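(* There exist universal constants $c_{10},c_{11}>0$ such that the following holds. Let $\kappa>0$, let $f\in L^\infty(\mathbb{T}^2)\cap H^1(\mathbb{T}^2)$, let $\mathcal{A}\subset H^1$ be the global attractor of the solution map $S(t)\colon H^1\to H^1$ of the critical SQG equation $\partial_t\theta+\mathcal{R}^\perp\theta\cdot\nabla\theta+\kappa\Lambda\theta=f$, and let $M_{\mathcal{A}}$ be the associated bound on the attractor. Set $$N=\left\lceil\left(c_{10}c_{11}\kappa^{-2}M_{\mathcal{A}}^2\right)^2\right\rceil .$$ Then the fractal dimension of $\mathcal{A}$ is finite, and $\dim_f(\mathcal{A})\le N$.
   Context: $\mathbb{T}^2=[-\pi,\pi]^2$ is the periodic box; $f=f(x)$ is time-independent; $f$, initial data and solutions have zero mean. $\Lambda^s$ is the Fourier multiplier with symbol $|k|^s$, $k\in\mathbb{Z}^2\setminus\{0\}$, $\Lambda=(-\Delta)^{1/2}$; $\mathcal{R}_j=\partial_j\Lambda^{-1}$; $\mathcal{R}^\perp\theta=(-\mathcal{R}_2\theta,\mathcal{R}_1\theta)$. $H^s$ is the Sobolev space of mean-zero periodic functions with norm $\|\phi\|_{H^s}=\|\Lambda^s\phi\|_{L^2}$. For $\theta_0\in H^1$ the equation with $\theta(\cdot,0)=\theta_0$ has a unique global solution $\theta\in L^\infty([0,\infty);H^1)\cap L^2_{loc}((0,\infty);H^{3/2})$, and $S(t)\theta_0:=\theta(\cdot,t)$. There is a ball $\mathcal{B}=\{\theta\in H^{3/2}\colon\|\theta\|_{H^{3/2}}\le M_{3/2,f}\}$,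 with $M_{3/2,f}$ depending only on $\kappa$ and $\|f\|_{L^\infty\cap H^1}=\|f\|_{L^\infty}+\|f\|_{H^1}$, which is absorbing: every trajectory $S(t)\theta_0$, $\theta_0\in H^1$, belongs to $\mathcal{B}$ for all sufficiently large $t$. The global attractor is $\mathcal{A}=\bigcap_{t>0}S(t)\mathcal{B}$; it is compact and connected in $H^1$, satisfies $S(t)\mathcal{A}=\mathcal{A}$ for all $t\in\mathbb{R}$ (for $t<0$, $S(t)$ on $\mathcal{A}$ is the inverse of $S(-t)|_{\mathcal{A}}$), and attracts every trajectory in $H^1$. $M_{\mathcal{A}}$ is a constant depending only on $\kappa$, $\|f\|_{L^\infty\cap H^1}$ and universal constants such that for every $\theta\in\mathcal{A}$: $\|\theta\|_{H^{3/2}}\le M_{\mathcal{A}}$ and $\frac1T\int_t^{t+T}\|S(\tau)\theta\|_{H^2}^2d\tau\le M_{\mathcal{A}}^2$ for all $T>0$, $t\in\mathbb{R}$. The fractal (box-counting) dimension of a compact set $Z\subset H^1$ is $\dim_f(Z)=\limsup_{r\to0}\frac{\log n_Z(r)}{\log(1/r)}$, where $n_Z(r)$ is the minimal number of balls in $H^1$ of radius $r$ needed to cover $Z$. ''Universal'' means independent of $\kappa$, $f$ and $\mathcal{A}$. *)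

(* Defs.v *)
From HB Require Import structures.
From mathcomp Require Import all_boot all_order all_algebra.
From mathcomp Require Import all_classical all_reals all_analysis.
From mathcomp Require Import measurable_realfun complex.
Set Implicit Arguments.
Unset Strict Implicit.
Unset Printing Implicit Defensive.
Import Order.TTheory GRing.Theory Num.Theory.
Import numFieldNormedType.Exports.
Local Open Scope classical_set_scope.
Local Open Scope ring_scope.
Local Open Scope complex_scope.

Section Torus.
Variable R : realType.

(* The torus is the box [-pi, pi]^2 with Lebesgue measure; a function on it is
   a function on the plane, of which only the values on the box matter. *)
Definition plane := (measurableTypeR R * measurableTypeR R)%type.

Definition box : set plane := `[- pi, pi]%classic `*` `[- pi, pi]%classic.

Lemma measurable_box : measurable box.
Proof. by apply: measurableX; exact: measurable_itv. Qed.

Definition lebesgue2 : {measure set plane -> \bar R} :=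
  (@lebesgue_measure R \x @lebesgue_measure R)%E.

Definition torus_measure : {measure set plane -> \bar R} :=
  mrestr lebesgue2 measurable_box.

(* Real measurable functions on the torus modulo almost everywhere equality. *)
Definition field := {mfun_ torus_measure, plane >-> R}.

Definition fun_of_field (phi : field) : plane -> R := repr phi.
Coercion fun_of_field : field >-> Funclass.

Definition L2norm (phi : field) : \bar R :=
  ('N[torus_measure]_2%:E [EFin \o (phi : plane -> R)])%E.

Definition Linfnorm (phi : field) : \bar R :=
  ('N[torus_measure]_+oo [EFin \o (phi : plane -> R)])%E.

Definition zerof : field := \pi_field%qT (cst 0 : {mfun plane >-> R}).

Definition subf (phi psi : field) : field :=
  \pi_field%qT (repr phi - repr psi).

Definition kdot (k : int * int) (x : plane) : R := k.1%:~R * x.1 + k.2%:~R * x.2.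

Definition kabs (k : int * int) : R := Num.sqrt (k.1%:~R ^+ 2 + k.2%:~R ^+ 2).

(* (2 pi)^-2 \int phi(x) e^{- i k.x} dx *)
Definition fourier (phi : plane -> R) (k : int * int) : R[i] :=
  ((2 * pi) ^- 2)%:C *
  ((\int[torus_measure]_x (phi x * cos (kdot k x)))
    -i* (\int[torus_measure]_x (phi x * sin (kdot k x)))).

(* [is_multiplier m phi psi]: psi is the L^2 function obtained from phi by the
   Fourier multiplier with symbol m. *)
Definition is_multiplier (m : int * int -> R[i]) (phi psi : field) : Prop :=
  (L2norm psi < +oo)%E /\ forall k, fourier psi k = m k * fourier phi k.

(* The L^2 function psi such that [is_multiplier m phi psi]; the zero function
   when m phi is not in L^2. *)
Definition multiplier (m : int * int -> R[i]) (phi : field) : field :=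
  xget zerof [set psi | is_multiplier m phi psi].

(* Only used on mean-zero functions, so that the value at k = 0 is irrelevant. *)
Definition Lambda_symbol (s : R) (k : int * int) : R[i] := (kabs k `^ s)%:C.

Definition Lambda (s : R) : field -> field := multiplier (Lambda_symbol s).

Definition partial1 : field -> field := multiplier (fun k => 0 +i* k.1%:~R).
Definition partial2 : field -> field := multiplier (fun k => 0 +i* k.2%:~R).

Definition riesz1 (phi : field) : field := partial1 (Lambda (- 1) phi).
Definition riesz2 (phi : field) : field := partial2 (Lambda (- 1) phi).

(* R^perp theta . grad theta, a pointwise product of L^2 functions *)
Definition advection (theta : field) (x : plane) : R :=
  - riesz2 theta x * partial1 theta x + riesz1 theta x * partial2 theta x.

(* The space H^s (s >= 0) of mean-zero functions and its norm, which is +oo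
   outside of H^s. *)
Definition Hs (s : R) : set field :=
  [set phi | [/\ (L2norm phi < +oo)%E, fourier phi (0, 0) = 0 &
                 exists psi, is_multiplier (Lambda_symbol s) phi psi]].

Definition Hnorm (s : R) (phi : field) : \bar R :=
  if pselect (Hs s phi) then L2norm (Lambda s phi) else +oo%E.

Definition H1dist (phi psi : field) : \bar R := Hnorm 1 (subf phi psi).

(* The topology of the (extended) H^1 distance. H1space has the same points as
   field; H^1 itself is an open and closed subset of it. *)
Definition H1space : Type := field.

Definition H1open (U : set H1space) : Prop :=
  forall phi, U phi -> exists2 r : R, 0 < r &
    forall psi, (H1dist psi phi < r%:E)%E -> U psi.

Let H1openT : H1open setT.
Proof. by move=> phi _; exists 1. Qed.

Let H1openI : setI_closed H1open.
Proof.
move=> U V oU oV phi [/oU[r r0 rU] /oV[s s0 sV]].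
exists (Num.min r s); first by rewrite lt_min r0 s0.
move=> psi h; split.
  by apply: rU; rewrite (lt_le_trans h)// lee_fin ge_min lexx.
by apply: sV; rewrite (lt_le_trans h)// lee_fin ge_min lexx orbT.
Qed.

Let H1open_bigU (I : Type) (F : I -> set H1space) :
  (forall i, H1open (F i)) -> H1open (\bigcup_i F i).
Proof.
move=> oF phi [i _ /oF[r r0 rF]]; exists r => // psi h.
by exists i => //; exact: rF.
Qed.

HB.instance Definition _ := Choice.on H1space.
HB.instance Definition _ :=
  isOpenTopological.Build H1space H1openT H1openI H1open_bigU.

Section SQG.
Variables (kappa : R) (f : field).

(* Fourier coefficient of f - R^perp theta . grad theta - kappa Lambda theta *)
Definition sqg_rhs (theta : field) (k : int * int) : R[i] :=
  fourier f k - fourier (advection theta) k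
  - kappa%:C * fourier (Lambda 1 theta) k.

Local Notation leb := (@lebesgue_measure R).

(* Solutions on [0, +oo[ in the class L^oo([0,oo); H^1) and
   L^2_loc((0,oo); H^{3/2}); the equation is tested against the characters
   e^{i k.x} and integrated in time. The coefficients of a solution being
   continuous in time, the essential H^1 bound holds at every time. *)
Definition is_solution (theta0 : field) (theta : R -> field) : Prop :=
  [/\ theta 0 = theta0,
      (forall t, 0 <= t -> Hs 1 (theta t)),
      (exists C : R, forall t, 0 <= t -> (Hnorm 1 (theta t) <= C%:E)%E),
      (forall a b : R, 0 < a -> a < b ->
        (\int[leb]_(t in `[a, b]) (Hnorm (3 / 2) (theta t) ^+ 2) < +oo)%E) &
      (forall k t, 0 <= t ->
        [/\ leb.-integrable `[0, t] (fun s => (complex.Re (sqg_rhs (theta s) k))%:E),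
            leb.-integrable `[0, t] (fun s => (complex.Im (sqg_rhs (theta s) k))%:E) &
            fourier (theta t) k = fourier theta0 k +
              ((\int[leb]_(s in `[0, t]) complex.Re (sqg_rhs (theta s) k))
               +i* (\int[leb]_(s in `[0, t]) complex.Im (sqg_rhs (theta s) k)))])].

(* S(t) theta0 is the value at time t >= 0 of the unique solution starting from
   theta0 in H^1. *)
Definition is_solution_map (S : R -> field -> field) : Prop :=
  forall theta0, Hs 1 theta0 ->
    is_solution theta0 (S ^~ theta0) /\
    forall theta, is_solution theta0 theta ->
      forall t, 0 <= t -> theta t = S t theta0.

End SQG.

Section Attractor.
Variable S : R -> field -> field.

Definition Hball32 (M : R) : set field :=
  [set phi | (Hnorm (3 / 2) phi <= M%:E)%E].

Definition absorbing (B : set field) : Prop :=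
  forall theta0, Hs 1 theta0 ->
    exists2 t0 : R, 0 <= t0 & forall t, t0 <= t -> B (S t theta0).

Definition attracting (A : set field) : Prop :=
  forall theta0, Hs 1 theta0 -> forall e : R, 0 < e ->
    exists2 t0 : R, 0 <= t0 & forall t, t0 <= t ->
      exists2 a, A a & (H1dist (S t theta0) a < e%:E)%E.

Record is_global_attractor (A : set field) : Prop := {
  attractor_def : exists2 M : R, absorbing (Hball32 M) &
    A = \bigcap_(t in [set t : R | 0 < t]) (S t @` Hball32 M);
  attractor_compact : compact (A : set H1space);
  attractor_connected : connected (A : set H1space);
  attractor_invariant : forall t, 0 <= t -> S t @` A = A;
  attractor_injective : forall t, 0 <= t -> {in A &, injective (S t)};
  attractor_attracting : attracting A }.

(* S(t) on A for every real t: for t < 0, the inverse of S(-t) restricted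
   to A. *)
Definition flow (A : set field) (t : R) (theta : field) : field :=
  if 0 <= t then S t theta
  else xget zerof [set phi | A phi /\ S (- t) phi = theta].

Definition is_attractor_bound (A : set field) (M : R) : Prop :=
  forall theta, A theta ->
    (Hnorm (3 / 2) theta <= M%:E)%E /\
    forall t T : R, 0 < T ->
      (T^-1%:E * \int[@lebesgue_measure R]_(tau in `[t, (t + T)%R])
         (Hnorm 2 (flow A tau theta) ^+ 2) <= (M ^+ 2)%:E)%E.

End Attractor.

(* Z is covered by n balls of H^1 of radius r *)
Definition H1_covered (Z : set field) (r : R) (n : nat) : Prop :=
  exists c : 'I_n -> field, (forall i, Hs 1 (c i)) /\
    forall phi, Z phi -> exists i, (H1dist phi (c i) < r%:E)%E.

Definition H1_covering_number (Z : set field) (r : R) : \bar R :=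
  ereal_inf [set n%:R%:E | n in H1_covered Z r].

Definition fractal_dim (Z : set field) : \bar R :=
  limf_esup
    (fun r : R => lne (H1_covering_number Z r) * ((ln r^-1)^-1)%:E)%E 0^'+.

End Torus.

(* Main.v *)
Require Import Defs.
From HB Require Import structures.
From mathcomp Require Import all_boot all_order all_algebra.
From mathcomp Require Import all_classical all_reals all_analysis.
From mathcomp Require Import measurable_realfun complex ring lra zify.

(** The solutions on the attractor stay in a ball of [H^(3/2)], of radius [M].
    In Fourier variables the difference [w] of two of them satisfies an equation
    with the dissipation [kappa |k| w_k] and with quadratic terms, which are sums
    over the triads of frequencies. The idea is to follow in time the sum of the
    [(1 + kappa t |k|) |w_k|^2]. The growth of the weight costs one half of
    the dissipation. The quadratic terms are absorbed by the rest, up to a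
    multiple of order [M^2 / kappa] of the sum itself: by the triadic estimate
    [trilinear], which is the product estimate of [H^(1/2) x H^(1/2)] into [L^2],
    and because the incompressibility of the velocity turns the most singular
    term into a commutator, [transport_commutator]. So after a time [T] of order
    [kappa / M^2] the distance of two trajectories in [L^2] has controlled their
    distance in [H^(1/2)]; this is [difference_smoothing].

    Consequently, the map [S(T)] sends a part of the attractor of diameter
    [delta] in [L^2] to a set whose frequencies above
    [n = O(M^2 / kappa^2)] vary by a small multiple of [delta], while the
    [d = O(n^2)] real coordinates of the lower ones range over a Euclidean ball of
    radius [O(delta)]. A grid cuts this ball into [2^(7 d)] pieces ([grid_code]),
    whence a partition of the image into as many parts of diameter [delta / 2].
    As [S(T)] maps the attractor onto itself, the diameter in [L^2] of the parts
    of a covering can be halved at will, their number being multiplied by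
    [2^(7 d)] each time ([colorable_step]). By interpolation with the
    bound in [H^(3/2)], a distance of order [r^3] in [L^2] gives a distance of
    order [r] in [H^1], so the dimension in [H^1] is at most [21 d], which is of
    order [(M^2 / kappa^2)^2], that is, of the form of [N].

    The equation is known through the Fourier coefficients of the solution
    only. The estimates therefore rest on a Fourier analysis on the torus, with
    uniqueness ([vanishing_ae0]), completeness ([riesz_fischer]) and the
    convolution formula for the nonlinear term ([advection_bilin]), and on the
    continuity in time of its coefficients, by which the integral equation can be
    differentiated ([coef_derive]). *)

Set Implicit Arguments.
Unset Strict Implicit.
Unset Printing Implicit Defensive.
Import Order.TTheory GRing.Theory Num.Theory.
Import numFieldNormedType.Exports.
Local Open Scope classical_set_scope.
Local Open Scope ring_scope.
Local Open Scope complex_scope.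

(** * Families with bounded sums *)

Section FamilySums.
Context {R : realType}.

(** That a nonnegative family, indexed by any set, has a sum of at most [B] can
    be said with finite sums only, so that summability need not be mentioned. *)
Definition sumbd (I : eqType) (a : I -> R) (B : R) :=
  forall s : seq I, uniq s -> \sum_(i <- s) a i <= B.

Lemma sumbd_ge0 (I : eqType) (a : I -> R) B : sumbd a B -> 0 <= B.
Proof. by move=> /(_ [::] isT); rewrite big_nil. Qed.

Lemma sumbd_le (I : eqType) (a b : I -> R) A B :
  (forall i, a i <= b i) -> A <= B -> sumbd b A -> sumbd a B.
Proof.
move=> ab AB bA s us; apply: le_trans AB; apply: le_trans (bA s us).
by apply: ler_sum => i _; exact: ab.
Qed.

Lemma sumbd_inj (I J : eqType) (h : J -> I) (a : I -> R) B :
  injective h -> sumbd a B -> sumbd (a \o h) B.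
Proof.
move=> hi aB s us; have := aB (map h s).
by rewrite map_inj_uniq// big_map => /(_ us).
Qed.

Lemma sumbdZ (I : eqType) (a : I -> R) B c :
  0 <= c -> sumbd a B -> sumbd (fun i => c * a i) (c * B).
Proof. by move=> c0 aB s us; rewrite -mulr_sumr ler_wpM2l// aB. Qed.

Lemma sumbdD (I : eqType) (a b : I -> R) A B :
  sumbd a A -> sumbd b B -> sumbd (fun i => a i + b i) (A + B).
Proof. by move=> aA bB s us; rewrite big_split lerD// ?aA ?bB. Qed.

Lemma ler_sum_sub (I : eqType) (a : I -> R) (s t : seq I) :
  (forall i, 0 <= a i) -> uniq s -> {subset s <= t} ->
  \sum_(i <- s) a i <= \sum_(i <- t) a i.
Proof.
move=> a0; elim: s t => [|x s ih] t /=; first by rewrite big_nil sumr_ge0.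
move=> /andP[xs us] st.
have xt : x \in t by rewrite st// mem_head.
rewrite (perm_big _ (perm_to_rem xt)) !big_cons lerD2l ih// => y ys.
have yx : y != x by apply: contraNneq xs => <-.
have : y \in t by rewrite st// inE ys orbT.
by rewrite (perm_mem (perm_to_rem xt)) inE (negPf yx).
Qed.

(** A finite set of pairs is contained in the product of its projections. *)
Lemma sumbd_pair (I J : eqType) (F : I * J -> R) (G : I -> R) B :
  (forall p, 0 <= F p) -> (forall i, sumbd (fun j => F (i, j)) (G i)) ->
  sumbd G B -> sumbd F B.
Proof.
move=> F0 FG GB s us.
pose s1 := undup (map fst s); pose s2 := undup (map snd s).
have : \sum_(p <- s) F p <= \sum_(p <- allpairs pair s1 s2) F p.
  apply: ler_sum_sub => // -[i j] ijs; apply/allpairsP; exists (i, j).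
  by split => //; rewrite mem_undup; apply/mapP; exists (i, j).
move/le_trans; apply; rewrite big_allpairs.
apply: le_trans (GB s1 (undup_uniq _)); apply: ler_sum => i _.
exact: FG (undup_uniq _).
Qed.

(** The common core of the Cauchy-Schwarz inequalities for sums and for
    integrals: the polynomial in [t] is the squared norm of [t a + b]. *)
Lemma discriminant_le (A B S : R) : 0 <= A -> 0 <= B ->
  (forall t : R, 0 <= A * t ^+ 2 + 2 * S * t + B) ->
  `|S| <= Num.sqrt A * Num.sqrt B.
Proof.
move=> A0 B0 h; rewrite -sqrtrM// -sqrtr_sqr ler_sqrt ?mulr_ge0//.
have [A00|Apos] := eqVneq A 0.
  suff -> : S = 0 by rewrite expr0n/= mulr_ge0.
  apply/eqP/negP => /negP S0; have := h (- (B + 1) / (2 * S)).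
  rewrite A00 mul0r add0r mulrCA divff ?mulf_neq0 ?pnatr_eq0// mulr1; lra.
have := h (- S / A); rewrite expr_div_n => h'.
have Ap : 0 < A by rewrite lt_neqAle eq_sym Apos.
have e : A * (A * ((- S) ^+ 2 / A ^+ 2) + 2 * S * (- S / A) + B)
   = A * B - S ^+ 2 by field.
have : 0 <= A * (A * ((- S) ^+ 2 / A ^+ 2) + 2 * S * (- S / A) + B).
  exact: mulr_ge0.
by rewrite e subr_ge0.
Qed.

Lemma sum_cauchy_schwarz (I : Type) (s : seq I) (a b : I -> R) :
  `|\sum_(i <- s) a i * b i| <=
    Num.sqrt (\sum_(i <- s) a i ^+ 2) * Num.sqrt (\sum_(i <- s) b i ^+ 2).
Proof.
apply: discriminant_le => [||t]; try by apply: sumr_ge0 => i _; exact: sqr_ge0.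
have -> : (\sum_(i <- s) a i ^+ 2) * t ^+ 2 + 2 * (\sum_(i <- s) a i * b i) * t
   + \sum_(i <- s) b i ^+ 2 = \sum_(i <- s) (a i * t + b i) ^+ 2.
  rewrite mulr_suml mulr_sumr mulr_suml -!big_split/=.
  by apply: eq_bigr => i _; ring.
by apply: sumr_ge0 => i _; exact: sqr_ge0.
Qed.

Lemma sumbd_cauchy_schwarz (I : eqType) (a b : I -> R) A B :
  sumbd (fun i => a i ^+ 2) A -> sumbd (fun i => b i ^+ 2) B ->
  sumbd (fun i => a i * b i) (Num.sqrt A * Num.sqrt B).
Proof.
move=> aA bB s us; apply: le_trans (ler_norm _) _.
apply: le_trans (sum_cauchy_schwarz _ _ _) _.
by apply: ler_pM; rewrite ?sqrtr_ge0 ?ler_wsqrtr// ?aA ?bB.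
Qed.

End FamilySums.

(** * The lattice of frequencies and the triadic estimate *)

Section Lattice.
Context {R : realType}.
Local Notation Z2 := (int * int)%type.
Local Notation kabs := (@kabs R).
Implicit Types (j k l : Z2) (n : nat).

(** Truncations use this norm, since its balls are boxes; the Euclidean norm
    [kabs] is between it and its double. *)
Definition supnorm k : nat := maxn `|k.1|%N `|k.2|%N.

Definition irange n : seq int := [seq (m%:Z - n%:Z) | m <- iota 0 (2 * n).+1].

(** An exhaustion of the lattice by finite sets that are symmetric about the
    origin. *)
Definition zbox n : seq Z2 := allpairs pair (irange n) (irange n).

Lemma mem_irange n (i : int) : (i \in irange n) = (`|i|%N <= n)%N.
Proof.
apply/mapP/idP => [[m]|].
  rewrite mem_iota add0n ltnS => /andP[_ mn] ->; lia.
move=> ni; exists `|(i + n%:Z)%R|%N; rewrite ?mem_iota; lia.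
Qed.

Lemma irange_uniq n : uniq (irange n).
Proof. by rewrite map_inj_uniq ?iota_uniq// => x y /addIr[]. Qed.

Lemma mem_zbox n k : (k \in zbox n) = (supnorm k <= n)%N.
Proof.
rewrite /supnorm geq_max -!mem_irange; apply/allpairsP/andP.
  by move=> [[i j] [/= ? ? ->]].
by case: k => i j /= [? ?]; exists (i, j).
Qed.

Lemma zbox_uniq n : uniq (zbox n).
Proof.
apply: allpairs_uniq; try exact: irange_uniq.
by move=> [a b] [c d] _ _.
Qed.

Lemma size_zbox n : size (zbox n) = ((2 * n).+1 * (2 * n).+1)%N.
Proof. by rewrite size_allpairs size_map size_iota. Qed.

Lemma sub_zbox m n : (m <= n)%N -> {subset zbox m <= zbox n}.
Proof. by move=> mn k; rewrite !mem_zbox => /leq_trans; exact. Qed.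

Lemma seq_sub_zbox (s : seq Z2) : exists n, {subset s <= zbox n}.
Proof.
exists (\max_(k <- s) supnorm k)%N => k ks.
by rewrite mem_zbox; apply: (@leq_bigmax_seq _ _ predT).
Qed.

Lemma sumbd_zbox (a : Z2 -> R) B : (forall k, 0 <= a k) ->
  (forall n, \sum_(k <- zbox n) a k <= B) -> sumbd a B.
Proof.
move=> a0 aB s us; have [n sn] := seq_sub_zbox s.
exact: le_trans (ler_sum_sub a0 us sn) (aB n).
Qed.

Lemma supnorm0 : supnorm 0 = 0%N. Proof. by []. Qed.

Lemma supnorm_gt0 k : (0 < supnorm k)%N = (k != 0).
Proof.
rewrite /supnorm leq_max !absz_gt0; case: k => a b /=.
by rewrite xpair_eqE negb_and.
Qed.

Lemma supnormN k : supnorm (- k) = supnorm k.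
Proof. by rewrite /supnorm/= !abszN. Qed.

Lemma supnormD j k : (supnorm (j + k)%R <= supnorm j + supnorm k)%N.
Proof. by case: j k => [a b] [c d]; rewrite /supnorm/=; lia. Qed.

Lemma kabs_ge0 k : 0 <= kabs k. Proof. exact: sqrtr_ge0. Qed.

Lemma kabs0 : kabs 0 = 0.
Proof. by rewrite /Defs.kabs/= !expr0n addr0 sqrtr0. Qed.

Lemma sqr_kabs k : kabs k ^+ 2 = k.1%:~R ^+ 2 + k.2%:~R ^+ 2.
Proof. by rewrite sqr_sqrtr// addr_ge0// sqr_ge0. Qed.

Lemma kabsN k : kabs (- k) = kabs k.
Proof. by rewrite /Defs.kabs/= !rmorphN/= !sqrrN. Qed.

Lemma absz_sqr (i : int) : (`|i|%N%:R : R) ^+ 2 = i%:~R ^+ 2.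
Proof. by rewrite -[X in X ^+ 2]/(`|i|%N%:~R) abszE intr_norm real_normK// num_real. Qed.

Lemma supnorm_kabs k : (supnorm k)%:R <= kabs k.
Proof.
rewrite -[leLHS]ger0_norm// -sqrtr_sqr ler_wsqrtr// /supnorm.
case: leqP => _; rewrite absz_sqr ?lerDr ?lerDl ?sqr_ge0//.
Qed.

Lemma sqr_kabs_le k : kabs k ^+ 2 <= 2 * (supnorm k)%:R ^+ 2.
Proof.
rewrite sqr_kabs -!absz_sqr /supnorm mulr2n mulrDl mul1r.
by apply: lerD; rewrite ler_sqr ?nnegrE// ler_nat leq_max leqnn ?orbT.
Qed.

Lemma kabs_gt0 k : k != 0 -> 0 < kabs k.
Proof. by rewrite -supnorm_gt0 => k0; apply: lt_le_trans (supnorm_kabs k); rewrite ltr0n. Qed.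

Lemma kabs_ge1 k : k != 0 -> 1 <= kabs k.
Proof. by rewrite -supnorm_gt0 => k0; apply: le_trans (supnorm_kabs k); rewrite ler1n. Qed.

(** Up to the factor [1 / |j|], the coefficient with which the frequency [j] of
    the velocity transports the frequency [l]. It vanishes on parallel
    frequencies, and this is the incompressibility of the velocity. *)
Definition cross j l : R := j.2%:~R * l.1%:~R - j.1%:~R * l.2%:~R.

Lemma cross_le j l : `|cross j l| <= kabs j * kabs l.
Proof.
rewrite /cross /Defs.kabs -sqrtrM ?addr_ge0 ?sqr_ge0//.
rewrite -sqrtr_sqr ler_wsqrtr//.
set a := j.1%:~R; set b := j.2%:~R; set c := l.1%:~R; set d := l.2%:~R.
have -> : (a ^+ 2 + b ^+ 2) * (c ^+ 2 + d ^+ 2)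
  = (b * c - a * d) ^+ 2 + (a * c + b * d) ^+ 2 by ring.
by rewrite lerDl sqr_ge0.
Qed.

Lemma dot_le j l : j.1%:~R * l.1%:~R + j.2%:~R * l.2%:~R <= kabs j * kabs l.
Proof.
rewrite /Defs.kabs -sqrtrM ?addr_ge0 ?sqr_ge0//.
apply: le_trans (ler_norm _) _; rewrite -sqrtr_sqr ler_wsqrtr//.
set a := j.1%:~R; set b := j.2%:~R; set c := l.1%:~R; set d := l.2%:~R.
have -> : (a ^+ 2 + b ^+ 2) * (c ^+ 2 + d ^+ 2)
  = (a * c + b * d) ^+ 2 + (b * c - a * d) ^+ 2 by ring.
by rewrite lerDl sqr_ge0.
Qed.

Lemma kabsD j k : kabs (j + k) <= kabs j + kabs k.
Proof.
rewrite -(@ler_pXn2r _ 2)// ?nnegrE ?addr_ge0 ?kabs_ge0//.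
rewrite sqrrD !sqr_kabs/= !rmorphD/=.
have := dot_le j k; nra.
Qed.

Lemma kabsB j k : `|kabs j - kabs k| <= kabs (j - k).
Proof.
rewrite ler_norml lerBlDl lerNl opprB lerBlDl; apply/andP; split.
  have := kabsD j (k - j); rewrite addrC subrK -(kabsN (j - k)) opprB addrC.
  by rewrite [k + _]addrC.
by have := kabsD k (j - k); rewrite addrC subrK.
Qed.

(** Each square shell of radius [m] has [8 m] points. *)
Lemma sum_inv_supnorm n :
  \sum_(k <- zbox n) (if (0 < supnorm k)%N then (supnorm k)%:R^-1 else 0) <= 8 * n%:R :> R.
Proof.
elim: n => [|n ih].
  rewrite mulr0 big_seq big1// => k; rewrite mem_zbox leqn0 => /eqP ->//.
set F := fun k => _; rewrite -/F in ih *.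
rewrite (bigID (fun k => (supnorm k <= n)%N))/=.
have fl : perm_eq [seq k <- zbox n.+1 | (supnorm k <= n)%N] (zbox n).
  apply: uniq_perm; rewrite ?filter_uniq ?zbox_uniq// => k.
  by rewrite mem_filter !mem_zbox; case: leqP => // /leqW ->.
rewrite -big_filter (perm_big _ fl)/=.
rewrite -[n.+1]addn1 natrD mulrDr mulr1 lerD//.
rewrite addn1 -big_filter big_seq.
rewrite (eq_bigr (fun=> n.+1%:R^-1 : R)); last first.
  move=> k; rewrite mem_filter mem_zbox -ltnNge => /andP[n1 n2].
  by have -> : supnorm k = n.+1 by apply/eqP; rewrite eqn_leq n2.
rewrite -big_seq big_const_seq count_predT iter_addr addr0.
have -> : size [seq i <- zbox n.+1 | ~~ (supnorm i <= n)%N] = (8 * n.+1)%N.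
  have := size_zbox n.+1.
  rewrite -(count_predC (fun k => (supnorm k <= n)%N)) -size_filter (perm_size fl).
  by rewrite size_filter size_zbox; set c := count _ _; nia.
by rewrite -[leLHS]mulr_natr natrM mulrCA mulVf ?mulr1.
Qed.

Lemma sumbd_inv_kabs n :
  sumbd (fun k => if (0 < supnorm k <= n)%N then (kabs k)^-1 else 0) (8 * n%:R).
Proof.
have h k : 0 <= (if (0 < supnorm k <= n)%N then (kabs k)^-1 else 0).
  by case: ifP => // _; rewrite invr_ge0 kabs_ge0.
move=> s us; apply: le_trans (sum_inv_supnorm n).
apply: (@le_trans _ _
  (\sum_(k <- s | (supnorm k <= n)%N) if (0 < supnorm k <= n)%N then (kabs k)^-1 else 0)).
  rewrite [leLHS](bigID (fun k => (supnorm k <= n)%N))/= gerDl.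
  by rewrite big1// => k /negPf ->; rewrite andbF.
rewrite -big_filter.
apply: (@le_trans _ _
  (\sum_(k <- zbox n) if (0 < supnorm k <= n)%N then (kabs k)^-1 else 0)).
  apply: ler_sum_sub => //; first exact: filter_uniq.
  by move=> k; rewrite mem_filter mem_zbox => /andP[].
rewrite big_seq [leRHS]big_seq; apply: ler_sum => k; rewrite mem_zbox => ->.
rewrite andbT; case: ifP => // k0.
by rewrite lef_pV2 ?supnorm_kabs// posrE ?ltr0n// kabs_gt0// -supnorm_gt0.
Qed.

(** Cauchy-Schwarz with the weight [|j|]: when [k] is fixed, the sum of the
    [1 / |j|] over the frequencies [j] below [k] is of order [|k|], because the
    dimension is two. *)
Lemma trilinear_half (a b c : Z2 -> R) A B C :
  a 0 = 0 -> (forall k, 0 <= b k) ->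
  sumbd (fun k => kabs k * a k ^+ 2) A -> sumbd (fun k => kabs k * b k ^+ 2) B ->
  sumbd (fun k => c k ^+ 2) C ->
  sumbd (fun p : Z2 * Z2 => if (supnorm p.1 <= supnorm p.2)%N then
     a p.1 * b p.2 * c (p.1 + p.2) else 0)
    (Num.sqrt (A * C) * Num.sqrt (8 * B)).
Proof.
move=> a0 b0 aA bB cC.
(* The two factors of the Cauchy-Schwarz inequality. *)
pose x (p : Z2 * Z2) := Num.sqrt (kabs p.1) * a p.1 * c (p.1 + p.2).
pose y (p : Z2 * Z2) :=
  if (0 < supnorm p.1 <= supnorm p.2)%N then b p.2 / Num.sqrt (kabs p.1) else 0.
apply: (@sumbd_le _ _ _ (fun p => x p * y p) (Num.sqrt (A * C) * Num.sqrt (8 * B))) => //.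
  move=> [j k]; rewrite /x /y /=; case: (posnP (supnorm j)) => [j0|jpos] /=.
    have -> : j = 0 by apply/eqP; move: j0; rewrite -[_ == _]negbK -supnorm_gt0 => ->.
    by rewrite a0 !(mul0r, mulr0).
  case: ifP => //; last by rewrite mulr0.
  move=> _; set q := Num.sqrt _.
  have q0 : q != 0 by rewrite gt_eqF// sqrtr_gt0 kabs_gt0// -supnorm_gt0.
  by rewrite le_eqVlt; apply/orP; left; apply/eqP; field.
apply: sumbd_cauchy_schwarz.
  apply: (@sumbd_pair _ _ _ _ (fun j => C * (kabs j * a j ^+ 2))).
  - by move=> p; exact: sqr_ge0.
  - move=> j; rewrite mulrC.
    apply: (@sumbd_le _ _ _ (fun k => kabs j * a j ^+ 2 * (c (j + k)) ^+ 2) _ _ _ (lexx _)).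
      by move=> k; rewrite /x/= !exprMn sqr_sqrtr ?kabs_ge0.
    apply: sumbdZ; first by rewrite mulr_ge0 ?sqr_ge0 ?kabs_ge0.
    by apply: (@sumbd_inj _ _ _ (fun k => j + k)) cC; exact: addrI.
  - by rewrite mulrC; apply: sumbdZ => //; exact: sumbd_ge0 cC.
(* The second factor has to be summed over [j] first. *)
suff : sumbd (fun p : Z2 * Z2 => y (p.2, p.1) ^+ 2) (8 * B).
  move/(@sumbd_inj _ _ _ (fun p : Z2 * Z2 => (p.2, p.1))).
  have e : injective (fun p : Z2 * Z2 => (p.2, p.1)) by move=> [? ?] [? ?] [-> ->].
  move=> /(_ e); apply: sumbd_le => // -[j k] //=.
apply: (@sumbd_pair _ _ _ _ (fun k => 8 * (kabs k * b k ^+ 2))).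
- by move=> p; exact: sqr_ge0.
- move=> k /=.
  apply: (@sumbd_le _ _ _ (fun j => b k ^+ 2 *
      (if (0 < supnorm j <= supnorm k)%N then (kabs j)^-1 else 0)) (b k ^+ 2 * (8 * (supnorm k)%:R))).
  + move=> j; rewrite /y /=; case: ifP => _; last by rewrite expr0n mulr0.
    by rewrite expr_div_n sqr_sqrtr// kabs_ge0.
  + by rewrite mulrCA (mulrC (b k ^+ 2)) ler_wpM2l// ler_wpM2r ?sqr_ge0 ?supnorm_kabs.
  + by apply: sumbdZ (sumbd_inv_kabs _); exact: sqr_ge0.
- exact: sumbdZ.
Qed.

(** This is the product estimate of [H^(1/2) x H^(1/2)] into [L^2], which
    follows from the embedding of [H^(1/2)] in [L^4], but with absolute values
    inside of the sum. Here each triad is counted according to which of the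
    frequencies [j] and [k] is the larger one. *)
Lemma trilinear (a b c : Z2 -> R) A B C :
  (forall k, 0 <= a k) -> (forall k, 0 <= b k) -> (forall k, 0 <= c k) ->
  a 0 = 0 -> b 0 = 0 ->
  sumbd (fun k => kabs k * a k ^+ 2) A -> sumbd (fun k => kabs k * b k ^+ 2) B ->
  sumbd (fun k => c k ^+ 2) C ->
  sumbd (fun p : Z2 * Z2 => a p.1 * b p.2 * c (p.1 + p.2))
    (6 * (Num.sqrt A * Num.sqrt B * Num.sqrt C)).
Proof.
move=> a0 b0 c0 a00 b00 aA bB cC.
have h1 := trilinear_half a00 b0 aA bB cC.
have h2 := trilinear_half b00 a0 bB aA cC.
have e : injective (fun p : Z2 * Z2 => (p.2, p.1)) by move=> [? ?] [? ?] [-> ->].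
have {h2}h2 := sumbd_inj e h2.
apply: sumbd_le (sumbdD h1 h2).
  move=> [j k] /=; rewrite [k + j]addrC [b k * a j]mulrC.
  have p : 0 <= a j * b k * c (j + k) by rewrite !mulr_ge0.
  case: (leqP (supnorm j)) => [_|/ltnW ->]; last by rewrite add0r.
  by rewrite lerDl; case: ifP.
have A0 := sumbd_ge0 aA; have B0 := sumbd_ge0 bB; have C0 := sumbd_ge0 cC.
rewrite !sqrtrM//.
have -> : Num.sqrt A * Num.sqrt C * (Num.sqrt 8 * Num.sqrt B) +
  Num.sqrt B * Num.sqrt C * (Num.sqrt 8 * Num.sqrt A) =
  (2 * Num.sqrt 8) * (Num.sqrt A * Num.sqrt B * Num.sqrt C) by ring.
rewrite ler_wpM2r ?mulr_ge0 ?sqrtr_ge0//.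
rewrite (_ : 6 = 2 * 3 :> R) ?ler_wpM2l//; last by ring.
rewrite -[3]ger0_norm// -sqrtr_sqr ler_wsqrtr//; lra.
Qed.

End Lattice.

(** * Uniqueness of Fourier coefficients *)

Section TorusMeasure.
Context {R : realType}.
Local Notation mu := (torus_measure R).
Local Notation leb := (@lebesgue_measure R).
Local Notation I := (`[- pi, pi]%classic : set (measurableTypeR R)).

Lemma leb_circle : leb I = (2 * pi)%:E.
Proof.
rewrite lebesgue_measure_itv/= lte_fin gtrN ?pi_gt0// -EFinB; congr (_%:E).
by rewrite opprK mulr2n mulrDl mul1r.
Qed.

Lemma leb_circle_fin : (leb I < +oo)%E.
Proof. by rewrite leb_circle ltry. Qed.

Lemma measurable_circle : measurable I. Proof. exact: measurable_itv. Qed.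

Definition circle_measure : {finite_measure set (measurableTypeR R) -> \bar R} :=
  @mfrestr _ (measurableTypeR R) R I leb measurable_circle leb_circle_fin.
Local Notation nu := circle_measure.

Lemma torus_measureX (X : set (plane R)) : measurable X -> (nu \x nu)%E X = mu X.
Proof.
move=> mX; apply: (@product_measure_unique _ _ _ _ _ nu nu mu) => // A B mA mB.
rewrite /torus_measure /= /mrestr /box -setXI /lebesgue2.
by rewrite product_measure1E//; apply: measurableI => //; exact: measurable_itv.
Qed.

Lemma torus_measureT : mu setT = ((2 * pi) ^+ 2)%:E.
Proof.
rewrite /torus_measure /= /mrestr setTI /box /lebesgue2 product_measure1E//=.
by rewrite leb_circle -EFinM expr2.
Qed.

Lemma torus_measure_lty : (mu setT < +oo)%E.
Proof. by rewrite torus_measureT ltry. Qed.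

Lemma circle_integral (f : R -> R) :
  measurable_fun setT f -> (exists C : R, forall x, `|f x| <= C) ->
  (\int[nu]_x (f x)%:E = \int[leb]_(x in I) (f x)%:E)%E.
Proof.
move=> mf [C fC].
have mI : measurable I by exact: measurable_itv.
rewrite (@negligible_integral _ _ _ nu setT (~` I))//.
- rewrite setTD setCK; apply: eq_measure_integral => A mA AI.
  by rewrite /circle_measure /= /mfrestr /mrestr setIidl.
- exact: measurableC.
- apply: measurable_bounded_integrable => //.
    by rewrite /circle_measure /= /mfrestr /mrestr setTI leb_circle_fin.
  by exists C; split => [|M CM x _ /=]; [exact: num_real|exact: le_trans (fC x) (ltW CM)].
- by rewrite /circle_measure /= /mfrestr /mrestr setICl measure0.
Qed.

Lemma sin_intpi (n : int) : sin (n%:~R * pi) = 0 :> R.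
Proof.
have h (m : nat) : sin (m%:R * pi) = 0 :> R.
  elim: m => [|m ih]; first by rewrite mul0r sin0.
  by rewrite -addn1 natrD mulrDl mul1r sinDpi ih oppr0.
case: n => m; first exact: h.
by rewrite NegzE rmorphN mulNr sinN h oppr0.
Qed.

Lemma circle_integral_derive (F f : R -> R) :
  (forall x, is_derive x (1 : R) F (f x)) -> continuous f -> F pi = F (- pi) ->
  (exists C : R, forall x, `|f x| <= C) -> (\int[nu]_x (f x)%:E = 0)%E.
Proof.
move=> dF cf Fpi bf; rewrite circle_integral//; last exact: continuous_measurable_fun.
have cF : continuous F.
  by move=> x; apply/differentiable_continuous/derivable1_diffP; case: (dF x).
rewrite (@continuous_FTC2 _ f F) ?Fpi ?subee//.
- by rewrite gtrN ?pi_gt0.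
- exact: continuous_subspaceT.
- split; first by move=> x _; case: (dF x).
    by apply: cvg_at_right_filter; exact: cF.
  by apply: cvg_at_left_filter; exact: cF.
- by move=> x _; rewrite derive1E; apply: derive_val.
Qed.

Lemma continuous_scale (g : R -> R) (a : R) :
  continuous g -> continuous (fun x : R => g (a * x)).
Proof.
move=> cg x; apply: continuous_comp; last exact: cg.
by apply: continuousM => //; exact: cst_continuous.
Qed.

Lemma circle_integral_cos (n : int) : n != 0 ->
  (\int[nu]_x (cos (n%:~R * x))%:E = 0)%E.
Proof.
move=> n0; have n0' : n%:~R != 0 :> R by rewrite intr_eq0.
apply: (@circle_integral_derive (fun x : R => sin (n%:~R * x) / n%:~R)).
- move=> x; apply: trigger_derive; rewrite /GRing.scale/= mulr0 mulr0 add0r mulr1.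
  by rewrite mulrCA mulVf ?mulr1.
- by apply: continuous_scale; exact: continuous_cos.
- by rewrite mulrN sinN sin_intpi oppr0.
- by exists 1 => x; exact: cos_max.
Qed.

Lemma circle_integral_sin (n : int) : (\int[nu]_x (sin (n%:~R * x))%:E = 0)%E.
Proof.
have [->|n0] := eqVneq n 0.
  by under eq_integral do rewrite mul0r sin0; rewrite integral0.
have n0' : n%:~R != 0 :> R by rewrite intr_eq0.
apply: (@circle_integral_derive (fun x : R => - cos (n%:~R * x) / n%:~R)).
- move=> x; apply: trigger_derive; rewrite /GRing.scale/= mulr0 mulr0 add0r mulr1.
  by rewrite mulNr opprK mulrCA mulVf ?mulr1.
- by apply: continuous_scale; exact: continuous_sin.
- by rewrite mulrN cosN.
- by exists 1 => x; exact: sin_max.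
Qed.

Definition tbounded (f : plane R -> R) :=
  measurable_fun setT f /\ exists C : R, forall x, `|f x| <= C.

Lemma tbounded_integrable (m : {measure set (plane R) -> \bar R}) f :
  (m setT < +oo)%E -> tbounded f -> m.-integrable setT (EFin \o f).
Proof.
move=> moo [mf [C fC]]; apply: measurable_bounded_integrable => //.
by exists C; split => [|M CM x _ /=]; [exact: num_real|exact: le_trans (fC x) (ltW CM)].
Qed.

Lemma torus_integral_prod (f g : R -> R) :
  continuous f -> continuous g ->
  (exists C : R, forall x, `|f x| <= C) -> (exists C : R, forall x, `|g x| <= C) ->
  \int[mu]_x (f x.1 * g x.2) = (\int[nu]_x f x) * (\int[nu]_x g x).
Proof.
move=> cf cg bf bg.
have mf := continuous_measurable_fun cf; have mg := continuous_measurable_fun cg.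
have tb : tbounded (fun x : plane R => f x.1 * g x.2).
  split.
    apply: measurable_funM; first exact: (measurableT_comp mf measurable_fst).
    exact: (measurableT_comp mg measurable_snd).
  have [C fC] := bf; have [D gD] := bg; exists (C * D) => x.
  by rewrite normrM ler_pM.
have bnd1 (h : R -> R) : continuous h -> (exists C : R, forall x, `|h x| <= C) ->
    nu.-integrable setT (EFin \o h).
  move=> ch [C hC]; apply: measurable_bounded_integrable => //.
  - by rewrite ltey_eq fin_num_measure.
  - exact: continuous_measurable_fun.
  by exists C; split => [|M CM x _ /=]; [exact: num_real|exact: le_trans (hC x) (ltW CM)].
have If := bnd1 _ cf bf; have Ig := bnd1 _ cg bg.
rewrite [LHS]/Rintegral.
rewrite -[in LHS](@eq_measure_integral _ _ _ setT mu (nu \x nu)%E); last first.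
  by move=> A mA _; exact: torus_measureX.
rewrite -integral12_prod_meas1; last first.
  apply: tbounded_integrable => //.
  rewrite [X in (X < _)%E](_ : _ = mu setT) ?torus_measure_lty//.
  exact: torus_measureX.
rewrite /fubini_F /=.
under eq_integral => x _.
  under eq_integral do rewrite EFinM.
  rewrite (integralZl _ Ig)//.
  over.
rewrite /Rintegral.
have /fineK <- : (\int[nu]_x (g x)%:E)%E \is a fin_num by exact: integrable_fin_num.
by rewrite integralZr//= fineM// integrable_fin_num.
Qed.

Lemma torus_integral_kdot (k : int * int) :
  \int[mu]_x cos (kdot k x) = (if k == 0 then (2 * pi) ^+ 2 else 0) /\
  \int[mu]_x sin (kdot k x) = 0.
Proof.
have [cc cs] := (@continuous_cos R, @continuous_sin R).
have bc (n : int) : exists C : R, forall x, `|cos (n%:~R * x)| <= C.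
  by exists 1 => x; exact: cos_max.
have bs (n : int) : exists C : R, forall x, `|sin (n%:~R * x)| <= C.
  by exists 1 => x; exact: sin_max.
have kc (n : int) := continuous_scale (a := n%:~R) cc.
have ks (n : int) := continuous_scale (a := n%:~R) cs.
have tb (f g : R -> R) : continuous f -> continuous g ->
    (exists C : R, forall x, `|f x| <= C) -> (exists C : R, forall x, `|g x| <= C) ->
    mu.-integrable setT (EFin \o (fun x : plane R => f x.1 * g x.2)).
  move=> cf cg [C fC] [D gD]; apply: tbounded_integrable; first exact: torus_measure_lty.
  have mf := continuous_measurable_fun cf; have mg := continuous_measurable_fun cg.
  split.
    apply: measurable_funM; first exact: (measurableT_comp mf measurable_fst).
    exact: (measurableT_comp mg measurable_snd).
  by exists (C * D) => x; rewrite normrM ler_pM.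
have tcc := tb _ _ (kc k.1) (kc k.2) (bc _) (bc _).
have tss := tb _ _ (ks k.1) (ks k.2) (bs _) (bs _).
have tcs := tb _ _ (kc k.1) (ks k.2) (bc _) (bs _).
have tsc := tb _ _ (ks k.1) (kc k.2) (bs _) (bc _).
have Is (n : int) : \int[nu]_x sin (n%:~R * x) = 0.
  by rewrite /Rintegral circle_integral_sin.
have Ic (n : int) : n != 0 -> \int[nu]_x cos (n%:~R * x) = 0.
  by move=> n0; rewrite /Rintegral circle_integral_cos.
split.
  case: eqP => [->|/eqP k0].
    under eq_Rintegral do rewrite /kdot/= !mul0r addr0 cos0.
    by rewrite Rintegral_cst//= mul1r torus_measureT.
  under eq_Rintegral do rewrite /kdot cosD.
  rewrite RintegralB//.
  rewrite (torus_integral_prod (kc k.1) (kc k.2) (bc _) (bc _)).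
  rewrite (torus_integral_prod (ks k.1) (ks k.2) (bs _) (bs _)) !Is mul0r subr0.
  have [k1|/Ic ->] := eqVneq k.1 0; last by rewrite mul0r.
  have [k2|/Ic ->] := eqVneq k.2 0; last by rewrite mulr0.
  by case/eqP: k0; rewrite [k]surjective_pairing k1 k2.
under eq_Rintegral do rewrite /kdot sinD.
rewrite RintegralD//.
rewrite (torus_integral_prod (ks k.1) (kc k.2) (bs _) (bc _)).
by rewrite (torus_integral_prod (kc k.1) (ks k.2) (bc _) (bs _)) !Is mul0r mulr0 addr0.
Qed.

Lemma continuous_kdot_measurable (h : R -> R) k : continuous h ->
  measurable_fun setT (fun x : plane R => h (kdot k x)).
Proof.
move=> ch; apply: (measurableT_comp (continuous_measurable_fun ch)).
apply: measurable_funD; apply: measurable_funM => //.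
Qed.

Lemma kdotD j k (x : plane R) : kdot (j + k) x = kdot j x + kdot k x.
Proof. by rewrite /kdot/= !rmorphD/=; ring. Qed.

Lemma kdotN k (x : plane R) : kdot (- k) x = - kdot k x.
Proof. by rewrite /kdot/= !rmorphN/=; ring. Qed.

Lemma tbounded_cosk k : tbounded (fun x : plane R => cos (kdot k x)).
Proof.
split; last by exists 1 => x; exact: cos_max.
by apply: continuous_kdot_measurable; exact: continuous_cos.
Qed.

Lemma tbounded_sink k : tbounded (fun x : plane R => sin (kdot k x)).
Proof.
split; last by exists 1 => x; exact: sin_max.
by apply: continuous_kdot_measurable; exact: continuous_sin.
Qed.

Lemma tboundedD f g : tbounded f -> tbounded g -> tbounded (fun x => f x + g x).
Proof.
move=> [mf [C fC]] [mg [D gD]]; split; first exact: measurable_funD.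
by exists (C + D) => x; apply: le_trans (ler_normD _ _) _; rewrite lerD.
Qed.

Lemma tboundedM f g : tbounded f -> tbounded g -> tbounded (fun x => f x * g x).
Proof.
move=> [mf [C fC]] [mg [D gD]]; split; first exact: measurable_funM.
by exists (C * D) => x; rewrite normrM ler_pM.
Qed.

Lemma tbounded_cst c : tbounded (fun=> c).
Proof. by split; [exact: measurable_cst|exists `|c|]. Qed.

Lemma tbounded_sum (J : Type) (s : seq J) (F : J -> plane R -> R) :
  (forall j, tbounded (F j)) -> tbounded (fun x => \sum_(j <- s) F j x).
Proof.
move=> bF; elim: s => [|j s ih].
  by under eq_fun do rewrite big_nil; exact: tbounded_cst.
by under eq_fun do rewrite big_cons; exact: tboundedD.
Qed.

Definition tint (f : plane R -> R) := mu.-integrable setT (EFin \o f).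

Lemma tint_measurable f : tint f -> measurable_fun setT f.
Proof. by move=> /measurable_int/measurable_EFinP. Qed.

Lemma tint_bounded f : tbounded f -> tint f.
Proof. by apply: tbounded_integrable; exact: torus_measure_lty. Qed.

Lemma tint_le (f g : plane R -> R) : measurable_fun setT f -> (forall x, `|f x| <= g x) ->
  tint g -> tint f.
Proof.
move=> mf fg ig; apply: le_integrable ig => //; first exact/measurable_EFinP.
by move=> x _ /=; rewrite lee_fin (le_trans (fg x))// ler_norm.
Qed.

Lemma tintZ c f : tint f -> tint (fun x => c * f x).
Proof. by move=> /(integrableZl measurableT c). Qed.

Lemma tintD f g : tint f -> tint g -> tint (fun x => f x + g x).
Proof. by move=> i1 i2; have := integrableD measurableT i1 i2. Qed.

Lemma tintM f g : tbounded f -> tint g -> tint (fun x => f x * g x).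
Proof.
move=> [mf [C fC]] ig; apply: (@tint_le _ (fun x => C * `|g x|)).
- by apply: measurable_funM => //; exact: tint_measurable.
- by move=> x; rewrite normrM ler_wpM2r.
- by apply: tintZ; have := integrable_abse ig.
Qed.

Definition sqint (f : plane R -> R) :=
  measurable_fun setT f /\ tint (fun x => f x ^+ 2).

Lemma sqint_mul f g : sqint f -> sqint g -> tint (fun x => f x * g x).
Proof.
move=> [mf sf] [mg sg]; apply: tint_le (tintD sf sg); first exact: measurable_funM.
move=> x; have := sqr_ge0 (`|f x| - `|g x|); rewrite sqrrB !real_normK ?num_real//.
have := sqr_ge0 (f x); have := sqr_ge0 (g x); rewrite normrM; nra.
Qed.

Lemma sqintZ c f : sqint f -> sqint (fun x => c * f x).
Proof.
move=> [mf sf]; split; first exact: measurable_funM.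
by under eq_fun do rewrite exprMn; exact: tintZ.
Qed.

Lemma sqintD f g : sqint f -> sqint g -> sqint (fun x => f x + g x).
Proof.
move=> sf sg; split; first by apply: measurable_funD; [case: sf|case: sg].
have -> : (fun x => (f x + g x) ^+ 2) =
    (fun x => f x ^+ 2 + 2 * (f x * g x) + g x ^+ 2).
  by apply/funext => x; ring.
apply: tintD; [apply: tintD; [by case: sf|]|by case: sg].
by apply: tintZ; exact: sqint_mul.
Qed.

Lemma sqintB f g : sqint f -> sqint g -> sqint (fun x => f x - g x).
Proof.
move=> sf /(sqintZ (-1)) sg; have := sqintD sf sg.
by under eq_fun do rewrite mulN1r.
Qed.

Lemma sqint_bounded f : tbounded f -> sqint f.
Proof. by move=> bf; split; [case: bf|apply: tint_bounded; exact: tboundedM]. Qed.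

Lemma sqintM f g : tbounded f -> sqint g -> sqint (fun x => f x * g x).
Proof.
move=> bf [mg sg]; split; first by apply: measurable_funM => //; case: bf.
under eq_fun do rewrite exprMn.
by apply: tintM sg; exact: tboundedM.
Qed.

Lemma sqint_int f : sqint f -> tint f.
Proof.
move=> sf; have := sqint_mul sf (sqint_bounded (tbounded_cst 1)).
by under eq_fun do rewrite mulr1.
Qed.

Definition ip (f g : plane R -> R) := \int[mu]_x (f x * g x).

Lemma ipC f g : ip f g = ip g f.
Proof. by rewrite /ip; under eq_Rintegral do rewrite mulrC. Qed.

Lemma ipDl f g h : sqint f -> sqint g -> sqint h ->
  ip (fun x => f x + g x) h = ip f h + ip g h.
Proof.
move=> sf sg sh; rewrite /ip -RintegralD//; [|exact: sqint_mul|exact: sqint_mul].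
by apply: eq_Rintegral => x _; rewrite mulrDl.
Qed.

Lemma ipZl c f h : sqint f -> sqint h -> ip (fun x => c * f x) h = c * ip f h.
Proof.
move=> sf sh; rewrite /ip -RintegralZl//; last exact: sqint_mul.
by apply: eq_Rintegral => x _; rewrite mulrA.
Qed.

Lemma ipBl f g h : sqint f -> sqint g -> sqint h ->
  ip (fun x => f x - g x) h = ip f h - ip g h.
Proof.
move=> sf sg sh; rewrite /ip -RintegralB//; [|exact: sqint_mul|exact: sqint_mul].
by apply: eq_Rintegral => x _; rewrite mulrBl.
Qed.

Lemma ip_ge0 f : 0 <= ip f f.
Proof. by apply: Rintegral_ge0 => x _; rewrite -expr2 sqr_ge0. Qed.

Lemma ip_cauchy_schwarz f g : sqint f -> sqint g ->
  `|ip f g| <= Num.sqrt (ip f f) * Num.sqrt (ip g g).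
Proof.
move=> sf sg; apply: discriminant_le; [exact: ip_ge0|exact: ip_ge0|move=> t].
have st := sqintZ t sf; have sh := sqintD st sg.
suff -> : ip f f * t ^+ 2 + 2 * ip f g * t + ip g g =
  ip (fun x => t * f x + g x) (fun x => t * f x + g x) by exact: ip_ge0.
rewrite ipDl// ipZl// ![ip _ (fun x => _ + _)]ipC !ipDl// !ipZl// [ip g f]ipC; ring.
Qed.

(** By [vanishing_ae0] below, these functions are the ones that are zero almost
    everywhere. *)
Definition vanishing (psi : plane R -> R) :=
  tint psi /\ forall k, \int[mu]_x (psi x * cos (kdot k x)) = 0 /\
                        \int[mu]_x (psi x * sin (kdot k x)) = 0.

(** The bounded functions that preserve [vanishing] under multiplication are an
    algebra. It contains the trigonometric functions and is closed under bounded
    limits, so it contains all the indicator functions; uniqueness follows with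
    no summability kernel. *)
Definition multiplying (p : plane R -> R) :=
  tbounded p /\ forall psi, vanishing psi -> vanishing (fun x => psi x * p x).

Lemma multiplyingM p q : multiplying p -> multiplying q ->
  multiplying (fun x => p x * q x).
Proof.
move=> [bp hp] [bq hq]; split; first exact: tboundedM.
by move=> psi /hp/hq; under eq_fun do rewrite -mulrA.
Qed.

Lemma vanishingZ c psi : vanishing psi -> vanishing (fun x => c * psi x).
Proof.
move=> [ip hp]; split; first exact: tintZ.
have tc k : tint (fun x => psi x * cos (kdot k x)).
  by under eq_fun do rewrite mulrC; apply: tintM => //; exact: tbounded_cosk.
have ts k : tint (fun x => psi x * sin (kdot k x)).
  by under eq_fun do rewrite mulrC; apply: tintM => //; exact: tbounded_sink.
move=> k; have [h1 h2] := hp k.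
have aux (f : plane R -> R) : tint f -> \int[mu]_x f x = 0 ->
    \int[mu]_x (c * f x) = 0 by move=> tf f0; rewrite RintegralZl// f0 mulr0.
split; [rewrite -[RHS](aux _ (tc k) h1)|rewrite -[RHS](aux _ (ts k) h2)];
  by apply: eq_Rintegral => x _; rewrite mulrA.
Qed.

Lemma vanishingD phi psi : vanishing phi -> vanishing psi ->
  vanishing (fun x => phi x + psi x).
Proof.
move=> [i1 h1] [i2 h2]; split; first exact: tintD.
have tc k f : tint f -> tint (fun x => f x * cos (kdot k x)).
  by move=> tf; under eq_fun do rewrite mulrC; apply: tintM => //; exact: tbounded_cosk.
have ts k f : tint f -> tint (fun x => f x * sin (kdot k x)).
  by move=> tf; under eq_fun do rewrite mulrC; apply: tintM => //; exact: tbounded_sink.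
move=> k; have [c1 s1] := h1 k; have [c2 s2] := h2 k; split.
  under eq_Rintegral do rewrite mulrDl.
  rewrite RintegralD//; [|exact: tc|exact: tc]; by rewrite c1 c2 addr0.
under eq_Rintegral do rewrite mulrDl.
rewrite RintegralD//; [|exact: ts|exact: ts]; by rewrite s1 s2 addr0.
Qed.

Lemma multiplying_cst c : multiplying (fun=> c).
Proof.
split; first exact: tbounded_cst.
by move=> psi /(vanishingZ c); under eq_fun do rewrite mulrC.
Qed.

Lemma multiplyingD p q : multiplying p -> multiplying q ->
  multiplying (fun x => p x + q x).
Proof.
move=> [bp hp] [bq hq]; split; first exact: tboundedD.
by move=> psi v; have := vanishingD (hp _ v) (hq _ v); under eq_fun do rewrite -mulrDr.
Qed.

Lemma multiplyingZ c p : multiplying p -> multiplying (fun x => c * p x).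
Proof. by move=> mp; exact: multiplyingM (multiplying_cst c) mp. Qed.

(** The product formulas express the coefficients of the product by those at the
    frequencies [j + k] and [j - k]. *)
Lemma multiplying_trig k : multiplying (fun x => cos (kdot k x)) /\
  multiplying (fun x => sin (kdot k x)).
Proof.
have tc j f : tint f -> tint (fun x => f x * cos (kdot j x)).
  by move=> tf; under eq_fun do rewrite mulrC; apply: tintM => //; exact: tbounded_cosk.
have ts j f : tint f -> tint (fun x => f x * sin (kdot j x)).
  by move=> tf; under eq_fun do rewrite mulrC; apply: tintM => //; exact: tbounded_sink.
have comb (f g : plane R -> R) c d : tint f -> tint g -> \int[mu]_x f x = 0 ->
    \int[mu]_x g x = 0 -> \int[mu]_x (c * f x + d * g x) = 0.
  move=> tf tg f0 g0; rewrite RintegralD//; [|exact: tintZ|exact: tintZ].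
  by rewrite !RintegralZl// f0 g0 !mulr0 addr0.
split; split; try exact: tbounded_cosk; try exact: tbounded_sink;
  move=> psi [ti h]; (split; first by [exact: tc|exact: ts]) => j;
  have [h1 h2] := h (j + k); have [h3 h4] := h (j - k); split.
- rewrite -[RHS](comb _ _ 2^-1 2^-1 (tc (j + k) _ ti) (tc (j - k) _ ti) h1 h3).
  by apply: eq_Rintegral => x _; rewrite !kdotD kdotN cosD cosB; field.
- rewrite -[RHS](comb _ _ 2^-1 2^-1 (ts (j + k) _ ti) (ts (j - k) _ ti) h2 h4).
  by apply: eq_Rintegral => x _; rewrite !kdotD kdotN sinD sinB; field.
- rewrite -[RHS](comb _ _ 2^-1 (- 2^-1) (ts (j + k) _ ti) (ts (j - k) _ ti) h2 h4).
  by apply: eq_Rintegral => x _; rewrite !kdotD kdotN sinD sinB; field.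
- rewrite -[RHS](comb _ _ (- 2^-1) (2^-1) (tc (j + k) _ ti) (tc (j - k) _ ti) h1 h3).
  by apply: eq_Rintegral => x _; rewrite !kdotD kdotN cosD cosB; field.
Qed.

Lemma tint_ae_eq (f g : plane R -> R) : tint f -> measurable_fun setT g ->
  {ae mu, forall x, f x = g x} -> tint g /\ \int[mu]_x f x = \int[mu]_x g x.
Proof.
move=> tf mg fg.
have e : ae_eq mu setT (EFin \o f) (EFin \o g).
  by apply: filterS fg => x /= -> .
have mf := tint_measurable tf.
split; last first.
  by rewrite /Rintegral; congr fine; apply: ae_eq_integral => //; exact/measurable_EFinP.
apply/integrableP; split; first exact/measurable_EFinP.
have [_] := integrableP _ _ _ tf; congr (_ < _)%E.
apply: ae_eq_integral => //.
- by apply: measurableT_comp => //; exact/measurable_EFinP.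
- by apply: measurableT_comp => //; exact/measurable_EFinP.
- by apply: filterS fg => x /= -> .
Qed.

Lemma multiplying_ae p q : multiplying p -> tbounded q ->
  {ae mu, forall x, p x = q x} -> multiplying q.
Proof.
move=> [bp hp] bq pq; split=> // psi v; have [tp hv] := hp _ v.
have mq : measurable_fun setT (fun x => psi x * q x).
  by apply: measurable_funM; [apply: tint_measurable; case: v|case: bq].
have [tq _] : tint (fun x => psi x * q x) /\ \int[mu]_x (psi x * p x) = \int[mu]_x (psi x * q x).
  by apply: tint_ae_eq => //; apply: filterS pq => x ->.
have gen (T : plane R -> R) : tbounded T -> \int[mu]_x (psi x * p x * T x) = 0 ->
    \int[mu]_x (psi x * q x * T x) = 0.
  move=> bT <-; apply/esym.
  have t1 : tint (fun x => psi x * p x * T x).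
    by under eq_fun do rewrite mulrC; exact: tintM.
  have t2 : measurable_fun setT (fun x => psi x * q x * T x).
    by apply: measurable_funM => //; case: bT.
  have t3 : {ae mu, forall x, psi x * p x * T x = psi x * q x * T x}.
    by apply: filterS pq => x ->.
  by case: (tint_ae_eq t1 t2 t3).
split=> // k; have [h1 h2] := hv k.
by split; apply: gen => //; [exact: tbounded_cosk|exact: tbounded_sink].
Qed.

(** Dominated convergence: the integrands are bounded by a multiple of
    [|psi|]. *)
Lemma multiplying_lim (p_ : nat -> plane R -> R) (p : plane R -> R) (C : R) :
  (forall n, multiplying (p_ n)) -> (forall n x, `|p_ n x| <= C) ->
  (forall x, p_ n x @[n --> \oo] --> p x) -> multiplying p.
Proof.
move=> mp pC pp.
have bp : tbounded p.
  split.
    apply: (@measurable_fun_cvg _ _ _ setT p_) => //.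
    by move=> n; case: (mp n) => -[].
  exists C => x; have cn : `|p_ n x| @[n --> \oo] --> `|p x| by exact: cvg_norm.
  rewrite -(cvg_lim (@Rhausdorff R) cn); apply: limr_le; first by apply/cvg_ex; exists `|p x|.
  by apply: nearW => n; exact: pC.
split=> // psi v; have [ti hv] := v.
have tq : tint (fun x => psi x * p x).
  by under eq_fun do rewrite mulrC; exact: tintM.
have gen (T : plane R -> R) : tbounded T ->
    (forall n, \int[mu]_x (psi x * p_ n x * T x) = 0) ->
    \int[mu]_x (psi x * p x * T x) = 0.
  move=> [mT [D TD]] h0.
  have tn n : tint (fun x => psi x * p_ n x * T x).
    have [b _] := mp n; under eq_fun do rewrite mulrC.
    apply: tintM; first by split=> //; exists D.
    by under eq_fun do rewrite mulrC; exact: tintM.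
  have := @dominated_cvg _ _ _ mu setT measurableT
    (fun n x => (psi x * p_ n x * T x)%:E) (fun x => (psi x * p x * T x)%:E)
    (fun x => (D * C * `|psi x|)%:E).
  have -> : (fun n => \int[mu]_x (psi x * p_ n x * T x)%:E)%E = (fun=> 0%E).
    apply/funext => n; rewrite -[LHS]fineK; last by apply: integrable_fin_num => //; exact: tn.
    by rewrite -[fine _]/(Rintegral _ _ _) h0.
  move=> h; rewrite /Rintegral -(cvg_lim (@ereal_hausdorff R) (h _ _ _ _ _)) ?lim_cst//.
  - by move=> n; apply/measurable_EFinP; exact: tint_measurable.
  - move=> x _; apply: cvg_EFin; first exact: nearW.
    by apply: cvgMl; apply: cvgMr; exact: pp.
  - by apply: tintZ; have := integrable_abse ti.
  - move=> n x _; rewrite /= lee_fin !normrM [X in _ <= X]mulrC -mulrA [D * C]mulrC.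
    by rewrite ler_wpM2l// ler_pM.
split=> // k; split; apply: gen; try exact: tbounded_cosk; try exact: tbounded_sink;
  by move=> n; have [_ /(_ _ v)[_ /(_ k)[]]] := mp n.
Qed.

(** The iteration [s |-> s (3 - s^2) / 2] has the attracting fixed points [1]
    and [-1], so it turns a polynomial in the trigonometric functions into its
    sign. *)
Definition sign_step (s : R) : R := s * (3 - s ^+ 2) / 2.

Lemma sign_step_le1 s : `|s| <= 1 -> `|sign_step s| <= 1.
Proof.
rewrite !ler_norml /sign_step => /andP[h1 h2].
apply/andP; split.
  have : 0 <= (1 + s) ^+ 2 * (2 - s) by rewrite mulr_ge0 ?sqr_ge0//; lra.
  nra.
have : 0 <= (1 - s) ^+ 2 * (2 + s) by rewrite mulr_ge0 ?sqr_ge0//; lra.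
nra.
Qed.

Lemma sign_stepN s : sign_step (- s) = - sign_step s.
Proof. by rewrite /sign_step sqrrN; field. Qed.

(** On positive numbers up to [1] the iterates increase, and each step
    multiplies the distance to [1] by [(1 - s) (2 + s) / 2], which is less than
    [1] and decreases in [s]. *)
Lemma iter_sign_step_cvg s : `|s| <= 1 ->
  iter n sign_step s @[n --> \oo] --> Num.sg s.
Proof.
have pos x : 0 < x -> x <= 1 -> iter n sign_step x @[n --> \oo] --> (1 : R).
  move=> x0 x1; pose q := (1 - x) * (2 + x) / 2.
  have q0 : 0 <= q by rewrite /q; nra.
  have q1 : q < 1 by rewrite /q; nra.
  have key n : 0 <= 1 - iter n sign_step x <= q ^+ n * (1 - x).
    have : 0 <= 1 - iter n sign_step x <= q ^+ n * (1 - x) /\ x <= iter n sign_step x.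
      elim: n => [|n [/andP[i1 i2] i3]].
        by rewrite expr0 mul1r lexx subr_ge0 x1.
      rewrite iterS; set e := iter n sign_step x in i1 i2 i3 *.
      have eE : 1 - sign_step e = (1 - e) * ((1 - e) * (2 + e) / 2).
        by rewrite /sign_step; field.
      have b0 : 0 <= (1 - e) * (2 + e) / 2 by nra.
      have bq : (1 - e) * (2 + e) / 2 <= q by rewrite /q; nra.
      rewrite eE mulr_ge0//=; split.
        rewrite (_ : q ^+ n.+1 * (1 - x) = q ^+ n * (1 - x) * q); last by rewrite exprS; ring.
        exact: ler_pM.
      by rewrite /sign_step; nra.
    by case.
  apply/cvgrPdist_le => eps eps0.
  have : (q ^+ n * (1 - x) @[n --> \oo] --> 0 * (1 - x)).
    by apply: cvgMl; apply: cvg_expr; rewrite ger0_norm.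
  rewrite mul0r => /cvgrPdist_le/(_ _ eps0); apply: filterS => n.
  rewrite sub0r normrN => h; have /andP[k1 k2] := key n.
  by rewrite ger0_norm// (le_trans k2)// (le_trans (ler_norm _)).
move=> s1; have [s0|s0|->] := ltgtP s 0.
- rewrite ltr0_sg//.
  have -> : (fun n => iter n sign_step s) = (fun n => - iter n sign_step (- s)).
    apply/funext; elim => [|n ih]; first by rewrite opprK.
    by rewrite !iterS ih sign_stepN.
  by apply: cvgN; apply: pos; [rewrite oppr_gt0|rewrite -ltr0_norm].
- by rewrite gtr0_sg//; apply: pos => //; rewrite -(gtr0_norm s0).
- rewrite sgr0 (_ : (fun n => _) = (fun=> 0)); first exact: cvg_cst.
  by apply/funext; elim => //= n ->; rewrite /sign_step !mul0r.
Qed.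

Lemma multiplying_sg p : multiplying p -> multiplying (fun x => Num.sg (p x)).
Proof.
move=> mp; have [[_ [C pC]] _] := mp.
pose D := `|C| + 1; have D0 : 0 < D by rewrite ltr_wpDl.
have mq : multiplying (fun x => D^-1 * p x) by exact: multiplyingZ.
have bq x : `|D^-1 * p x| <= 1.
  have Di : 0 <= D^-1 by rewrite invr_ge0 ltW.
  rewrite normrM (ger0_norm Di) mulrC ler_pdivrMr// mul1r.
  by rewrite (le_trans (pC x))// /D (le_trans (ler_norm _))// lerDl.
have -> : (fun x => Num.sg (p x)) = (fun x => Num.sg (D^-1 * p x)).
  by apply/funext => x; rewrite sgrM (@gtr0_sg _ D^-1) ?invr_gt0// mul1r.
apply: (@multiplying_lim (fun n x => iter n sign_step (D^-1 * p x)) _ 1).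
- elim => [//|n ih].
  have -> : (fun x => iter n.+1 sign_step (D^-1 * p x)) = (fun x =>
      iter n sign_step (D^-1 * p x) * (3 / 2 + (- 2^-1) * (iter n sign_step (D^-1 * p x) *
      iter n sign_step (D^-1 * p x)))).
    by apply/funext => x; rewrite iterS /sign_step; field.
  apply: multiplyingM => //; apply: multiplyingD; first exact: multiplying_cst.
  by apply: multiplyingZ; exact: multiplyingM.
- by elim => [//|n ih] x; rewrite iterS sign_step_le1.
- by move=> x; exact: iter_sign_step_cvg.
Qed.

(** The indicator of positive numbers is [(sg^2 + sg) / 2]. *)
Lemma multiplying_pos p : multiplying p ->
  multiplying (fun x => ((0 < p x)%R)%:R).
Proof.
move=> /multiplying_sg ms.
have -> : (fun x => ((0 < p x)%R)%:R) =
    (fun x => 2^-1 * (Num.sg (p x) * Num.sg (p x) + Num.sg (p x))).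
  apply/funext => x; case: (ltgtP (p x) 0) => [h|h|->].
  - by rewrite ltr0_sg// mulrNN mulr1 subrr mulr0.
  - by rewrite gtr0_sg//=; lra.
  - by rewrite sgr0 !(mulr0, addr0).
by apply: multiplyingZ; apply: multiplyingD => //; exact: multiplyingM.
Qed.

Definition multiplying_set (E : set (plane R)) :=
  measurable E /\ multiplying (fun x => (x \in E)%:R).

Lemma multiplying_setC E : multiplying_set E -> multiplying_set (~` E).
Proof.
move=> [mE h]; split; first exact: measurableC.
have -> : (fun x => (x \in ~` E)%:R : R) = (fun x => 1 + (-1) * (x \in E)%:R).
  by apply/funext => x; rewrite in_setC; case: (x \in E); rewrite /= ?mulr1 ?mulr0 ?subrr ?addr0.
by apply: multiplyingD; [exact: multiplying_cst|exact: multiplyingZ].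
Qed.

Lemma multiplying_setI E F : multiplying_set E -> multiplying_set F ->
  multiplying_set (E `&` F).
Proof.
move=> [mE hE] [mF hF]; split; first exact: measurableI.
have -> : (fun x => (x \in E `&` F)%:R : R) = (fun x => (x \in E)%:R * (x \in F)%:R).
  by apply/funext => x; rewrite in_setI -natrM mulnb.
exact: multiplyingM.
Qed.

Lemma multiplying_set_sigma : sigma_algebra setT multiplying_set.
Proof.
split.
- split; first exact: measurable0.
  by under eq_fun do rewrite in_set0; exact: multiplying_cst.
- by move=> E mE; rewrite setTD; exact: multiplying_setC.
move=> F mF; split; first by apply: bigcup_measurable => k _; case: (mF k).
pose G n := \big[setI/setT]_(i < n) ~` F i.
have mG n : multiplying_set (G n).
  rewrite /G; elim: n => [|n ih]; last first.
    by rewrite big_ord_recr; apply: multiplying_setI => //; exact: multiplying_setC.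
  rewrite big_ord0; split; first exact: measurableT.
  by under eq_fun do rewrite in_setT; exact: multiplying_cst.
apply: (@multiplying_lim (fun n x => (x \in ~` G n)%:R) _ 1).
- by move=> n; case: (multiplying_setC (mG n)).
- by move=> n x; rewrite ger0_norm// lern1 leq_b1.
move=> x; have [|nx] := boolP (x \in \bigcup_k F k).
  rewrite inE => -[m _ Fm]; apply: cvg_near_cst.
  exists m.+1 => // n /= mn; suff h : (~` G n) x by rewrite mem_set.
  by rewrite /G -(bigcap_mkord n (fun i => ~` F i)) => /(_ m mn); exact.
rewrite (_ : (fun n => _) = (fun=> 0)); first exact: cvg_cst.
apply/funext => n; rewrite memNset// => h; apply: h.
rewrite /G -(bigcap_mkord n (fun i => ~` F i)) => m /= _ Fm.
by move/negP: nx; apply; rewrite inE; exists m.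
Qed.

Local Notation J := (`]- pi, pi[%classic : set (measurableTypeR R)).

(** The sides of the box have to be discarded, since the trigonometric functions
    do not tell [pi] from [- pi]. *)
Lemma torus_ae_interior :
  {ae mu, forall x, (- pi < x.1 < pi) /\ (- pi < x.2 < pi)}.
Proof.
have mJ : measurable J by exact: measurable_itv.
have mJJ : measurable (J `*` J) by exact: measurableX.
exists (~` (J `*` J)); split; first exact: measurableC.
- have e1 : mu (J `*` J) = ((2 * pi) ^+ 2)%:E.
    rewrite -torus_measureX//; transitivity (nu J * nu J)%E; first exact: product_measure1E.
    have -> : nu J = (2 * pi)%:E.
      rewrite /circle_measure /= /mfrestr /mrestr setIidl; last exact: subset_itv_oo_cc.
      rewrite lebesgue_measure_itv/= lte_fin gtrN ?pi_gt0// -EFinB; congr (_%:E).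
      by rewrite opprK mulr2n mulrDl mul1r.
    by rewrite -EFinM -expr2.
  have -> : mu (~` (J `*` J)) = (mu setT - mu (J `*` J))%E.
    by rewrite -setTD (measureD measurableT mJJ torus_measure_lty) setTI.
  by rewrite torus_measureT e1 subee.
- by move=> x /= h [x1 x2]; apply: h; rewrite /= !in_itv/= in x1 x2.
Qed.

(** The left-hand side is a trigonometric polynomial of degree one. The
    right-hand side shows that on the open circle it has the sign of [x - a]. *)
Lemma half_angle_factor (a x : R) :
  cos (a / 2) * sin x - sin (a / 2) * (1 + cos x) =
  2 * cos (x / 2) * sin ((x - a) / 2).
Proof.
have -> : (x - a) / 2 = x / 2 - a / 2 by field.
have {1}-> : x = (x / 2) *+ 2 by rewrite mulr2n; field.
have {2}-> : x = (x / 2) *+ 2 by rewrite mulr2n; field.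
rewrite sin_mulr2n cos_mulr2n sinB !mulr2n; ring.
Qed.

Lemma half_angle_gt0 (a x : R) : - pi <= a <= pi -> - pi < x < pi ->
  (0 < cos (a / 2) * sin x - sin (a / 2) * (1 + cos x)) = (a < x).
Proof.
move=> /andP[a1 a2] /andP[x1 x2]; rewrite half_angle_factor.
have c0 : 0 < 2 * cos (x / 2).
  rewrite mulr_gt0// cos_gt0_pihalf//; apply/andP; split; lra.
rewrite pmulr_rgt0//; case: (ltgtP a x) => ax.
- by rewrite sin_gt0_pi//; apply/andP; split; lra.
- apply/negbTE; rewrite -leNgt -oppr_ge0 -sinN sin_ge0_pi//.
  apply/andP; split; lra.
- by rewrite ax subrr mul0r sin0 ltxx.
Qed.

(** The ray is the set where the polynomial of [half_angle_factor] is positive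
    if [a] is in [[- pi, pi]], and otherwise it is empty or full up to a
    negligible set. *)
Lemma multiplying_ray (a : R) :
  multiplying_set (fst @^-1` `]a, +oo[) /\ multiplying_set (snd @^-1` `]a, +oo[).
Proof.
have gen (pr : plane R -> R) (e : int * int) : (forall x, kdot e x = pr x) ->
    measurable_fun setT pr -> {ae mu, forall x, - pi < pr x < pi} ->
    multiplying_set (pr @^-1` `]a, +oo[).
  move=> kpr mpr aepr.
  have mE : measurable (pr @^-1` `]a, +oo[).
    by rewrite -[X in measurable X]setTI; apply: mpr => //; exact: measurable_itv.
  split=> //.
  have tb : tbounded (fun x => (x \in pr @^-1` `]a, +oo[)%:R).
    split; last by exists 1 => x; rewrite ger0_norm// lern1 leq_b1.
    exact: measurable_indic.
  have eE x : (x \in pr @^-1` `]a, +oo[) = (a < pr x).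
    by apply/idP/idP; rewrite inE/= in_itv/= andbT.
  have [/andP[a1 a2]|] := boolP (- pi <= a <= pi).
    have [mc ms] := multiplying_trig e.
    have := multiplying_pos (multiplyingD (multiplyingZ (cos (a / 2)) ms)
      (multiplyingZ (- sin (a / 2)) (multiplyingD (multiplying_cst 1) mc))).
    move/multiplying_ae; apply=> //; apply: filterS aepr => x prx.
    by rewrite eE kpr mulNr half_angle_gt0// a1.
  rewrite negb_and -!ltNge => /orP[a1|a1].
    apply: (multiplying_ae (multiplying_cst 1)) => //.
    by apply: filterS aepr => x /andP[h _]; rewrite eE (lt_trans a1 h).
  apply: (multiplying_ae (multiplying_cst 0)) => //.
  by apply: filterS aepr => x /andP[_ h]; rewrite eE ltNge (ltW (lt_trans h a1)).
split.
  apply: (gen _ (1, 0)) => [x| |]; first by rewrite /kdot/= mul1r mul0r addr0.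
    exact: measurable_fst.
  have [N [mN N0 sN]] := torus_ae_interior.
  by exists N; split => // x /= h; apply: sN => -[].
apply: (gen _ (0, 1)) => [x| |]; first by rewrite /kdot/= mul1r mul0r add0r.
  exact: measurable_snd.
have [N [mN N0 sN]] := torus_ae_interior.
by exists N; split => // x /= h; apply: sN => -[].
Qed.

Lemma multiplying_set_preimage (pr : plane R -> measurableTypeR R) :
  (forall a : R, multiplying_set (pr @^-1` `]a, +oo[)) ->
  forall A, measurable A -> multiplying_set (pr @^-1` A).
Proof.
move=> h; have [s0 sC sU] := multiplying_set_sigma.
move=> A mA; have {}mA : (@RGenOInfty.G R).-sigma.-measurable A.
  by rewrite -RGenOInfty.measurableE.
have : sigma_algebra setT [set A | multiplying_set (pr @^-1` A)].
  split.
  - by rewrite /= preimage_set0.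
  - by move=> B /= mB; rewrite setTD preimage_setC -setTD; exact: sC.
  - by move=> F mF; rewrite /= preimage_bigcup; exact: sU.
move=> sa; apply: (mA [set A | multiplying_set (pr @^-1` A)]); split => //.
by move=> _ [a ->]; exact: h.
Qed.

Lemma measurable_multiplying (E : set (plane R)) : measurable E -> multiplying_set E.
Proof.
rewrite measurable_prod_measurableType => mE.
apply: (mE multiplying_set); split; first exact: multiplying_set_sigma.
move=> _ [A mA [B mB <-]].
have -> : A `*` B = (fst @^-1` A) `&` (snd @^-1` B) by [].
by apply: multiplying_setI; apply: multiplying_set_preimage => // a;
  have [] := multiplying_ray a.
Qed.

(** The integral over [E] is the coefficient of frequency [0] of the product
    with the indicator of [E]; a function with zero integrals over all
    measurable sets is zero almost everywhere. *)
Lemma vanishing_ae0 psi : vanishing psi -> {ae mu, forall x, psi x = 0}.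
Proof.
move=> v; have [ti _] := v.
have : ae_eq mu setT (EFin \o psi) (cst 0%E).
  apply: integral_ae_eq => // E _ mE.
  have [_ [_ /(_ psi v)[tE /(_ 0)[h _]]]] := measurable_multiplying mE.
  rewrite integral0 integral_mkcond.
  rewrite (_ : integral _ _ _ = \int[mu]_x (psi x * (x \in E)%:R)%:E)%E; last first.
    apply: eq_integral => x _; rewrite /patch /=.
    by case: (x \in E); rewrite ?mulr1 ?mulr0.
  rewrite -[LHS]fineK; last by apply: integrable_fin_num => //; exact: tE.
  congr (_%:E); rewrite -h /Rintegral; congr fine; apply: eq_integral => x _.
  by rewrite /kdot !mul0r addr0 cos0 mulr1.
by apply: filterS => x /(_ Logic.I) /= [].
Qed.

End TorusMeasure.

(** * The theorems of Parseval and Riesz-Fischer *)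

Section Fourier.
Context {R : realType}.
Local Notation mu := (torus_measure R).
Local Notation Z2 := (int * int)%type.
Local Notation Re := complex.Re.
Local Notation Im := complex.Im.
Implicit Types (f g : plane R -> R) (c : Z2 -> R[i]) (j k : Z2).

(** The modulus as a real number, whereas [`|z|] is an element of [R[i]]. *)
Definition cnorm (z : R[i]) : R := ComplexField.Normc.normc z.

Lemma sqr_cnorm z : cnorm z ^+ 2 = Re z ^+ 2 + Im z ^+ 2.
Proof. by case: z => a b; rewrite /cnorm/= sqr_sqrtr// addr_ge0// sqr_ge0. Qed.

Lemma cnorm_ge0 z : 0 <= cnorm z.
Proof. by case: z => a b; rewrite /cnorm/= sqrtr_ge0. Qed.

Lemma cnormM z w : cnorm (z * w) = cnorm z * cnorm w.
Proof. exact: ComplexField.Normc.normcM. Qed.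

Lemma cnormD z w : cnorm (z + w) <= cnorm z + cnorm w.
Proof. exact: le_normcD. Qed.

Lemma cnormJ z : cnorm (z^*)%C = cnorm z.
Proof. by case: z => a b; rewrite /cnorm/= sqrrN. Qed.

Lemma cnorm_real (a : R) : cnorm a%:C = `|a|.
Proof. by rewrite /cnorm/= expr0n addr0 sqrtr_sqr. Qed.

Lemma Re_le_cnorm z : `|Re z| <= cnorm z.
Proof.
rewrite -[leRHS]ger0_norm ?cnorm_ge0// -ler_sqr ?nnegrE// !real_normK ?num_real//.
by rewrite sqr_cnorm lerDl sqr_ge0.
Qed.

Lemma Im_le_cnorm z : `|Im z| <= cnorm z.
Proof.
rewrite -[leRHS]ger0_norm ?cnorm_ge0// -ler_sqr ?nnegrE// !real_normK ?num_real//.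
by rewrite sqr_cnorm lerDr sqr_ge0.
Qed.

Lemma cnorm_le_ReIm z : cnorm z <= `|Re z| + `|Im z|.
Proof.
rewrite -ler_sqr ?nnegrE ?cnorm_ge0 ?addr_ge0//.
by rewrite sqr_cnorm sqrrD !real_normK ?num_real// lerD2r lerDl mulrn_wge0 ?mulr_ge0.
Qed.

Lemma complex_eqP (z w : R[i]) : Re z = Re w -> Im z = Im w -> z = w.
Proof. by case: z w => a b [c d] /= -> ->. Qed.

Lemma ReD (z w : R[i]) : Re (z + w) = Re z + Re w.
Proof. by case: z w => [a b] [c d]. Qed.
Lemma ImD (z w : R[i]) : Im (z + w) = Im z + Im w.
Proof. by case: z w => [a b] [c d]. Qed.
Lemma ReN (z : R[i]) : Re (- z) = - Re z. Proof. by case: z. Qed.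
Lemma ImN (z : R[i]) : Im (- z) = - Im z. Proof. by case: z. Qed.
Lemma ReM (z w : R[i]) : Re (z * w) = Re z * Re w - Im z * Im w.
Proof. by case: z w => [a b] [c d]. Qed.
Lemma ImM (z w : R[i]) : Im (z * w) = Re z * Im w + Im z * Re w.
Proof. by case: z w => [a b] [c d]. Qed.
Lemma ReJ (z : R[i]) : Re (z^*)%C = Re z. Proof. by case: z. Qed.
Lemma ImJ (z : R[i]) : Im (z^*)%C = - Im z. Proof. by case: z. Qed.
Lemma ReC (a : R) : Re a%:C = a. Proof. by []. Qed.
Lemma ImC (a : R) : Im a%:C = 0. Proof. by []. Qed.
Definition ReImE := (ReD, ImD, ReN, ImN, ReJ, ImJ, ReC, ImC).

Definition cosk k (x : plane R) : R := cos (kdot k x).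
Definition sink k (x : plane R) : R := sin (kdot k x).
Definition area : R := (2 * pi) ^+ 2.

Lemma area_gt0 : 0 < area.
Proof. by rewrite /area exprn_gt0// mulr_gt0// pi_gt0. Qed.

Lemma sqint_cosk k : sqint (cosk k).
Proof. exact: sqint_bounded (tbounded_cosk k). Qed.

Lemma sqint_sink k : sqint (sink k).
Proof. exact: sqint_bounded (tbounded_sink k). Qed.

Lemma Re_fourier f k : Re (fourier f k) = area^-1 * ip f (cosk k).
Proof. by rewrite /fourier /= mul0r subr0. Qed.

Lemma Im_fourier f k : Im (fourier f k) = - (area^-1 * ip f (sink k)).
Proof. by rewrite /fourier /= mul0r addr0 mulrN. Qed.

Lemma ip_cosk f k : ip f (cosk k) = area * Re (fourier f k).
Proof. by rewrite Re_fourier mulVKf// gt_eqF// area_gt0. Qed.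

Lemma ip_sink f k : ip f (sink k) = - (area * Im (fourier f k)).
Proof. by rewrite Im_fourier mulrN opprK mulVKf// gt_eqF// area_gt0. Qed.

Lemma fourierE f k :
  fourier f k = (area^-1 * ip f (cosk k)) -i* (area^-1 * ip f (sink k)).
Proof. by apply: complex_eqP; rewrite (Re_fourier, Im_fourier). Qed.

#[local] Opaque fourier.

Lemma fourierD f g k : sqint f -> sqint g ->
  fourier (fun x => f x + g x) k = fourier f k + fourier g k.
Proof.
move=> sf sg; have sc := sqint_cosk k; have ss := sqint_sink k.
by rewrite !fourierE !ipDl//; apply: complex_eqP => /=; ring.
Qed.

Lemma fourierZ a f k : sqint f -> fourier (fun x => a * f x) k = a%:C * fourier f k.
Proof.
move=> sf; have sc := sqint_cosk k; have ss := sqint_sink k.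
by rewrite !fourierE !ipZl//; apply: complex_eqP => /=; ring.
Qed.

Lemma fourierB f g k : sqint f -> sqint g ->
  fourier (fun x => f x - g x) k = fourier f k - fourier g k.
Proof.
move=> sf sg; have sc := sqint_cosk k; have ss := sqint_sink k.
by rewrite !fourierE !ipBl//; apply: complex_eqP => /=; ring.
Qed.

Lemma coskN k : cosk (- k) = cosk k.
Proof. by apply/funext => x; rewrite /cosk kdotN cosN. Qed.

Lemma sinkN k : sink (- k) = (fun x => (-1) * sink k x).
Proof. by apply/funext => x; rewrite /sink kdotN sinN mulN1r. Qed.

Lemma fourier_sym f k : sqint f -> fourier f (- k) = ((fourier f k)^*)%C.
Proof.
move=> sf; have ss := sqint_sink k.
have e : ip f (fun x => -1 * sink k x) = - ip f (sink k).
  by rewrite ipC ipZl// ipC mulN1r.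
by rewrite !fourierE coskN sinkN e /= mulrN.
Qed.

Lemma ip_coscos j k : ip (cosk j) (cosk k) =
  area / 2 * ((j == k)%:R + (j == - k)%:R).
Proof.
have [h1 _] := @torus_integral_kdot R (j + k).
have [h2 _] := @torus_integral_kdot R (j - k).
have i1 := tint_bounded (tbounded_cosk (R := R) (j + k)).
have i2 := tint_bounded (tbounded_cosk (R := R) (j - k)).
rewrite /ip (@eq_Rintegral _ _ R mu setT (fun x => 2^-1 * cos (kdot (j + k) x) + 2^-1 * cos (kdot (j - k) x))).
  rewrite RintegralD//; [|exact: tintZ|exact: tintZ].
  rewrite !RintegralZl// h1 h2 subr_eq0 addr_eq0 -/area.
  by case: eqP => _; case: eqP => _ /=; field.
by move=> x _; rewrite /cosk !kdotD kdotN cosD cosB; field.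
Qed.

Lemma ip_sinsin j k : ip (sink j) (sink k) =
  area / 2 * ((j == k)%:R - (j == - k)%:R).
Proof.
have [h1 _] := @torus_integral_kdot R (j + k).
have [h2 _] := @torus_integral_kdot R (j - k).
have i1 := tint_bounded (tbounded_cosk (R := R) (j + k)).
have i2 := tint_bounded (tbounded_cosk (R := R) (j - k)).
rewrite /ip (@eq_Rintegral _ _ R mu setT (fun x => - 2^-1 * cos (kdot (j + k) x) + 2^-1 * cos (kdot (j - k) x))).
  rewrite RintegralD//; [|exact: tintZ|exact: tintZ].
  rewrite !RintegralZl// h1 h2 subr_eq0 addr_eq0 -/area.
  by case: eqP => _; case: eqP => _ /=; field.
by move=> x _; rewrite /sink !kdotD kdotN cosD cosB; field.
Qed.

Lemma ip_sincos j k : ip (sink j) (cosk k) = 0.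
Proof.
have [_ h1] := @torus_integral_kdot R (j + k).
have [_ h2] := @torus_integral_kdot R (j - k).
have i1 := tint_bounded (tbounded_sink (R := R) (j + k)).
have i2 := tint_bounded (tbounded_sink (R := R) (j - k)).
rewrite /ip (@eq_Rintegral _ _ R mu setT (fun x => 2^-1 * sin (kdot (j + k) x) + 2^-1 * sin (kdot (j - k) x))).
  rewrite RintegralD//; [|exact: tintZ|exact: tintZ].
  by rewrite !RintegralZl// h1 h2 mulr0 addr0.
by move=> x _; rewrite /sink /cosk !kdotD kdotN sinD sinB; field.
Qed.

Definition trig_poly c (s : seq Z2) (x : plane R) : R :=
  \sum_(k <- s) (Re (c k) * cosk k x + - Im (c k) * sink k x).

Lemma tbounded_trig_poly c s : tbounded (trig_poly c s).
Proof.
apply: tbounded_sum => k; apply: tboundedD; apply: tboundedM;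
  by [exact: tbounded_cst|exact: tbounded_cosk|exact: tbounded_sink].
Qed.

Lemma sqint_trig_poly c s : sqint (trig_poly c s).
Proof. exact: sqint_bounded (tbounded_trig_poly c s). Qed.

Lemma trig_poly_cons c k s : trig_poly c (k :: s) =
  (fun x => (Re (c k) * cosk k x + - Im (c k) * sink k x) + trig_poly c s x).
Proof. by apply/funext => x; rewrite /trig_poly big_cons. Qed.

Lemma ip0l f : ip (fun=> 0) f = 0.
Proof. by rewrite /ip; under eq_Rintegral do rewrite mul0r; rewrite Rintegral_cst//= mul0r. Qed.

Lemma ip_trig_poly c s f : sqint f -> ip (trig_poly c s) f =
  \sum_(k <- s) (Re (c k) * ip f (cosk k) + - Im (c k) * ip f (sink k)).
Proof.
move=> sf; elim: s => [|k s ih].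
  rewrite big_nil (_ : trig_poly c [::] = fun=> 0) ?ip0l//.
  by apply/funext => x; rewrite /trig_poly big_nil.
have sc := sqint_cosk k; have ss := sqint_sink k.
have s1 := sqintZ (Re (c k)) sc; have s2 := sqintZ (- Im (c k)) ss.
rewrite big_cons trig_poly_cons ipDl//; last exact: sqint_trig_poly.
  by rewrite ih ipDl// !ipZl// [ip f (cosk k)]ipC [ip f (sink k)]ipC.
exact: sqintD.
Qed.

Definition dotc (z w : R[i]) : R := Re z * Re w + Im z * Im w.

Lemma dotc_self z : dotc z z = cnorm z ^+ 2.
Proof. by rewrite sqr_cnorm /dotc !expr2. Qed.

Lemma ip_trig_poly_fourier c s f : sqint f -> ip (trig_poly c s) f =
  area * \sum_(k <- s) dotc (c k) (fourier f k).
Proof.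
move=> sf; rewrite ip_trig_poly// mulr_sumr; apply: eq_bigr => k _.
by rewrite ip_cosk ip_sink /dotc; ring.
Qed.

Lemma sum_delta (s : seq Z2) (F : Z2 -> R) k : uniq s ->
  \sum_(j <- s) F j * (j == k)%:R = F k * (k \in s)%:R.
Proof.
move=> us; rewrite (bigID (fun j => j == k))/= [X in _ + X]big1 ?addr0; last first.
  by move=> j /negPf ->; rewrite mulr0.
rewrite (eq_bigr (fun=> F k)) => [|j /eqP ->]; last by rewrite eqxx mulr1.
rewrite big_const_seq iter_addr addr0 -[LHS]mulr_natr.
by rewrite (eq_count (a2 := pred1 k))// count_uniq_mem.
Qed.

Lemma fourier_trig_poly c n k : (forall k, c (- k) = ((c k)^*)%C) ->
  fourier (trig_poly c (zbox n)) k = if (supnorm k <= n)%N then c k else 0.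
Proof.
move=> cs; have u := zbox_uniq n; have a0 := area_gt0.
have kn : (- k \in zbox n) = (k \in zbox n) by rewrite !mem_zbox supnormN.
apply: complex_eqP.
- rewrite Re_fourier ip_trig_poly; last exact: sqint_cosk.
  under eq_bigr => j _.
    rewrite [ip _ (sink j)]ipC ip_sincos mulr0 addr0 ip_coscos.
    rewrite (_ : Re (c j) * _ = area / 2 * (Re (c j) * (j == k)%:R) +
      area / 2 * (Re (c j) * (j == - k)%:R)); last by rewrite [k == j]eq_sym [k == - j]eq_sym eqr_oppLR; ring.
    over.
  rewrite big_split/= -!mulr_sumr !sum_delta// kn cs !ReImE mem_zbox.
  by case: ifP => _ /=; field; rewrite gt_eqF.
- rewrite Im_fourier ip_trig_poly; last exact: sqint_sink.
  under eq_bigr => j _.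
    rewrite ip_sincos mulr0 add0r ip_sinsin.
    rewrite (_ : - Im (c j) * _ = - (area / 2) * (Im (c j) * (j == k)%:R) +
      area / 2 * (Im (c j) * (j == - k)%:R)); last by rewrite [k == j]eq_sym [k == - j]eq_sym eqr_oppLR; ring.
    over.
  rewrite big_split/= -!mulr_sumr !sum_delta// kn cs !ReImE mem_zbox.
  by case: ifP => _ /=; field; rewrite gt_eqF.
Qed.

Lemma ip_subself f g : sqint f -> sqint g ->
  ip (fun x => f x - g x) (fun x => f x - g x) = ip f f - 2 * ip f g + ip g g.
Proof.
move=> sf sg; have sh := sqintB sf sg.
rewrite ipBl// ![ip _ (fun x => _ - _)]ipC !ipBl// [ip g f]ipC; ring.
Qed.

Definition conj_sym c := forall k, c (- k) = ((c k)^*)%C.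

Lemma conj_sym_fourier f : sqint f -> conj_sym (fourier f).
Proof. by move=> sf k; exact: fourier_sym. Qed.

Lemma ip_trig_polyS c m n : conj_sym c -> (m <= n)%N ->
  ip (trig_poly c (zbox m)) (trig_poly c (zbox n)) = area * \sum_(k <- zbox m) cnorm (c k) ^+ 2.
Proof.
move=> ch mn; rewrite ip_trig_poly_fourier; last exact: sqint_trig_poly.
congr (_ * _); rewrite big_seq [RHS]big_seq; apply: eq_bigr => k.
by rewrite mem_zbox => km; rewrite fourier_trig_poly// (leq_trans km mn) dotc_self.
Qed.

Lemma ip_trig_polyB c m n : conj_sym c -> (m <= n)%N ->
  ip (fun x => trig_poly c (zbox n) x - trig_poly c (zbox m) x)
     (fun x => trig_poly c (zbox n) x - trig_poly c (zbox m) x) =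
  area * (\sum_(k <- zbox n) cnorm (c k) ^+ 2 - \sum_(k <- zbox m) cnorm (c k) ^+ 2).
Proof.
move=> ch mn; rewrite ip_subself; [|exact: sqint_trig_poly|exact: sqint_trig_poly].
by rewrite [ip (trig_poly c (zbox n)) (trig_poly c (zbox m))]ipC !ip_trig_polyS//; ring.
Qed.

Lemma bessel_identity f n : sqint f ->
  ip (fun x => f x - trig_poly (fourier f) (zbox n) x)
     (fun x => f x - trig_poly (fourier f) (zbox n) x) =
  ip f f - area * \sum_(k <- zbox n) cnorm (fourier f k) ^+ 2.
Proof.
move=> sf; have ch := conj_sym_fourier sf.
rewrite ip_subself//; last exact: sqint_trig_poly.
rewrite ip_trig_polyS// ipC ip_trig_poly_fourier//.
by under eq_bigr do rewrite dotc_self; ring.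
Qed.

Lemma bessel f : sqint f -> sumbd (fun k => cnorm (fourier f k) ^+ 2) (area^-1 * ip f f).
Proof.
move=> sf; apply: sumbd_zbox => [k|n]; first exact: sqr_ge0.
rewrite mulrC ler_pdivlMr ?area_gt0// mulrC -subr_ge0 -bessel_identity//.
exact: ip_ge0.
Qed.

(** The limit is squeezed between the monotone sequences [u n - 2 K / 2^n] and
    [u n + 2 K / 2^n]. *)
Lemma geometric_cvg (u : nat -> R) (K : R) :
  (forall n, `|u n.+1 - u n| <= K * 2^-1 ^+ n) ->
  exists l, u n @[n --> \oo] --> l /\ forall n, `|l - u n| <= 2 * K * 2^-1 ^+ n.
Proof.
move=> h; have K0 : 0 <= K by have := h 0%N; rewrite expr0 mulr1; apply: le_trans.
pose v n := u n - 2 * K * 2^-1 ^+ n; pose w n := u n + 2 * K * 2^-1 ^+ n.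
have e0 n : 0 <= 2 * K * 2^-1 ^+ n by rewrite !mulr_ge0// exprn_ge0// invr_ge0.
have hn n : u n.+1 - u n <= K * 2^-1 ^+ n /\ - (K * 2^-1 ^+ n) <= u n.+1 - u n.
  by have := h n; rewrite ler_norml => /andP[].
have vnd : nondecreasing_seq v.
  by apply/nondecreasing_seqP => n; rewrite /v exprS; have [_] := hn n; lra.
have wni : nonincreasing_seq w.
  by apply/nonincreasing_seqP => n; rewrite /w exprS; have [] := hn n; lra.
have vw n m : v n <= w m.
  have [nm|mn] := leqP n m.
    by rewrite (le_trans (vnd _ _ nm))// /v /w; have := e0 m; lra.
  by rewrite (le_trans _ (wni _ _ (ltnW mn)))// /v /w; have := e0 n; lra.
have vcv : cvgn v by apply: nondecreasing_is_cvgn => //; exists (w 0%N) => _ [n _ <-].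
pose l := limn v; exists l.
have lb n : `|l - u n| <= 2 * K * 2^-1 ^+ n.
  have l1 : v n <= l by exact: nondecreasing_cvgn_le.
  have l2 : l <= w n by apply: limr_le => //; exact: nearW.
  by rewrite ler_norml; move: l1 l2; rewrite /v /w; lra.
split=> //; apply/cvgrPdist_le => eps eps0.
have : (2 * K * 2^-1 ^+ n @[n --> \oo] --> 2 * K * 0).
  by apply: cvgMr; apply: cvg_expr; rewrite ger0_norm; lra.
rewrite mulr0 => /cvgrPdist_le/(_ _ eps0); apply: filterS => n.
by rewrite sub0r normrN => k; rewrite (le_trans (lb n))// (le_trans (ler_norm _)).
Qed.

(** Completeness of L^2, along a rapidly converging sequence: the series
    of the [4^n (g_(n+1) - g_n)^2] has a finite integral, so it is finite almost
    everywhere, and it then dominates the tail of the telescoping series. *)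
Lemma sqint_complete (g : nat -> plane R -> R) (C : R) :
  (forall n, sqint (g n)) ->
  (forall n, ip (fun x => g n.+1 x - g n x) (fun x => g n.+1 x - g n x)
      <= C * 8^-1 ^+ n) ->
  exists2 h, sqint h & exists D : R, forall n,
    ip (fun x => h x - g n x) (fun x => h x - g n x) <= D * 4^-1 ^+ n.
Proof.
move=> sg hg; pose d n x := g n.+1 x - g n x.
have sd n : sqint (d n) by exact: sqintB.
pose H n (x : plane R) : \bar R := (\sum_(i < n) 4 ^+ i * d i x ^+ 2)%:E.
have t0 i x : 0 <= 4 ^+ i * d i x ^+ 2 by rewrite mulr_ge0 ?sqr_ge0// exprn_ge0.
have mH n : measurable_fun setT (H n).
  apply/measurable_EFinP; apply: measurable_sum => i.
  by apply: measurable_funM => //; apply: measurable_funX; case: (sd i).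
have H0 n x : (0 <= H n x)%E by rewrite lee_fin sumr_ge0.
have ndH x : nondecreasing_seq (H ^~ x).
  apply/nondecreasing_seqP => n; rewrite lee_fin big_ord_recr/= lerDl//.
have cvH x : cvgn (H ^~ x) by exact: ereal_nondecreasing_is_cvgn.
(* The limit is finite almost everywhere; where it is, it bounds the increments
   by a geometric sequence. *)
pose Hoo x := limn (H ^~ x).
have C0 : 0 <= C by have := hg 0%N; rewrite expr0 mulr1; apply: le_trans; exact: ip_ge0.
pose Hr n (x : plane R) : R := \sum_(i < n) 4 ^+ i * d i x ^+ 2.
have tHr n : tint (Hr n) /\ \int[mu]_x Hr n x <= 2 * C * (1 - 2^-1 ^+ n).
  elim: n => [|n [ti ih]].
    have -> : Hr 0%N = fun=> 0 by apply/funext => x; rewrite /Hr big_ord0.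
    split; first exact: tint_bounded (tbounded_cst 0).
    by rewrite Rintegral_cst//= mul0r expr0 subrr mulr0.
  have e : Hr n.+1 = fun x => Hr n x + 4 ^+ n * d n x ^+ 2.
    by apply/funext => x; rewrite /Hr big_ord_recr.
  have t1 : tint (fun x => d n x ^+ 2) by case: (sd n).
  have t2 : tint (fun x => 4 ^+ n * d n x ^+ 2) by exact: tintZ.
  rewrite e; split; first exact: tintD.
  rewrite RintegralD// RintegralZl//.
  have := hg n; rewrite -/(d n) => hn.
  have e1 : \int[mu]_x d n x ^+ 2 = ip (d n) (d n).
    by apply: eq_Rintegral => x _; rewrite expr2.
  have e2 : 4 ^+ n * (C * 8^-1 ^+ n) = C * 2^-1 ^+ n :> R.
    by rewrite mulrCA -exprMn; congr (_ * _ ^+ _); field.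
  have : 4 ^+ n * ip (d n) (d n) <= C * 2^-1 ^+ n.
    by rewrite -e2 ler_wpM2l// exprn_ge0.
  by rewrite e1 exprS; lra.
have intH n : (\int[mu]_x H n x <= (2 * C)%:E)%E.
  have [ti le1] := tHr n.
  rewrite -[leLHS]fineK; last by apply: integrable_fin_num => //; exact: ti.
  by rewrite lee_fin (le_trans le1)// -[leRHS]mulr1 ler_wpM2l ?mulr_ge0// gerBl exprn_ge0// invr_ge0.
have mHoo : measurable_fun setT Hoo.
  by apply: (emeasurable_fun_cvg H) => // x _; exact: cvH.
have Hoo0 x : (0 <= Hoo x)%E by apply: lime_ge => //; exact: nearW.
have intHoo : (\int[mu]_x Hoo x <= (2 * C)%:E)%E.
  rewrite (monotone_convergence mu measurableT mH)//.
  apply: lime_le; last exact: nearW.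
  by apply: cvgP; apply: cvg_monotone_convergence.
have iHoo : mu.-integrable setT Hoo.
  apply/integrableP; split => //.
  under eq_integral do rewrite gee0_abs//.
  by apply: le_lt_trans intHoo _; exact: ltry.
have aeHoo := integrable_ae measurableT iHoo.
pose E := [set x : plane R | Hoo x \is a fin_num].
have mE : measurable E.
  rewrite -[E]setTI; exact: emeasurable_fin_num.
pose G n x := g n x * (x \in E)%:R.
have key x : exists l, (G n x @[n --> \oo] --> l) /\
    (E x -> forall n, (l - g n x) ^+ 2 <= 4 * fine (Hoo x) * 4^-1 ^+ n).
  have [xE|xE] := boolP (x \in E); last first.
    exists 0; split; last by move=> /mem_set; rewrite (negPf xE).
    rewrite (_ : (fun n => _) = fun=> 0); first exact: cvg_cst.
    by apply/funext => n; rewrite /G (negPf xE) mulr0.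
  have Ef : Hoo x \is a fin_num by move: xE; rewrite inE.
  pose eta := fine (Hoo x).
  have eta0 : 0 <= eta by exact: fine_ge0.
  have [n|l [lc lb]] := @geometric_cvg (fun n => g n x) (Num.sqrt eta).
    have h1 : 4 ^+ n * d n x ^+ 2 <= eta.
      rewrite -lee_fin fineK//.
      have : (H n.+1 x <= Hoo x)%E by apply: lime_ge => //; exists n.+1 => // m nm; exact: ndH.
      apply: le_trans; rewrite lee_fin big_ord_recr/= lerDr sumr_ge0//.
    rewrite -[leLHS]/(`|d n x|) -[leLHS]normr_id -sqrtr_sqr real_normK ?num_real//.
    rewrite -[2^-1 ^+ n]ger0_norm ?exprn_ge0 ?invr_ge0//.
    rewrite -sqrtr_sqr -sqrtrM// ler_wsqrtr//.
    rewrite exprAC (_ : 2^-1 ^+ 2 = 4^-1); last by field.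
    by rewrite exprVn ler_pdivlMr ?exprn_gt0// mulrC.
  exists l; split.
    by rewrite /G; under eq_fun do rewrite xE mulr1.
  move=> _ n; rewrite -real_normK ?num_real//.
  have : `|l - g n x| ^+ 2 <= (2 * Num.sqrt eta * 2^-1 ^+ n) ^+ 2.
    by rewrite ler_sqr ?nnegrE// ?lb// !mulr_ge0// ?sqrtr_ge0// exprn_ge0// invr_ge0.
  move/le_trans; apply; rewrite !exprMn sqr_sqrtr// exprAC.
  have e22 : (2 : R) ^+ 2 = 4 by ring.
  have e4 : (2^-1 : R) ^+ 2 = 4^-1 by field.
  by rewrite e22 e4.
pose h x := projT1 (cid (key x)).
have hE x : (G n x @[n --> \oo] --> h x) /\
    (E x -> forall n, (h x - g n x) ^+ 2 <= 4 * fine (Hoo x) * 4^-1 ^+ n).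
  by rewrite /h; case: cid.
have mh : measurable_fun setT h.
  apply: (@measurable_fun_cvg _ _ _ setT G) => [n|x _]; last by case: (hE x).
  apply: measurable_funM; first by case: (sg n).
  exact: measurable_indic.
have mhg n : measurable_fun setT (fun x => (h x - g n x) ^+ 2).
  by apply: measurable_funX; apply: measurable_funB => //; case: (sg n).
have bnd n : (\int[mu]_x ((h x - g n x) ^+ 2)%:E <= (8 * C * 4^-1 ^+ n)%:E)%E.
  apply: (@le_trans _ _ (\int[mu]_x ((4 * 4^-1 ^+ n)%:E * Hoo x))%E).
    apply: ae_ge0_le_integral => //.
    - by move=> x _; rewrite lee_fin sqr_ge0.
    - exact/measurable_EFinP.
    - by move=> x _; rewrite mule_ge0// lee_fin mulr_ge0// exprn_ge0// invr_ge0.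
    - exact: measurable_funeM.
    - apply: filterS aeHoo => x /(_ Logic.I) Ex _.
      have [_ /(_ Ex n)] := hE x.
      by rewrite -{2}[Hoo x]fineK// -EFinM lee_fin mulrAC.
  rewrite ge0_integralZl//.
  apply: (@le_trans _ _ ((4 * 4^-1 ^+ n)%:E * (2 * C)%:E)%E).
    by rewrite lee_wpmul2l// lee_fin mulr_ge0// exprn_ge0// invr_ge0.
  by rewrite -EFinM lee_fin; lra.
have shg n : sqint (fun x => h x - g n x).
  split; first by apply: measurable_funB => //; case: (sg n).
  apply/integrableP; split; first exact/measurable_EFinP.
  under eq_integral => x _ do rewrite /= ger0_norm ?sqr_ge0//.
  by apply: le_lt_trans (bnd n) _; exact: ltry.
exists h.
  have -> : h = fun x => (h x - g 0%N x) + g 0%N x by apply/funext => x; rewrite subrK.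
  exact: sqintD.
exists (8 * C) => n; rewrite -lee_fin.
apply: le_trans (bnd n); rewrite /ip /Rintegral fineK.
  by under eq_integral do rewrite -expr2.
by apply: integrable_fin_num => //; exact: sqint_mul.
Qed.

(** The partial sums are a Cauchy sequence; [sqint_complete] applies to a
    subsequence whose remainders decay like [8^-i]. *)
Lemma riesz_fischer_fun c B : conj_sym c -> sumbd (fun k => cnorm (c k) ^+ 2) B ->
  exists h, [/\ sqint h, forall k, fourier h k = c k & ip h h <= area * B].
Proof.
move=> ch cB; pose S n := \sum_(k <- zbox n) cnorm (c k) ^+ 2.
have a0 := area_gt0.
have Snd : nondecreasing_seq S.
  move=> m n mn; apply: ler_sum_sub; [by move=> k; exact: sqr_ge0|exact: zbox_uniq|].
  exact: sub_zbox.
have Scv : cvgn S.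
  by apply: nondecreasing_is_cvgn => //; exists B => _ [n _ <-]; exact: cB (zbox_uniq _).
pose L : R := limn S.
have SL n : S n <= L by exact: nondecreasing_cvgn_le.
(* The remainder of the norm is at most [8^-i] from the rank [nu i] on. *)
have pick i : exists n, (i <= n)%N /\ L - S n <= 8^-1 ^+ i.
  have e0 : (0 : R) < 8^-1 ^+ i by rewrite exprn_gt0// invr_gt0.
  have /cvgrPdist_le/(_ _ e0)[N _ hN] : S n @[n --> \oo] --> L by [].
  exists (maxn i N); split; first exact: leq_maxl.
  by have /= := hN (maxn i N) (leq_maxr _ _); rewrite ger0_norm ?subr_ge0.
pose nu i := projT1 (cid (pick i)).
have nuP i : (i <= nu i)%N /\ L - S (nu i) <= 8^-1 ^+ i by rewrite /nu; case: cid.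
have dist m n (e : R) : L - S m <= e -> L - S n <= e ->
    ip (fun x => trig_poly c (zbox n) x - trig_poly c (zbox m) x)
     (fun x => trig_poly c (zbox n) x - trig_poly c (zbox m) x) <= area * e.
  move=> hm hn; have [mn|/ltnW nm] := leqP m n.
    rewrite ip_trig_polyB// ler_wpM2l ?(ltW a0)// -/(S m) -/(S n).
    by have := SL n; lra.
  have -> : (fun x => trig_poly c (zbox n) x - trig_poly c (zbox m) x) =
     (fun x => -1 * (trig_poly c (zbox m) x - trig_poly c (zbox n) x)).
    by apply/funext => x; rewrite mulN1r opprB.
  have sq : sqint (fun x => trig_poly c (zbox m) x - trig_poly c (zbox n) x).
    by apply: sqintB; exact: sqint_trig_poly.
  rewrite ipZl//; last exact: sqintZ.
  rewrite ipC ipZl// mulrA mulrNN !mulr1 mul1r.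
  rewrite ip_trig_polyB// ler_wpM2l ?(ltW a0)// -/(S m) -/(S n).
  by have := SL m; lra.
have [||h sh [D hD]] := @sqint_complete (fun i => trig_poly c (zbox (nu i))) area.
- by move=> n; exact: sqint_trig_poly.
- move=> n; apply: dist; first by case: (nuP n).
  have [_ h1] := nuP n.+1; apply: le_trans h1 _.
  rewrite exprS ler_piMl ?exprn_ge0 ?invr_ge0//; lra.
suff hc : forall k, fourier h k = c k.
  exists h; split=> //; apply/ler_addgt0Pl => e e0.
  have D0 : 0 <= D by have := hD 0%N; rewrite expr0 mulr1; apply: le_trans; exact: ip_ge0.
  have : (D * 4^-1 ^+ n @[n --> \oo] --> D * 0).
    by apply: cvgMr; apply: cvg_expr; rewrite ger0_norm; lra.
  rewrite mulr0 => /cvgrPdist_le/(_ _ e0)[N _ /(_ N (leqnn _))].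
  rewrite /= sub0r normrN ger0_norm ?mulr_ge0 ?exprn_ge0 ?invr_ge0// => De.
  have := bessel_identity (nu N) sh; have := hD N.
  have -> : fourier h = c by apply/funext.
  have : area * S (nu N) <= area * B by rewrite ler_wpM2l ?(ltW a0)// cB ?zbox_uniq.
  by rewrite /S; lra.
move=> k.
have close (T : plane R -> R) : sqint T -> ip T T <= area ->
    forall i, `|ip (fun x => h x - trig_poly c (zbox (nu i)) x) T| <= Num.sqrt (D * area) * 2^-1 ^+ i.
  move=> sT Ta i; have sq := sqintB sh (sqint_trig_poly c (zbox (nu i))).
  have D0 : 0 <= D by have := hD 0%N; rewrite expr0 mulr1; apply: le_trans; exact: ip_ge0.
  apply: le_trans (ip_cauchy_schwarz sq sT) _.
  rewrite -sqrtrM ?ip_ge0// -[2^-1 ^+ i]ger0_norm ?exprn_ge0 ?invr_ge0//.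
  have DA : 0 <= D * area by rewrite mulr_ge0// ltW.
  rewrite -sqrtr_sqr -(sqrtrM _ DA) ler_wsqrtr//.
  have e4 : (2^-1 : R) ^+ 2 = 4^-1 by field.
  by rewrite exprAC e4 mulrAC ler_pM ?ip_ge0.
have lim0 (K a : R) : (forall i, (supnorm k <= i)%N -> `|a| <= K * 2^-1 ^+ i) -> a = 0.
  move=> ha; apply/eqP; rewrite -normr_le0; apply/ler_addgt0Pl => e e0; rewrite addr0.
  have : (K * 2^-1 ^+ n @[n --> \oo] --> K * 0).
    by apply: cvgMr; apply: cvg_expr; rewrite ger0_norm; lra.
  rewrite mulr0 => /cvgrPdist_le/(_ _ e0)[N _ hN].
  have := hN _ (leq_maxr (supnorm k) N); rewrite /= sub0r normrN.
  by move/(le_trans (ler_norm _)); apply: le_trans; apply: ha; exact: leq_maxl.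
have fT i : (supnorm k <= i)%N -> fourier (trig_poly c (zbox (nu i))) k = c k.
  by move=> ki; rewrite fourier_trig_poly// (leq_trans ki)//; case: (nuP i).
have Icc : ip (cosk k) (cosk k) <= area.
  rewrite ip_coscos eqxx; case: eqP => _ /=; rewrite ?addr0; lra.
have Iss : ip (sink k) (sink k) <= area.
  rewrite ip_sinsin eqxx; case: eqP => _ /=; rewrite ?subr0; lra.
have sc := sqint_cosk k; have ss := sqint_sink k.
apply: complex_eqP; apply/eqP; rewrite -subr_eq0; apply/eqP.
- apply: (lim0 (area^-1 * Num.sqrt (D * area))) => i ki.
  have st := sqint_trig_poly c (zbox (nu i)).
  rewrite -(fT _ ki) !Re_fourier -mulrBr -ipBl//.
  rewrite normrM ger0_norm ?invr_ge0 ?(ltW a0)// -mulrA ler_wpM2l ?invr_ge0 ?(ltW a0)//.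
  exact: close.
- apply: (lim0 (area^-1 * Num.sqrt (D * area))) => i ki.
  have st := sqint_trig_poly c (zbox (nu i)).
  rewrite -(fT _ ki) !Im_fourier -opprD -mulrBr -ipBl//.
  rewrite normrN normrM ger0_norm ?invr_ge0 ?(ltW a0)// -mulrA ler_wpM2l ?invr_ge0 ?(ltW a0)//.
  exact: close.
Qed.

Lemma fourier_inj f g : sqint f -> sqint g -> (forall k, fourier f k = fourier g k) ->
  {ae mu, forall x, f x = g x}.
Proof.
move=> sf sg fg.
have : vanishing (fun x => f x - g x).
  split; first by apply: sqint_int; exact: sqintB.
  move=> k; have sc := sqint_cosk k; have ss := sqint_sink k.
  split.
    rewrite -[LHS]/(ip (fun x => f x - g x) (cosk k)) ipBl//.
    by rewrite !ip_cosk fg subrr.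
  rewrite -[LHS]/(ip (fun x => f x - g x) (sink k)) ipBl//.
  by rewrite !ip_sink fg subrr.
by move/vanishing_ae0; apply: filterS => x /eqP; rewrite subr_eq0 => /eqP.
Qed.

(** Bessel's inequality is the converse estimate. Here [f] is recovered from its
    coefficients, by Riesz-Fischer and uniqueness. *)
Lemma parseval_le f B : sqint f -> sumbd (fun k => cnorm (fourier f k) ^+ 2) B ->
  ip f f <= area * B.
Proof.
move=> sf fB; have [h [sh fh hB]] := riesz_fischer_fun (conj_sym_fourier sf) fB.
have hf := fourier_inj sh sf fh.
apply: le_trans hB; rewrite le_eqVlt; apply/orP; left; apply/eqP/esym.
have mf : measurable_fun setT (fun x => f x * f x).
  by apply: measurable_funM; case: sf.
have [] := tint_ae_eq (sqint_mul sh sh) mf _; last by [].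
by apply: filterS hf => x ->.
Qed.

(** The chosen representative of a class agrees almost everywhere with the
    function from which the class was formed. *)
Lemma repr_pi (g : {mfun plane R >-> R}) :
  {ae mu, forall x, fun_of_field (\pi_(field R)%qT g) x = g x}.
Proof.
have /eqmodP/asboolP h : (repr (\pi_(field R) g) = g %[mod field R])%qT by rewrite reprK.
by apply: filterS h => x /(_ Logic.I).
Qed.

End Fourier.

(** * Sobolev norms and the advection term in Fourier variables *)

Section Fields.
Context {R : realType}.
Local Notation mu := (torus_measure R).
Local Notation Z2 := (int * int)%type.
Local Notation Re := complex.Re.
Local Notation Im := complex.Im.
Local Notation kabs := (@kabs R).
Local Notation area := (@area R).
Implicit Types (f g : plane R -> R) (c : Z2 -> R[i]) (j k : Z2) (phi psi theta : field R).

#[local] Opaque fourier.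

Lemma measurable_field phi : measurable_fun setT (phi : plane R -> R).
Proof. by rewrite /fun_of_field. Qed.

Lemma L2norm_sqint phi : sqint phi -> L2norm phi = (Num.sqrt (ip phi phi))%:E.
Proof.
move=> sp; rewrite /L2norm unlock.
have -> : (\int[mu]_x `|(EFin \o (phi : plane R -> R)) x| `^ 2)%E = (ip phi phi)%:E.
  rewrite /ip /Rintegral fineK; last first.
    by apply: integrable_fin_num => //; exact: sqint_mul.
  apply: eq_integral => x _ /=; congr (_%:E).
  by rewrite powR_mulrn// real_normK ?num_real// expr2.
by rewrite poweR_EFin powR12_sqrt// ip_ge0.
Qed.

Lemma L2norm_ltyP phi : (L2norm phi < +oo)%E -> sqint phi.
Proof.
rewrite /L2norm unlock => /lty_poweRy; rewrite invr_eq0 pnatr_eq0/= => /(_ isT) h.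
split; first exact: measurable_field.
apply/integrableP; split.
  by apply/measurable_EFinP; apply: measurable_funX; exact: measurable_field.
apply: le_lt_trans h; rewrite le_eqVlt; apply/orP; left; apply/eqP.
apply: eq_integral => x _ /=; congr (_%:E).
by rewrite powR_mulrn// normrX.
Qed.

Lemma sqint_L2norm_lty phi : sqint phi -> (L2norm phi < +oo)%E.
Proof. by move=> /L2norm_sqint ->; exact: ltry. Qed.

Lemma ae_eq_fourier f g : sqint f -> sqint g -> {ae mu, forall x, f x = g x} ->
  forall k, fourier f k = fourier g k.
Proof.
move=> sf sg fg k.
have gen (T : plane R -> R) : tbounded T -> ip f T = ip g T.
  move=> bT; have sT := sqint_bounded bT.
  have [] := tint_ae_eq (sqint_mul sf sT) (tint_measurable (sqint_mul sg sT)) _ => //.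
  by apply: filterS fg => x ->.
by rewrite !fourierE !gen//; [exact: tbounded_sink|exact: tbounded_cosk].
Qed.

Lemma field_of_fun f : sqint f -> exists phi : field R, [/\ sqint phi,
  {ae mu, forall x, phi x = f x} & forall k, fourier phi k = fourier f k].
Proof.
move=> sf; have mf : f \in mfun by rewrite inE; case: sf.
pose F : {mfun plane R >-> R} := mfun_Sub mf.
pose phi : field R := \pi_(field R)%qT F.
have h : {ae mu, forall x, phi x = f x} := repr_pi F.
have sp : sqint phi.
  split; first exact: measurable_field.
  have [_ tf] := sf.
  have [] := tint_ae_eq (g := fun x => (phi x) ^+ 2) tf _ _ => //.
    by apply: measurable_funX; exact: measurable_field.
  by apply: filterS h => x ->.
by exists phi; split=> //; exact: ae_eq_fourier.
Qed.

Lemma riesz_fischer c B : conj_sym c -> sumbd (fun k => cnorm (c k) ^+ 2) B ->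
  exists2 phi : field R, (L2norm phi < +oo)%E & forall k, fourier phi k = c k.
Proof.
move=> ch cB; have [h [sh hc _]] := riesz_fischer_fun ch cB.
have [phi [sp _ pc]] := field_of_fun sh.
by exists phi; [exact: sqint_L2norm_lty|move=> k; rewrite pc].
Qed.

Lemma conj_symM m c : conj_sym m -> conj_sym c -> conj_sym (fun k => m k * c k).
Proof. by move=> hm hc k; rewrite hm hc rmorphM. Qed.

(** Riesz-Fischer provides a function with the right coefficients, and then the
    choice made in [multiplier] has the same property. *)
Lemma multiplierP m phi B : sqint phi -> conj_sym m ->
  sumbd (fun k => cnorm (m k * fourier phi k) ^+ 2) B ->
  is_multiplier m phi (multiplier m phi).
Proof.
move=> sp hm mB.
have [psi h1 h2] := riesz_fischer (conj_symM hm (conj_sym_fourier sp)) mB.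
by rewrite /multiplier; case: xgetP => [? -> //|/(_ psi)[]].
Qed.

Lemma multiplier_spec m phi : (exists psi, is_multiplier m phi psi) ->
  is_multiplier m phi (multiplier m phi).
Proof. by move=> [psi h]; rewrite /multiplier; case: xgetP => [? -> //|/(_ psi)[]]. Qed.

Lemma conj_sym_Lambda s : conj_sym (@Lambda_symbol R s).
Proof. by move=> k; rewrite /Lambda_symbol kabsN conjc_real. Qed.

Lemma Lambda_symbolE s k : cnorm (@Lambda_symbol R s k) = kabs k `^ s.
Proof. by rewrite /Lambda_symbol cnorm_real ger0_norm ?powR_ge0. Qed.

Lemma Hnorm_leP s phi M : (Hnorm s phi <= M%:E)%E ->
  [/\ Hs s phi, sqint phi, 0 <= M &
   sumbd (fun k => (kabs k `^ s * cnorm (fourier phi k)) ^+ 2) (area^-1 * M ^+ 2)].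
Proof.
rewrite /Hnorm; case: pselect => // hs hM; have [l2 z ex] := hs.
have [ls lc] := multiplier_spec ex; have sl := L2norm_ltyP ls.
have sp := L2norm_ltyP l2.
move: hM; rewrite L2norm_sqint// lee_fin => hM.
have M0 : 0 <= M by apply: le_trans hM; exact: sqrtr_ge0.
split=> //; apply: sumbd_le (bessel sl) => [k|].
  by rewrite lc cnormM Lambda_symbolE.
rewrite ler_wpM2l ?invr_ge0 ?(ltW (@area_gt0 R))//.
rewrite -[ip _ _]sqr_sqrtr ?ip_ge0// ler_sqr ?nnegrE ?sqrtr_ge0//.
Qed.

Lemma HsP s phi B : sqint phi -> fourier phi 0 = 0 ->
  sumbd (fun k => (kabs k `^ s * cnorm (fourier phi k)) ^+ 2) B -> Hs s phi.
Proof.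
move=> sp z hB; split; [exact: sqint_L2norm_lty|exact: z|].
exists (Lambda s phi); apply: multiplierP (conj_sym_Lambda s) _ => //.
by apply: sumbd_le hB => // k; rewrite cnormM Lambda_symbolE.
Qed.

Lemma Hnorm_le s phi B : sqint phi -> fourier phi 0 = 0 ->
  sumbd (fun k => (kabs k `^ s * cnorm (fourier phi k)) ^+ 2) B ->
  (Hnorm s phi <= (Num.sqrt (area * B))%:E)%E.
Proof.
move=> sp z hB; have hs := HsP sp z hB; have B0 := sumbd_ge0 hB.
have [_ _ ex] := hs; rewrite /Hnorm; case: pselect => // ?.
have [ls lc] := multiplier_spec ex; have sl := L2norm_ltyP ls.
rewrite L2norm_sqint// lee_fin ler_wsqrtr//.
apply: parseval_le => //; apply: sumbd_le hB => // k.
by rewrite lc cnormM Lambda_symbolE.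
Qed.

Lemma fourier_subf phi psi k : sqint phi -> sqint psi ->
  sqint (subf phi psi) /\ fourier (subf phi psi) k = fourier phi k - fourier psi k.
Proof.
move=> sp sq; have sB := sqintB sp sq.
have h : {ae mu, forall x, subf phi psi x = phi x - psi x} := repr_pi _.
have s1 : sqint (subf phi psi).
  split; first exact: measurable_field.
  have [_ tf] := sB.
  have [] := tint_ae_eq (g := fun x => (subf phi psi x) ^+ 2) tf _ _ => //.
    by apply: measurable_funX; exact: measurable_field.
  by apply: filterS h => x ->.
by split=> //; rewrite (ae_eq_fourier s1 sB h) fourierB.
Qed.

Lemma ip_mul_trig f j k : sqint f ->
  [/\ ip (fun x => cosk j x * f x) (cosk k) =
        2^-1 * (ip f (cosk (k - j)) + ip f (cosk (k + j))),
      ip (fun x => sink j x * f x) (cosk k) =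
        2^-1 * (ip f (sink (k + j)) - ip f (sink (k - j))),
      ip (fun x => cosk j x * f x) (sink k) =
        2^-1 * (ip f (sink (k + j)) + ip f (sink (k - j))) &
      ip (fun x => sink j x * f x) (sink k) =
        2^-1 * (ip f (cosk (k - j)) - ip f (cosk (k + j)))].
Proof.
move=> sf.
have c1 := sqint_cosk (R := R) (k - j); have c2 := sqint_cosk (R := R) (k + j).
have s1 := sqint_sink (R := R) (k - j); have s2 := sqint_sink (R := R) (k + j).
have gen (g h : plane R -> R) (a b : R) (F : plane R -> R) : sqint g -> sqint h ->
    (forall x, F x = f x * (a * g x + b * h x)) ->
    \int[mu]_x F x = a * ip f g + b * ip f h.
  move=> sg sh FE; rewrite [ip f g]ipC [ip f h]ipC -!ipZl// -ipDl//; try exact: sqintZ.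
  by apply: eq_Rintegral => x _; rewrite FE mulrC.
split.
- rewrite /ip (gen _ _ 2^-1 2^-1 _ c1 c2) -/(ip _ _) -/(ip _ _); first by rewrite /ip; ring.
  by move=> x; rewrite /cosk !kdotD kdotN cosB cosD; field.
- rewrite /ip (gen _ _ 2^-1 (- 2^-1) _ s2 s1); first by rewrite /ip; ring.
  by move=> x; rewrite /sink /cosk !kdotD kdotN sinD sinB; field.
- rewrite /ip (gen _ _ 2^-1 2^-1 _ s2 s1); first by rewrite /ip; ring.
  by move=> x; rewrite /sink /cosk !kdotD kdotN sinD sinB; field.
- rewrite /ip (gen _ _ 2^-1 (- 2^-1) _ c1 c2); first by rewrite /ip; ring.
  by move=> x; rewrite /cosk /sink !kdotD kdotN cosB cosD; field.
Qed.

Lemma sqint_mul_trig_poly c s f : sqint f -> sqint (fun x => trig_poly c s x * f x).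
Proof. by apply: sqintM; exact: tbounded_trig_poly. Qed.

Lemma sum_zboxN (V : nmodType) (F : Z2 -> V) n :
  \sum_(k <- zbox n) F k = \sum_(k <- zbox n) F (- k).
Proof.
rewrite -(big_map (fun k => - k) xpredT F); apply: perm_big.
have inj : injective (fun k : Z2 => - k) by move=> x y /oppr_inj.
apply: uniq_perm; rewrite ?(map_inj_uniq inj) ?zbox_uniq//.
move=> k; apply/idP/mapP => [kn|[l ln ->]]; last by rewrite mem_zbox supnormN -mem_zbox.
by exists (- k); rewrite ?opprK// mem_zbox supnormN -mem_zbox.
Qed.

(** The product formulas give terms at [k - j] and conjugate ones at [k + j]; by
    the symmetry of the box the latter can be reindexed into the former. *)
Lemma fourier_mul_trig_poly c n f k : conj_sym c -> sqint f ->
  fourier (fun x => trig_poly c (zbox n) x * f x) k =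
  \sum_(j <- zbox n) c j * fourier f (k - j).
Proof.
move=> ch sf.
have E (s : seq Z2) : fourier (fun x => trig_poly c s x * f x) k =
    \sum_(j <- s) (2^-1)%:C * (c j * fourier f (k - j) + ((c j)^*)%C * fourier f (k + j)).
  elim: s => [|j s ih].
    rewrite big_nil fourierE (_ : (fun x => _) = fun=> 0) ?ip0l.
      by rewrite mulr0 oppr0.
    by apply/funext => x; rewrite /trig_poly big_nil mul0r.
  have sc : sqint (fun x => cosk j x * f x) by apply: sqintM => //; exact: tbounded_cosk.
  have ss : sqint (fun x => sink j x * f x) by apply: sqintM => //; exact: tbounded_sink.
  have sC := sqintZ (Re (c j)) sc; have sS := sqintZ (- Im (c j)) ss.
  rewrite big_cons -ih (_ : (fun x => _) = fun x => (Re (c j) * (cosk j x * f x) +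
      - Im (c j) * (sink j x * f x)) + trig_poly c s x * f x); last first.
    by apply/funext => x; rewrite trig_poly_cons; ring.
  rewrite fourierD; [|exact: sqintD|exact: sqint_mul_trig_poly].
  congr (_ + _); rewrite fourierD// !fourierZ// !fourierE.
  have [-> -> -> ->] := ip_mul_trig j k sf.
  by apply: complex_eqP; case: (c j) => a b /=; ring.
rewrite E -mulr_sumr big_split/=.
rewrite [X in _ * (_ + X)]sum_zboxN.
under [X in _ * (_ + X)]eq_bigr do rewrite ch conjcK.
rewrite mulrDr -mulrDl -rmorphD/= (_ : 2^-1 + 2^-1 = 1 :> R) ?rmorph1 ?mul1r//; lra.
Qed.

Lemma cnorm_fourier_le f K :
  (forall T, sqint T -> (forall x, `|T x| <= 1) -> `|ip f T| <= K) ->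
  forall k, cnorm (fourier f k) <= area^-1 * (2 * K).
Proof.
move=> h k; apply: le_trans (cnorm_le_ReIm _) _.
have a0 : 0 <= area^-1 by rewrite invr_ge0 ltW// area_gt0.
rewrite Re_fourier Im_fourier normrN !normrM (ger0_norm a0) -mulrDr ler_wpM2l//.
rewrite mulr2n mulrDl mul1r lerD// h//; try exact: sqint_cosk; try exact: sqint_sink.
  by move=> x; exact: cos_max.
by move=> x; exact: sin_max.
Qed.

Lemma tint_fourierD f g k : tint f -> tint g ->
  fourier (fun x => f x + g x) k = fourier f k + fourier g k.
Proof.
move=> tf tg.
have gen (T : plane R -> R) : tbounded T -> ip (fun x => f x + g x) T = ip f T + ip g T.
  move=> bT; rewrite /ip -RintegralD//; try (under eq_fun do rewrite mulrC; exact: tintM).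
  by apply: eq_Rintegral => x _; rewrite mulrDl.
rewrite !fourierE !gen; [|exact: tbounded_sink|exact: tbounded_cosk].
by apply: complex_eqP => /=; ring.
Qed.

Lemma tint_fourierN f k : tint f -> fourier (fun x => - f x) k = - fourier f k.
Proof.
move=> tf.
have gen (T : plane R -> R) : tbounded T -> ip (fun x => - f x) T = - ip f T.
  move=> bT; rewrite /ip -mulN1r -RintegralZl//; last first.
    by under eq_fun do rewrite mulrC; exact: tintM.
  by apply: eq_Rintegral => x _; rewrite mulN1r mulNr.
rewrite !fourierE !gen; [|exact: tbounded_sink|exact: tbounded_cosk].
by apply: complex_eqP => /=; ring.
Qed.

(** The Fourier coefficient of a product is a convolution up to an error that is
    uniform in the frequency: the truncation of [f] is controlled by
    [parseval_le], its product with [g] by Cauchy-Schwarz. *)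
Lemma fourier_mul f g n k eps B : sqint f -> sqint g ->
  sumbd (fun k => if (supnorm k <= n)%N then 0 else cnorm (fourier f k) ^+ 2) eps ->
  sumbd (fun k => cnorm (fourier g k) ^+ 2) B ->
  cnorm (fourier (fun x => f x * g x) k - \sum_(j <- zbox n) fourier f j * fourier g (k - j))
   <= 2 * (Num.sqrt eps * Num.sqrt B).
Proof.
move=> sf sg fe gB; have a0 := @area_gt0 R.
have ch := conj_sym_fourier sf.
pose p := trig_poly (fourier f) (zbox n).
have sp : sqint p by exact: sqint_trig_poly.
have spg : sqint (fun x => p x * g x) by exact: sqint_mul_trig_poly.
have sfp := sqintB sf sp.
have e0 := sumbd_ge0 fe; have B0 := sumbd_ge0 gB.
rewrite -fourier_mul_trig_poly// -/p.
have -> : fourier (fun x => f x * g x) k - fourier (fun x => p x * g x) k =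
    fourier (fun x => (f x - p x) * g x) k.
  apply/eqP; rewrite subr_eq -tint_fourierD; [|exact: sqint_mul|exact: sqint_mul].
  by apply/eqP; apply: (f_equal (fun F => fourier F k)); apply/funext => x; ring.
have hfp : ip (fun x => f x - p x) (fun x => f x - p x) <= area * eps.
  apply: parseval_le => //; apply: sumbd_le fe => // j.
  rewrite fourierB// fourier_trig_poly//; case: ifP => _; last by rewrite subr0.
  by rewrite subrr /cnorm ComplexField.Normc.normc0 expr0n.
have hg : ip g g <= area * B by exact: parseval_le.
have -> : 2 * (Num.sqrt eps * Num.sqrt B) =
    area^-1 * (2 * (Num.sqrt (area * eps) * Num.sqrt (area * B))).
  rewrite !(sqrtrM _ (ltW a0)).
  have -> : Num.sqrt area * Num.sqrt eps * (Num.sqrt area * Num.sqrt B) =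
    Num.sqrt area ^+ 2 * (Num.sqrt eps * Num.sqrt B) by ring.
  rewrite sqr_sqrtr ?(ltW a0)// [2 * (area * _)]mulrCA mulKf//; by rewrite gt_eqF.
apply: cnorm_fourier_le => T sT T1.
have sgT : sqint (fun x => g x * T x).
  have [mT _] := sT; have := @sqintM R T g _ sg; under eq_fun do rewrite mulrC.
  by apply; split=> //; exists 1.
have -> : ip (fun x => (f x - p x) * g x) T = ip (fun x => f x - p x) (fun x => g x * T x).
  by apply: eq_Rintegral => x _; rewrite mulrA.
apply: le_trans (ip_cauchy_schwarz sfp sgT) _.
apply: ler_pM; rewrite ?sqrtr_ge0 ?ler_wsqrtr//.
apply: le_trans hg; apply: le_Rintegral => //; try exact: sqint_mul.
move=> x _; rewrite mulrACA ler_piMr -?expr2 ?sqr_ge0//.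
by rewrite -real_normK ?num_real// expr_le1.
Qed.

Lemma cnorm0 : cnorm (0 : R[i]) = 0.
Proof. exact: ComplexField.Normc.normc0. Qed.

(** A consequence of the bound [M] for the norm of [H^(3/2)], because the area
    of the torus is at least [1]. *)
Definition h32 (c : Z2 -> R[i]) (M : R) :=
  c 0 = 0 /\ sumbd (fun k => kabs k ^+ 3 * cnorm (c k) ^+ 2) (M ^+ 2).

Lemma h32_le c M n : h32 c M -> (n <= 3)%N ->
  sumbd (fun k => kabs k ^+ n * cnorm (c k) ^+ 2) (M ^+ 2).
Proof.
move=> [c0 h] n3; apply: sumbd_le h => // k.
have [->|k0] := eqVneq k 0; first by rewrite c0 cnorm0 expr0n !mulr0.
by rewrite ler_wpM2r ?sqr_ge0// ler_weXn2l// kabs_ge1.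
Qed.

Lemma h32_tail c M n : h32 c M ->
  sumbd (fun k => if (supnorm k <= n)%N then 0 else kabs k ^+ 2 * cnorm (c k) ^+ 2)
    (M ^+ 2 / n.+1%:R).
Proof.
move=> [c0 h]; rewrite mulrC.
apply: sumbd_le (sumbdZ (c := n.+1%:R^-1) _ h) => [k||]; rewrite ?invr_ge0//.
case: leqP => kn.
  by rewrite mulr_ge0 ?invr_ge0// mulr_ge0 ?sqr_ge0// exprn_ge0// kabs_ge0.
rewrite [leRHS]mulrA; apply: ler_wpM2r; first exact: sqr_ge0.
rewrite mulrC ler_pdivlMr ?ltr0n// [leRHS]exprSr.
by rewrite ler_wpM2l ?sqr_ge0// (le_trans _ (supnorm_kabs _))// ler_nat.
Qed.

Lemma area_ge1 : 1 <= area.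
Proof. by rewrite expr_ge1 ?mulr_ge0 ?pi_ge0//; have := @pi_ge2 R; lra. Qed.

Lemma Hnorm32_h32 theta M : (Hnorm (3 / 2) theta <= M%:E)%E ->
  sqint theta /\ h32 (fourier theta) M.
Proof.
move=> /Hnorm_leP[[_ z _] st M0 hs]; split=> //; split=> //.
apply: sumbd_le hs => [k|].
  rewrite exprMn -[X in _ <= X * _]powR_mulrn ?powR_ge0// -powRrM.
  by rewrite (_ : 3 / 2 * 2 = 3%:R) ?powR_mulrn ?kabs_ge0//; lra.
by rewrite ler_piMl ?sqr_ge0// invf_le1 ?area_ge1 ?area_gt0.
Qed.

(** The symbol of the bilinear expression [R^perp a . grad b], with [j] the
    frequency of [a] and [l] that of [b]. *)
Definition beta j l : R := cross j l / kabs j.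

(** The truncation bears on the frequency of the velocity; it keeps the sum
    finite. *)
Definition bilin (n : nat) (a b : Z2 -> R[i]) k : R[i] :=
  \sum_(j <- zbox n) (beta j (k - j))%:C * (a j * b (k - j)).

(** The symbol of a partial derivative. *)
Definition isym (n : int) : R[i] := 0 +i* n%:~R.

Lemma beta_identity j l (x y : R[i]) :
  (beta j l)%:C * (x * y) =
  - (isym j.2 * ((kabs j)^-1%:C * x) * (isym l.1 * y)) +
  isym j.1 * ((kabs j)^-1%:C * x) * (isym l.2 * y).
Proof.
rewrite /beta /cross; move: (kabs j)^-1 => v; case: x y => [u w] [u' w'].
by apply: complex_eqP => /=; ring.
Qed.

Lemma advection_bilin_gen (r1 r2 q1 q2 : field R) (a : Z2 -> R[i]) (M : R) n k :
  sqint r1 -> sqint r2 -> sqint q1 -> sqint q2 ->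
  sumbd (fun k => if (supnorm k <= n)%N then 0 else cnorm (fourier r1 k) ^+ 2) (M ^+ 2 / n.+1%:R) ->
  sumbd (fun k => if (supnorm k <= n)%N then 0 else cnorm (fourier r2 k) ^+ 2) (M ^+ 2 / n.+1%:R) ->
  sumbd (fun k => cnorm (fourier q1 k) ^+ 2) (M ^+ 2) ->
  sumbd (fun k => cnorm (fourier q2 k) ^+ 2) (M ^+ 2) ->
  (forall k, fourier r1 k = isym k.1 * ((kabs k)^-1%:C * a k)) ->
  (forall k, fourier r2 k = isym k.2 * ((kabs k)^-1%:C * a k)) ->
  (forall k, fourier q1 k = isym k.1 * a k) ->
  (forall k, fourier q2 k = isym k.2 * a k) ->
  cnorm (fourier (fun x => - r2 x * q1 x + r1 x * q2 x) k - bilin n a a k)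
    <= 4 * (M ^+ 2 / Num.sqrt n.+1%:R).
Proof.
move=> s1 s2 p1 p2 t1 t2 b1 b2 e1 e2 f1 f2.
have h1 := fourier_mul k s1 p2 t1 b2; have h2 := fourier_mul k s2 p1 t2 b1.
have -> : fourier (fun x => - r2 x * q1 x + r1 x * q2 x) k = - fourier (fun x => r2 x * q1 x) k
    + fourier (fun x => r1 x * q2 x) k.
  rewrite -tint_fourierN; last exact: sqint_mul.
  rewrite -tint_fourierD; last exact: sqint_mul.
    by apply: (f_equal (fun F => fourier F k)); apply/funext => x; rewrite mulNr.
  have := tintZ (-1) (sqint_mul s2 p1); by under eq_fun do rewrite mulN1r.
have -> : bilin n a a k = - (\sum_(j <- zbox n) fourier (r2) j * fourier (q1) (k - j))
    + \sum_(j <- zbox n) fourier (r1) j * fourier (q2) (k - j).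
  rewrite -sumrN -big_split/=; apply: eq_bigr => j _.
  rewrite e2.
  rewrite e1.
  rewrite f1.
  rewrite f2.
  by rewrite beta_identity.
rewrite opprD opprK addrACA.
apply: le_trans (cnormD _ _) _.
rewrite [X in X + _](_ : _ = cnorm (fourier (fun x => r2 x * q1 x) k -
  \sum_(j <- zbox n) fourier (r2) j * fourier (q1) (k - j))); last first.
  by rewrite -[LHS]normcN opprD !opprK.
have := lerD h2 h1; move/le_trans; apply.
rewrite sqrtrM ?sqr_ge0// sqrtrV// !sqrtr_sqr.
have -> : `|M| / Num.sqrt n.+1%:R * `|M| = M ^+ 2 / Num.sqrt n.+1%:R.
  by rewrite mulrAC -expr2 real_normK ?num_real.
by rewrite -mulrDl -natrD.
Qed.

Section Advection.
Variables (theta : field R) (M : R).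
Hypotheses (st : sqint theta) (hM : h32 (fourier theta) M).
Let a := fourier theta.

Lemma bound_le1 (m : Z2 -> R[i]) n : (n <= 3)%N ->
  (forall k, cnorm (m k) ^+ 2 <= kabs k ^+ n) ->
  sumbd (fun k => cnorm (m k * a k) ^+ 2) (M ^+ 2).
Proof.
move=> n3 hm; apply: sumbd_le (h32_le hM n3) => // k.
by rewrite cnormM exprMn ler_wpM2r ?sqr_ge0.
Qed.

Lemma Lambda1_coef k : fourier (Lambda 1 theta) k = (kabs k)%:C * a k.
Proof.
have [] := @multiplierP (Lambda_symbol 1) theta (M ^+ 2) st (conj_sym_Lambda _) _.
  by apply: (@bound_le1 _ 2%N) => // j; rewrite Lambda_symbolE powRr1 ?kabs_ge0.
by move=> _ ->; rewrite /Lambda_symbol powRr1 ?kabs_ge0.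
Qed.

Lemma cnorm_isym n : cnorm (isym n) ^+ 2 = n%:~R ^+ 2.
Proof. by rewrite sqr_cnorm /= expr0n add0r. Qed.

Lemma conj_sym_isym1 : conj_sym (fun k : Z2 => isym k.1).
Proof. by move=> k; apply: complex_eqP; rewrite /= ?rmorphN. Qed.

Lemma conj_sym_isym2 : conj_sym (fun k : Z2 => isym k.2).
Proof. by move=> k; apply: complex_eqP; rewrite /= ?rmorphN. Qed.

Lemma isym1_le k : cnorm (isym k.1) ^+ 2 <= kabs k ^+ 2.
Proof. by rewrite cnorm_isym sqr_kabs lerDl sqr_ge0. Qed.

Lemma isym2_le k : cnorm (isym k.2) ^+ 2 <= kabs k ^+ 2.
Proof. by rewrite cnorm_isym sqr_kabs lerDr sqr_ge0. Qed.

Let LamV := Lambda (- 1) theta.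

Lemma LambdaV_coef : (L2norm LamV < +oo)%E /\
  forall k, fourier LamV k = (kabs k)^-1%:C * a k.
Proof.
have [] := @multiplierP (Lambda_symbol (- 1)) theta (M ^+ 2) st (conj_sym_Lambda _) _.
  apply: sumbd_le (h32_le hM (leq0n 3)) => // k.
  have [->|k0] := eqVneq k 0.
    by have [-> _] := hM; rewrite mulr0 cnorm0 expr0n mulr0.
  rewrite cnormM exprMn ler_wpM2r ?sqr_ge0// Lambda_symbolE powR_inv1 ?kabs_ge0//.
  by rewrite expr_le1 ?invr_ge0 ?kabs_ge0// invf_le1 ?kabs_ge1// kabs_gt0.
by move=> h e; split=> // k; rewrite e /Lambda_symbol powR_inv1 ?kabs_ge0.
Qed.

Lemma multiplier_coef (m : Z2 -> R[i]) (phi : field R) (c : Z2 -> R[i]) B :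
  conj_sym m -> sqint phi -> (forall k, m k * fourier phi k = c k) ->
  sumbd (fun k => cnorm (c k) ^+ 2) B ->
  sqint (multiplier m phi) /\ forall k, fourier (multiplier m phi) k = c k.
Proof.
move=> ms sp mc cB; have [] := @multiplierP m phi B sp ms _.
  by under eq_fun do rewrite mc.
by move=> h e; split; [exact: L2norm_ltyP|move=> k; rewrite e mc].
Qed.

Lemma riesz_le (m : Z2 -> R[i]) : (forall k, cnorm (m k) ^+ 2 <= kabs k ^+ 2) ->
  forall k, cnorm (m k * ((kabs k)^-1%:C * a k)) ^+ 2 <= cnorm (a k) ^+ 2.
Proof.
move=> hm k; have [->|k0] := eqVneq k 0.
  by have [z _] := hM; rewrite /a z !mulr0.
move: (a k) (m k) (hm k) => x y hy.
rewrite !cnormM !exprMn mulrA ler_piMl ?sqr_ge0// cnorm_real.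
rewrite ger0_norm ?invr_ge0 ?kabs_ge0// exprVn ler_pdivrMr ?exprn_gt0 ?kabs_gt0//.
by rewrite mul1r.
Qed.

(** The error depends neither on the frequency nor on [theta], so that the limit
    in [n] is uniform along a trajectory. *)
Lemma advection_bilin n k :
  cnorm (fourier (advection theta) k - bilin n a a k) <= 4 * (M ^+ 2 / Num.sqrt n.+1%:R).
Proof.
have [lV cV] := LambdaV_coef; have sV := L2norm_ltyP lV.
have l0 : sumbd (fun k => cnorm (a k) ^+ 2) (M ^+ 2).
  by apply: sumbd_le (h32_le hM (leq0n 3)) => // j; rewrite mul1r.
have rz (m : Z2 -> R[i]) : conj_sym m -> (forall k, cnorm (m k) ^+ 2 <= kabs k ^+ 2) ->
    [/\ sqint (multiplier m LamV),
      forall k, fourier (multiplier m LamV) k = m k * ((kabs k)^-1%:C * a k) &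
      sumbd (fun k => if (supnorm k <= n)%N then 0 else
        cnorm (fourier (multiplier m LamV) k) ^+ 2) (M ^+ 2 / n.+1%:R)].
  move=> ms hm.
  have [] := @multiplier_coef m LamV (fun k => m k * ((kabs k)^-1%:C * a k)) (M ^+ 2) ms sV.
  - by move=> j; rewrite cV.
  - by apply: sumbd_le l0 => // j; exact: riesz_le.
  move=> h1 h2; split=> //.
  apply: sumbd_le (h32_tail n hM) => // j; case: leqP => // jn.
  rewrite h2 (le_trans (riesz_le hm j))// ler_peMl ?sqr_ge0//.
  by rewrite exprn_ege1// kabs_ge1// -supnorm_gt0 (leq_trans _ jn).
have pd (m : Z2 -> R[i]) : conj_sym m -> (forall k, cnorm (m k) ^+ 2 <= kabs k ^+ 2) ->
    [/\ sqint (multiplier m theta),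
      forall k, fourier (multiplier m theta) k = m k * a k &
      sumbd (fun k => cnorm (fourier (multiplier m theta) k) ^+ 2) (M ^+ 2)].
  move=> ms hm; have hb := @bound_le1 m 2%N isT hm.
  have [] := @multiplier_coef m theta (fun k => m k * a k) (M ^+ 2) ms st _ hb => //.
  by move=> h1 h2; split=> //; under eq_fun do rewrite h2.
have [s1 e1 t1] := rz _ conj_sym_isym1 isym1_le.
have [s2 e2 t2] := rz _ conj_sym_isym2 isym2_le.
have [p1 f1 b1] := pd _ conj_sym_isym1 isym1_le.
have [p2 f2 b2] := pd _ conj_sym_isym2 isym2_le.
rewrite -/(partial1 LamV) -/(riesz1 theta) in s1 e1 t1.
rewrite -/(partial2 LamV) -/(riesz2 theta) in s2 e2 t2.
rewrite -/(partial1 theta) in p1 f1 b1; rewrite -/(partial2 theta) in p2 f2 b2.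
exact: advection_bilin_gen s1 s2 p1 p2 t1 t2 b1 b2 e1 e2 f1 f2.
Qed.

End Advection.

End Fields.

(** * The quadratic terms in the energy balance of a difference *)

Section Energy.
Context {R : realType}.
Local Notation Z2 := (int * int)%type.
Local Notation Re := complex.Re.
Local Notation Im := complex.Im.
Local Notation kabs := (@kabs R).
Local Notation beta := (@beta R).
Implicit Types (c : Z2 -> R[i]) (j k l : Z2).

Lemma Re_sum (I : Type) (s : seq I) (z : I -> R[i]) :
  Re (\sum_(i <- s) z i) = \sum_(i <- s) Re (z i).
Proof. by elim/big_rec2: _ => //= i x y _ <-; rewrite ReD. Qed.

Lemma ler_sum_seq (I : eqType) (s : seq I) (F G : I -> R) :
  (forall i, i \in s -> F i <= G i) -> \sum_(i <- s) F i <= \sum_(i <- s) G i.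
Proof. by move=> FG; rewrite big_seq [leRHS]big_seq; apply: ler_sum => i /FG. Qed.

Lemma sum_pair_le (s t : seq Z2) (z : Z2 -> Z2 -> R) (F : Z2 * Z2 -> R) B :
  uniq s -> uniq t -> (forall k j, k \in s -> j \in t -> `|z k j| <= F (k, j)) -> sumbd F B ->
  `|\sum_(k <- s) \sum_(j <- t) z k j| <= B.
Proof.
move=> us ut zF FB; apply: le_trans (FB (allpairs pair s t) _); last first.
  by apply: allpairs_uniq => // -[? ?] [? ?] _ _.
rewrite big_allpairs; apply: le_trans (ler_norm_sum _ _ _) _.
apply: ler_sum_seq => k ks; apply: le_trans (ler_norm_sum _ _ _) _.
by apply: ler_sum_seq => j jt; exact: zF.
Qed.

Lemma sumbd_trunc K (F : Z2 -> R) : (forall k, 0 <= F k) ->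
  sumbd (fun k => if (supnorm k <= K)%N then F k else 0) (\sum_(k <- zbox K) F k).
Proof.
move=> F0 s us; rewrite -big_mkcond -big_filter; apply: ler_sum_sub => //.
  exact: filter_uniq.
by move=> k; rewrite mem_filter mem_zbox => /andP[].
Qed.

(** A box that is twice as large contains all the frequencies [k - l] with [k]
    and [l] in the smaller one. *)
Lemma sum_convolution_box K n k (G : Z2 -> R) : (2 * K <= n)%N -> (supnorm k <= K)%N ->
  \sum_(j <- zbox n) (if (supnorm (k - j)%R <= K)%N then G j else 0) =
  \sum_(l <- zbox K) G (k - l).
Proof.
move=> nK kK; rewrite -big_mkcond -big_filter -(big_map (fun l => k - l) xpredT G).
have inj : injective (fun l : Z2 => k - l) by move=> x y /addrI /oppr_inj.
apply: perm_big; apply: uniq_perm; rewrite ?(map_inj_uniq inj) ?filter_uniq ?zbox_uniq//.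
move=> j; rewrite mem_filter; apply/andP/mapP => [[h1 h2]|[l]].
  by exists (k - j); [rewrite mem_zbox|rewrite opprB addrC subrK].
rewrite !mem_zbox => lK ->; rewrite opprB addrC subrK; split=> //.
by rewrite (leq_trans (supnormD _ _))// supnormN (leq_trans (leq_add kK lK))// addnn -mul2n.
Qed.

Variables (a1 a2 : Z2 -> R[i]) (M tau : R).
Hypotheses (sa1 : conj_sym a1) (sa2 : conj_sym a2).
Hypotheses (ha1 : h32 a1 M) (ha2 : h32 a2 M) (M0 : 0 <= M) (tau0 : 0 <= tau).

Let w k := a1 k - a2 k.
Let m k : R := 1 + tau * kabs k.

Lemma cnormB2 (x y : R[i]) : cnorm (x - y) ^+ 2 <= 2 * cnorm x ^+ 2 + 2 * cnorm y ^+ 2.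
Proof.
rewrite !sqr_cnorm !ReD !ImD !ReN !ImN.
move: (Re x) (Im x) (Re y) (Im y) => p q r s.
have := sqr_ge0 (p + r); have := sqr_ge0 (q + s); lra.
Qed.

Lemma h32_diff : h32 w (2 * M).
Proof.
have [z1 h1] := ha1; have [z2 h2] := ha2; split; first by rewrite /w z1 z2 subrr.
apply: sumbd_le (sumbdD (sumbdZ (c := 2) _ h1) (sumbdZ (c := 2) _ h2)) => //.
  move=> k; have := ler_wpM2l (exprn_ge0 3 (kabs_ge0 (R := R) k)) (cnormB2 (a1 k) (a2 k)).
  by rewrite -/(w k); lra.
lra.
Qed.

Variable K : nat.
Let W k := if (supnorm k <= K)%N then w k else 0.
Let Q k := if (supnorm k <= K)%N then 0 else w k.
Let h (i : nat) : R := Num.sqrt (\sum_(k <- zbox K) kabs k ^+ i * cnorm (w k) ^+ 2).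

Lemma m_ge0 k : 0 <= m k.
Proof. by rewrite addr_ge0// mulr_ge0// kabs_ge0. Qed.

Lemma h_ge0 i : 0 <= h i. Proof. exact: sqrtr_ge0. Qed.

Lemma sqr_h i : h i ^+ 2 = \sum_(k <- zbox K) kabs k ^+ i * cnorm (w k) ^+ 2.
Proof.
by rewrite sqr_sqrtr// sumr_ge0// => k _; rewrite mulr_ge0 ?exprn_ge0 ?kabs_ge0// cnorm_ge0.
Qed.

Lemma W0 : W 0 = 0. Proof. by rewrite /W supnorm0 /=; case: h32_diff. Qed.

Lemma sumbd_W i : sumbd (fun k => kabs k ^+ i * cnorm (W k) ^+ 2) (h i ^+ 2).
Proof.
rewrite sqr_h.
have F0 k : 0 <= kabs k ^+ i * cnorm (w k) ^+ 2.
  by rewrite mulr_ge0 ?exprn_ge0 ?kabs_ge0// cnorm_ge0.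
apply: sumbd_le (@sumbd_trunc K _ F0) => // k.
by rewrite /W; case: ifP => // _; rewrite cnorm0 expr0n mulr0.
Qed.

Lemma sumbd_Q : sumbd (fun k => kabs k ^+ 2 * cnorm (Q k) ^+ 2) ((2 * M) ^+ 2 / K.+1%:R).
Proof.
apply: sumbd_le (h32_tail K h32_diff) => // k.
by rewrite /Q; case: ifP => // _; rewrite cnorm0 expr0n mulr0.
Qed.

Lemma sumbd_Q0 : sumbd (fun k => cnorm (Q k) ^+ 2) ((2 * M) ^+ 2 / K.+1%:R).
Proof.
apply: sumbd_le sumbd_Q => // k.
have [->|k0] := eqVneq k 0; first by rewrite (_ : Q 0 = 0)// cnorm0 expr0n mulr0.
by rewrite ler_peMl ?sqr_ge0// exprn_ege1// kabs_ge1.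
Qed.

Lemma sumbd_mW : sumbd (fun k => kabs k * (m k * cnorm (W k)) ^+ 2)
  (((1 + tau) * (2 * M)) ^+ 2).
Proof.
have [_ hw] := h32_diff; rewrite exprMn.
apply: sumbd_le (sumbdZ (sqr_ge0 (1 + tau)) hw) => // k.
rewrite exprMn.
have [->|k0] := eqVneq k 0; first by rewrite W0 cnorm0 kabs0 !expr0n/= !(mul0r, mulr0).
have k1 := kabs_ge1 (R := R) k0.
have mk : m k ^+ 2 <= (1 + tau) ^+ 2 * kabs k ^+ 2.
  rewrite -exprMn ler_sqr ?nnegrE ?m_ge0// ?mulr_ge0 ?addr_ge0 ?kabs_ge0//.
  by rewrite /m mulrDl mul1r lerD2r.
have Ww : cnorm (W k) ^+ 2 <= cnorm (w k) ^+ 2.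
  by rewrite /W; case: ifP => // _; rewrite cnorm0 expr0n sqr_ge0.
rewrite mulrA [leRHS]mulrA; apply: ler_pM => //; rewrite ?sqr_ge0//.
  by rewrite mulr_ge0 ?kabs_ge0 ?sqr_ge0.
have := ler_wpM2l (kabs_ge0 (R := R) k) mk; rewrite [kabs k ^+ 3]exprS; lra.
Qed.

Lemma sumbd_mW0 : sumbd (fun k => (m k * cnorm (W k)) ^+ 2)
  ((2 * (h 0 + tau * h 2)) ^+ 2).
Proof.
apply: sumbd_le (sumbdD (sumbdZ (c := 2) _ (sumbd_W 0))
   (sumbdZ (c := 2 * tau ^+ 2) _ (sumbd_W 2))) => //.
- move=> k; rewrite exprMn expr0 mul1r /m; move: (kabs k) (cnorm (W k)) => x y.
  by have := mulr_ge0 (sqr_ge0 (1 - tau * x)) (sqr_ge0 y); lra.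
- have h0 := h_ge0 0; have h2 := h_ge0 2; have := mulr_ge0 tau0 (mulr_ge0 h0 h2).
  by have := sqr_ge0 (h 0); have := sqr_ge0 (tau * h 2); nra.
- by rewrite mulr_ge0// sqr_ge0.
Qed.

Lemma beta_le j l : `|beta j l| <= kabs l.
Proof.
have [->|j0] := eqVneq j 0.
  by rewrite /beta kabs0 invr0 mulr0 normr0 kabs_ge0.
have p := kabs_gt0 (R := R) j0.
rewrite normrM normfV (gtr0_norm p) ler_pdivrMr// mulrC; exact: cross_le.
Qed.

Let T k l : R := Re ((w k)^*%C * (w l * a1 (k - l))).

Lemma T_sym k l : T l k = T k l.
Proof.
rewrite /T -[l - k]opprB sa1.
move: (w k) (w l) (a1 (k - l)) => [x1 y1] [x2 y2] [x3 y3] /=; ring.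
Qed.

Lemma T_le k l : `|T k l| <= cnorm (w k) * cnorm (w l) * cnorm (a1 (k - l)).
Proof. by apply: le_trans (Re_le_cnorm _) _; rewrite !cnormM cnormJ mulrA. Qed.

Lemma beta_sym k l : beta (l - k) k = - beta (k - l) l.
Proof.
rewrite /beta -(kabsN (l - k)) opprB -mulNr; congr (_ / _).
by rewrite /cross /= !rmorphB/=; ring.
Qed.

Lemma cnorm_sym c j : conj_sym c -> cnorm (c (- j)) = cnorm (c j).
Proof. by move=> ->; rewrite cnormJ. Qed.

(** The term is antisymmetric in [k] and [l] except for its weight, so that
    [m k] can be replaced by half of [m k - m l], which is at most
    [tau |k - l| / 2]. The derivative that falls on the transported function [w]
    is thus moved to the velocity. *)
Lemma transport_commutator :
  `|2 * \sum_(k <- zbox K) \sum_(l <- zbox K) m k * beta (k - l) l * T k l|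
   <= 6 * tau * M * (h 1 * h 2).
Proof.
set S := \sum_(k <- _) _.
have S2 : S = \sum_(k <- zbox K) \sum_(l <- zbox K) - (m l * beta (k - l) l * T k l).
  rewrite /S exchange_big/=; apply: eq_bigr => k _; apply: eq_bigr => l _.
  by rewrite T_sym beta_sym; ring.
have -> : 2 * S = \sum_(k <- zbox K) \sum_(l <- zbox K) (m k - m l) * beta (k - l) l * T k l.
  rewrite mulr2n mulrDl mul1r {1}S2 /S -big_split/=; apply: eq_bigr => k _.
  by rewrite -big_split/=; apply: eq_bigr => l _; ring.
have [z1 b1] := ha1; have [_ sW1] := (tau0, sumbd_W 1).
pose a k := kabs k * cnorm (a1 k).
have aE k : a (- k) = a k by rewrite /a kabsN cnorm_sym.
have aA : sumbd (fun k => kabs k * a k ^+ 2) (M ^+ 2).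
  by apply: sumbd_le b1 => // k; rewrite /a exprMn mulrA -exprS.
have bB : sumbd (fun k => kabs k * cnorm (W k) ^+ 2) (h 1 ^+ 2).
  by apply: sumbd_le sW1 => // k; rewrite expr1.
have cC : sumbd (fun k => (kabs k * cnorm (W k)) ^+ 2) (h 2 ^+ 2).
  by apply: sumbd_le (sumbd_W 2) => // k; rewrite exprMn.
have := @trilinear R a (fun k => cnorm (W k)) (fun k => kabs k * cnorm (W k)) _ _ _
  (fun k => mulr_ge0 (kabs_ge0 k) (cnorm_ge0 (a1 k))) (fun k => cnorm_ge0 (W k))
  (fun k => mulr_ge0 (kabs_ge0 k) (cnorm_ge0 (W k))) _ _ aA bB cC.
rewrite /a kabs0 mul0r W0 cnorm0 -/a => /(_ erefl erefl).
have inj : injective (fun p : Z2 * Z2 => (p.2 - p.1, p.1)).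
  move=> [x1 x2] [y1 y2] e; have e1 : x1 = y1 := f_equal snd e.
  by have := f_equal fst e; rewrite /= e1 => /addIr ->.
move/(sumbd_inj inj)/(sumbdZ tau0).
rewrite !sqrtr_sqr (ger0_norm M0) !(ger0_norm (h_ge0 _)) => tri.
apply: le_trans (sum_pair_le (zbox_uniq _) (zbox_uniq _) _ tri) _ => [k l|].
- rewrite !mem_zbox => kK lK /=; rewrite subrK -[l - k]opprB kabsN (cnorm_sym _ sa1) /W kK lK.
  rewrite 2!normrM.
  have t1 := T_le k l; have t2 := beta_le (k - l) l.
  have t3 : `|m k - m l| <= tau * kabs (k - l).
    rewrite /m opprD addrACA subrr add0r -mulrBr normrM (ger0_norm tau0) ler_wpM2l//.
    exact: kabsB.
  apply: le_trans (ler_pM _ _ (ler_pM _ _ t3 t2) t1) _; rewrite ?mulr_ge0//.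
  by rewrite le_eqVlt; apply/orP; left; apply/eqP; ring.
- by rewrite le_eqVlt; apply/orP; left; apply/eqP; ring.
Qed.

Lemma mW_ge0 k : 0 <= m k * cnorm (W k).
Proof. by rewrite mulr_ge0 ?m_ge0 ?cnorm_ge0. Qed.

Lemma sqrt_tail : Num.sqrt ((2 * M) ^+ 2 / K.+1%:R) = 2 * M / Num.sqrt K.+1%:R.
Proof.
by rewrite sqrtrM ?sqr_ge0// sqrtrV// sqrtr_sqr ger0_norm// mulr_ge0.
Qed.

Lemma sumbd_a1 : sumbd (fun k => kabs k * cnorm (a1 k) ^+ 2) (M ^+ 2).
Proof. by apply: sumbd_le (h32_le ha1 (isT : (1 <= 3)%N)) => // k; rewrite expr1. Qed.

Lemma sumbd_grad_a2 : sumbd (fun k => kabs k * (kabs k * cnorm (a2 k)) ^+ 2) (M ^+ 2).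
Proof. by have [_ b] := ha2; apply: sumbd_le b => // k; rewrite exprMn mulrA -exprS. Qed.

Let err : R := 24 * (1 + tau) * M ^+ 3 / Num.sqrt K.+1%:R.

Lemma transport_tail n :
  `|\sum_(k <- zbox K) \sum_(j <- zbox n)
      m k * Re ((w k)^*%C * ((beta j (k - j))%:C * (a1 j * Q (k - j))))| <= err.
Proof.
have [z1 _] := ha1.
have cC : sumbd (fun k => (kabs k * cnorm (Q k)) ^+ 2) ((2 * M) ^+ 2 / K.+1%:R).
  by apply: sumbd_le sumbd_Q => // k; rewrite exprMn.
have := @trilinear R (fun k => cnorm (a1 k)) (fun k => m k * cnorm (W k))
  (fun k => kabs k * cnorm (Q k)) _ _ _ (fun k => cnorm_ge0 _) mW_ge0
  (fun k => mulr_ge0 (kabs_ge0 k) (cnorm_ge0 (Q k))) _ _ sumbd_a1 sumbd_mW cC.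
rewrite z1 W0 cnorm0 mulr0 => /(_ erefl erefl).
have inj : injective (fun p : Z2 * Z2 => (- p.2, p.1)).
  move=> [x1 x2] [y1 y2] e; have e1 : x1 = y1 := f_equal snd e.
  by have := f_equal fst e; rewrite /= e1 => /oppr_inj ->.
move/(sumbd_inj inj).
rewrite sqrt_tail !sqrtr_sqr (ger0_norm M0) ger0_norm ?mulr_ge0 ?addr_ge0// => tri.
apply: le_trans (sum_pair_le (zbox_uniq _) (zbox_uniq _) _ tri) _ => [k j|].
- rewrite !mem_zbox => kK jn /=; rewrite cnorm_sym// [- j + k]addrC /W kK.
  rewrite normrM (ger0_norm (m_ge0 k)).
  apply: le_trans (ler_wpM2l (m_ge0 k) (Re_le_cnorm _)) _.
  rewrite !cnormM cnormJ cnorm_real.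
  have b := beta_le j (k - j).
  have p : 0 <= m k * (cnorm (w k) * (cnorm (a1 j) * cnorm (Q (k - j)))).
    by rewrite !mulr_ge0 ?m_ge0 ?cnorm_ge0.
  have := ler_wpM2r p b; lra.
- by rewrite le_eqVlt /err; apply/orP; left; apply/eqP; ring.
Qed.

Lemma stretching_tail n :
  `|\sum_(k <- zbox K) \sum_(j <- zbox n)
      m k * Re ((w k)^*%C * ((beta j (k - j))%:C * (Q j * a2 (k - j))))| <= err.
Proof.
have [z2 _] := ha2.
have := @trilinear R (fun k => m k * cnorm (W k)) (fun k => kabs k * cnorm (a2 k))
  (fun k => cnorm (Q k)) _ _ _ mW_ge0 (fun k => mulr_ge0 (kabs_ge0 k) (cnorm_ge0 (a2 k)))
  (fun k => cnorm_ge0 (Q k)) _ _ sumbd_mW sumbd_grad_a2 sumbd_Q0.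
rewrite z2 W0 cnorm0 !mulr0 => /(_ erefl erefl).
have inj : injective (fun p : Z2 * Z2 => (p.1, p.2 - p.1)).
  move=> [x1 x2] [y1 y2] e; have e1 : x1 = y1 := f_equal fst e.
  by have := f_equal snd e; rewrite /= e1 => /addIr ->.
move/(sumbd_inj inj).
rewrite sqrt_tail !sqrtr_sqr (ger0_norm M0) ger0_norm ?mulr_ge0 ?addr_ge0// => tri.
apply: le_trans (sum_pair_le (zbox_uniq _) (zbox_uniq _) _ tri) _ => [k j|].
- rewrite !mem_zbox => kK jn /=.
  rewrite -[j - k]opprB kabsN cnorm_sym// opprB [k + (j - k)]addrC subrK /W kK.
  rewrite normrM (ger0_norm (m_ge0 k)).
  apply: le_trans (ler_wpM2l (m_ge0 k) (Re_le_cnorm _)) _.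
  rewrite !cnormM cnormJ cnorm_real.
  have b := beta_le j (k - j).
  have p : 0 <= m k * (cnorm (w k) * (cnorm (Q j) * cnorm (a2 (k - j)))).
    by rewrite !mulr_ge0 ?m_ge0 ?cnorm_ge0.
  have := ler_wpM2r p b; lra.
- by rewrite le_eqVlt /err; apply/orP; left; apply/eqP; ring.
Qed.

(** Here [w] plays the part of the velocity and the derivative falls on the
    known function [a2]. *)
Lemma stretching_main n :
  `|\sum_(k <- zbox K) \sum_(j <- zbox n)
      m k * Re ((w k)^*%C * ((beta j (k - j))%:C * (W j * a2 (k - j))))|
   <= 12 * M * (h 1 * (h 0 + tau * h 2)).
Proof.
have [z2 _] := ha2.
have bB : sumbd (fun k => kabs k * cnorm (W k) ^+ 2) (h 1 ^+ 2).
  by apply: sumbd_le (sumbd_W 1) => // k; rewrite expr1.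
have := @trilinear R (fun k => cnorm (W k)) (fun k => kabs k * cnorm (a2 k))
  (fun k => m k * cnorm (W k)) _ _ _ (fun k => cnorm_ge0 (W k))
  (fun k => mulr_ge0 (kabs_ge0 k) (cnorm_ge0 (a2 k)))
  mW_ge0 _ _ bB sumbd_grad_a2 sumbd_mW0.
rewrite z2 W0 cnorm0 !mulr0 => /(_ erefl erefl).
have inj : injective (fun p : Z2 * Z2 => (p.2, p.1 - p.2)).
  move=> [x1 x2] [y1 y2] e; have e1 : x2 = y2 := f_equal fst e.
  by have := f_equal snd e; rewrite /= e1 => /addIr ->.
move/(sumbd_inj inj).
have q0 : 0 <= 2 * (h 0 + tau * h 2).
  by rewrite mulr_ge0// addr_ge0 ?h_ge0// mulr_ge0// h_ge0.
rewrite !sqrtr_sqr (ger0_norm M0) (ger0_norm (h_ge0 _)) (ger0_norm q0) => tri.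
apply: le_trans (sum_pair_le (zbox_uniq _) (zbox_uniq _) _ tri) _ => [k j|].
- rewrite !mem_zbox => kK jn /=; rewrite [j + (k - j)]addrC subrK.
  have -> : W k = w k by rewrite /W kK.
  rewrite normrM (ger0_norm (m_ge0 k)).
  apply: le_trans (ler_wpM2l (m_ge0 k) (Re_le_cnorm _)) _.
  rewrite !cnormM cnormJ cnorm_real.
  have b := beta_le j (k - j).
  have p : 0 <= m k * (cnorm (w k) * (cnorm (W j) * cnorm (a2 (k - j)))).
    by rewrite !mulr_ge0 ?m_ge0 ?cnorm_ge0.
  have := ler_wpM2r p b; lra.
- by rewrite le_eqVlt; apply/orP; left; apply/eqP; ring.
Qed.

(** The difference of the two nonlinear terms is the transport of [w] by the
    velocity of [a1], plus the transport of [a2] by the velocity of [w]. In each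
    of them the factor [w] is cut into [W], its part in the box, and [Q]. The
    terms in [Q] are errors that tend to zero as [K] grows. *)
Lemma energy_bound n : (2 * K <= n)%N ->
  `|2 * \sum_(k <- zbox K) m k * Re ((w k)^*%C * (bilin n a1 a1 k - bilin n a2 a2 k))|
   <= 30 * M * tau * (h 1 * h 2) + 24 * M * (h 0 * h 1) + 4 * err.
Proof.
move=> nK.
pose X k j (x y : R[i]) := m k * Re ((w k)^*%C * ((beta j (k - j))%:C * (x * y))).
have XD1 k j x y z : X k j (x + y) z = X k j x z + X k j y z.
  by rewrite /X -mulrDr -ReD; congr (_ * Re _); ring.
have XD2 k j x y z : X k j x (y + z) = X k j x y + X k j x z.
  by rewrite /X -mulrDr -ReD; congr (_ * Re _); ring.
have WQ k : w k = W k + Q k by rewrite /W /Q; case: ifP; rewrite ?addr0 ?add0r.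
have e k : m k * Re ((w k)^*%C * (bilin n a1 a1 k - bilin n a2 a2 k)) =
    \sum_(j <- zbox n) X k j (a1 j) (W (k - j)) + \sum_(j <- zbox n) X k j (a1 j) (Q (k - j)) +
    \sum_(j <- zbox n) X k j (W j) (a2 (k - j)) + \sum_(j <- zbox n) X k j (Q j) (a2 (k - j)).
  rewrite /bilin -sumrB mulr_sumr Re_sum mulr_sumr -!big_split/=.
  apply: eq_bigr => j _; rewrite -XD2 -WQ -addrA -XD1 -WQ /X -mulrDr -ReD -mulrDr -mulrDr.
  by congr (m k * Re (_ * _)); rewrite -mulrBr /w; ring.
have e1 k : (supnorm k <= K)%N -> \sum_(j <- zbox n) X k j (a1 j) (W (k - j)) =
    \sum_(l <- zbox K) m k * beta (k - l) l * T k l.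
  move=> kK; rewrite (eq_bigr (fun j => if (supnorm (k - j)%R <= K)%N then
      X k j (a1 j) (w (k - j)) else 0)); last first.
    by move=> j _; rewrite /W /X; case: ifP => // _; rewrite !mulr0.
  rewrite sum_convolution_box//; apply: eq_bigr => l _.
  rewrite /X opprB [k + (l - k)]addrC subrK /T -mulrA; congr (_ * _).
  rewrite mulrCA [a1 _ * _]mulrC; move: ((w k)^*%C * (w l * a1 (k - l))) => -[x y] /=; ring.
have tr := transport_commutator; have t1 := transport_tail n.
have t2 := stretching_main n; have t3 := stretching_tail n.
rewrite (eq_bigr _ (fun k _ => e k)) !big_split/=.
rewrite -/(X _ _ _ _) in t1 t2 t3.
set S1 := \sum_(k <- zbox K) _.
have -> : S1 = \sum_(k <- zbox K) \sum_(l <- zbox K) m k * beta (k - l) l * T k l.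
  by rewrite /S1 big_seq [RHS]big_seq; apply: eq_bigr => k; rewrite mem_zbox; exact: e1.
have S2 : forall x y z u : R, `|2 * (x + y + z + u)| <= `|2 * x| + 2 * `|y| + 2 * `|z| + 2 * `|u|.
  move=> x y z u; rewrite !mulrDr.
  apply: le_trans (ler_normD _ _) _; rewrite lerD ?normrM ?(ger0_norm (_ : 0 <= 2))//.
  apply: le_trans (ler_normD _ _) _; rewrite lerD ?normrM ?(ger0_norm (_ : 0 <= 2))//.
  apply: le_trans (ler_normD _ _) _; rewrite lerD ?normrM ?(ger0_norm (_ : 0 <= 2))//.
apply: le_trans (S2 _ _ _ _) _.
have := lerD (lerD tr (lerD t1 t1)) (lerD (lerD t2 t2) (lerD t3 t3)).
lra.
Qed.

End Energy.

(** * Regularity in time of the Fourier coefficients *)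

Section IntegralCurve.
Context {R : realType}.
Local Notation leb := (@lebesgue_measure R).
Variables (g u : R -> R) (u0 : R).
Hypotheses (hg : forall t : R, 0 <= t -> leb.-integrable `[0, t] (fun s => (g s)%:E))
  (hu : forall t : R, 0 <= t -> u t = u0 + \int[leb]_(s in `[0, t]) g s).

Let F (t : R) := \int[leb]_(s in `[0, t]) g s.

Lemma integral_curve_within (T : R) : 0 < T -> {within `[0, T], continuous u}.
Proof.
move=> T0; apply: (@subspace_eq_continuous _ _ _ (fun t => u0 + F t)).
  move=> t; rewrite inE /= in_itv /= => /andP[t0 _]; exact/esym/hu.
have cF : {within `[0, T], continuous F}.
  exact: parameterized_integral_continuous (ltW T0) (hg (ltW T0)).
by move=> x; apply: cvgD; [exact: cvg_cst|exact: cF].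
Qed.

Lemma integral_curve_continuous (t : R) : 0 < t -> {for t, continuous u}.
Proof.
move=> t0; have t1 : 0 < t + 1 by rewrite addr_gt0.
apply: (within_continuous_continuous t1 (integral_curve_within t1)).
by rewrite in_itv /= t0 ltrDl ltr01.
Qed.

(** The fundamental theorem of calculus at an interior point, where the
    integrand is continuous. *)
Lemma integral_curve_derive (t : R) : 0 < t -> {for t, continuous g} -> is_derive t 1 u (g t).
Proof.
move=> t0 cg; have t1 : 0 <= t + 1 by rewrite addr_ge0// ltW.
have [dF eF] : derivable F t 1 /\ derive1 F t = g t.
  by apply: continuous_FTC1_closed (hg t1) _ _ => //; rewrite ltrDl.
rewrite derive1E in eF; have iF : is_derive t 1 F (g t) := DeriveDef dF eF.
have iG : is_derive t 1 (cst u0 + F) (g t).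
  by apply: is_derive_eq; rewrite add0r.
apply: near_eq_is_derive iG; rewrite ?oner_eq0//.
near=> s; have s0 : 0 < s by near: s; exact: lt_nbhsr.
by rewrite (hu (ltW s0)).
Unshelve. all: by end_near. Qed.

End IntegralCurve.

Section ComplexCurves.
Context {R : realType}.
Local Notation Re := complex.Re.
Local Notation Im := complex.Im.
Implicit Types (y z : R -> R[i]) (t : R).

Lemma for_continuous_ext (f g : R -> R) t : f =1 g ->
  {for t, continuous g} -> {for t, continuous f}.
Proof. by move=> /funext ->. Qed.

(** Continuity of both parts, as the field [R[i]] is only used algebraically. *)
Definition ccontinuous z t :=
  {for t, continuous (fun s => Re (z s))} /\ {for t, continuous (fun s => Im (z s))}.

Lemma ccontinuous_cst (c : R[i]) t : ccontinuous (fun=> c) t.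
Proof. by split; exact: cvg_cst. Qed.

Lemma ccontinuousD y z t : ccontinuous y t -> ccontinuous z t ->
  ccontinuous (fun s => y s + z s) t.
Proof.
move=> [y1 y2] [z1 z2]; split.
  by apply: (for_continuous_ext (fun s => ReD _ _)); exact: cvgD.
by apply: (for_continuous_ext (fun s => ImD _ _)); exact: cvgD.
Qed.

Lemma ccontinuousM y z t : ccontinuous y t -> ccontinuous z t ->
  ccontinuous (fun s => y s * z s) t.
Proof.
move=> [y1 y2] [z1 z2]; split.
  by apply: (for_continuous_ext (fun s => ReM _ _)); apply: cvgB; exact: cvgM.
by apply: (for_continuous_ext (fun s => ImM _ _)); apply: cvgD; exact: cvgM.
Qed.

Lemma ccontinuousB y z t : ccontinuous y t -> ccontinuous z t ->
  ccontinuous (fun s => y s - z s) t.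
Proof.
move=> yc zc; rewrite (_ : (fun s => _) = fun s => y s + (- 1) * z s).
  exact: ccontinuousD yc (ccontinuousM (ccontinuous_cst _ _) zc).
by apply/funext => s; rewrite mulN1r.
Qed.

Lemma ccontinuous_sum (I : Type) (r : seq I) (z : I -> R -> R[i]) t :
  (forall i, ccontinuous (z i) t) -> ccontinuous (fun s => \sum_(i <- r) z i s) t.
Proof.
move=> zc; elim: r => [|i r IH].
  by under eq_fun do rewrite big_nil; exact: ccontinuous_cst.
by under eq_fun do rewrite big_cons; apply: ccontinuousD.
Qed.

Lemma ccontinuous_uniform_limit z t :
  (forall e : R, 0 < e -> exists2 y, ccontinuous y t &
     \forall s \near t, cnorm (z s - y s) <= e) -> ccontinuous z t.
Proof.
have gen (p : R[i] -> R) : (forall x y : R[i], p (x - y) = p x - p y) ->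
    (forall x : R[i], `|p x| <= cnorm x) ->
    (forall e : R, 0 < e -> exists2 y, {for t, continuous (fun s => p (y s))} &
     \forall s \near t, cnorm (z s - y s) <= e) -> {for t, continuous (fun s => p (z s))}.
  move=> pB pn H; apply/cvgrPdist_le => /= e e0.
  have e3 : 0 < e / 3 by rewrite divr_gt0.
  have [y yc yz] := H _ e3.
  have d0 := nbhs_singleton yz; move/cvgrPdist_le: yc => /(_ _ e3) /= yn.
  near=> s.
  have d1 : cnorm (z s - y s) <= e / 3 by near: s.
  have d2 : `|p (y t) - p (y s)| <= e / 3.
    by near: s; exact: yn.
  have -> : p (z t) - p (z s) = p (z t - y t) - p (z s - y s) + (p (y t) - p (y s)).
    by rewrite !pB; ring.
  have b1 := le_trans (pn _) d0; have b2 := le_trans (pn _) d1.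
  apply: le_trans (ler_normD _ _) _; have := ler_normB (p (z t - y t)) (p (z s - y s)); lra.
move=> H; split.
  have p1 (x y : R[i]) : Re (x - y) = Re x - Re y by rewrite ReD ReN.
  have p2 (x : R[i]) : `|Re x| <= cnorm x by exact: Re_le_cnorm.
  by refine (gen (@complex.Re R) p1 p2 _) => e /H[y [y1 _] yz]; exists y.
have p1 (x y : R[i]) : Im (x - y) = Im x - Im y by rewrite ImD ImN.
  have p2 (x : R[i]) : `|Im x| <= cnorm x by exact: Im_le_cnorm.
by refine (gen (@complex.Im R) p1 p2 _) => e /H[y [_ y1] yz]; exists y.
Unshelve. all: by end_near. Qed.

End ComplexCurves.

Section Trajectory.
Context {R : realType}.
Local Notation Z2 := (int * int)%type.
Local Notation Re := complex.Re.
Local Notation Im := complex.Im.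
Local Notation kabs := (@kabs R).
Local Notation leb := (@lebesgue_measure R).
#[local] Opaque fourier.

Variables (kappa M : R) (f : field R) (theta : R -> field R).
Hypotheses (sol : is_solution kappa f (theta 0) theta)
  (hM : forall t : R, 0 <= t -> (Hnorm (3 / 2) (theta t) <= M%:E)%E).
Let a t k := fourier (theta t) k.
Let rhs t k := sqg_rhs kappa f (theta t) k.

Lemma coef_Re k :
  (forall t : R, 0 <= t -> leb.-integrable `[0, t] (fun s => (Re (rhs s k))%:E)) /\
  (forall t : R, 0 <= t -> Re (a t k) = Re (a 0 k) + \int[leb]_(s in `[0, t]) Re (rhs s k)).
Proof.
have [_ _ _ _ h] := sol; split=> t t0; have [h1 h2 h3] := h k t t0 => //.
by rewrite /a h3 ReD.
Qed.

Lemma coef_Im k :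
  (forall t : R, 0 <= t -> leb.-integrable `[0, t] (fun s => (Im (rhs s k))%:E)) /\
  (forall t : R, 0 <= t -> Im (a t k) = Im (a 0 k) + \int[leb]_(s in `[0, t]) Im (rhs s k)).
Proof.
have [_ _ _ _ h] := sol; split=> t t0; have [h1 h2 h3] := h k t t0 => //.
by rewrite /a h3 ImD.
Qed.

Lemma coef_within (T : R) k : 0 < T ->
  {within `[0, T], continuous (fun t => Re (a t k))} /\
  {within `[0, T], continuous (fun t => Im (a t k))}.
Proof.
have [h1 h2] := coef_Re k; have [h3 h4] := coef_Im k => T0.
by split; [exact: integral_curve_within h1 h2 _ T0|exact: integral_curve_within h3 h4 _ T0].
Qed.

Lemma coef_continuous (t : R) k : 0 < t -> ccontinuous (fun s => a s k) t.
Proof.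
have [h1 h2] := coef_Re k; have [h3 h4] := coef_Im k => t0.
by split; [exact: integral_curve_continuous h1 h2 _ t0|exact: integral_curve_continuous h3 h4 _ t0].
Qed.

Lemma sqrt_inv_small (c e : R) : 0 <= c -> 0 < e -> exists m : nat,
  forall n, (m <= n)%N -> c / Num.sqrt n.+1%:R <= e.
Proof.
move=> c0 e0; exists (Num.truncn ((c / e) ^+ 2)).+1 => n mn.
rewrite ler_pdivrMr ?sqrtr_gt0// mulrC -ler_pdivrMr//.
rewrite -(ger0_norm (divr_ge0 c0 (ltW e0))) -sqrtr_sqr ler_wsqrtr//.
have := truncnS_gt ((c / e) ^+ 2); move/ltW/le_trans; apply.
by rewrite ler_nat (leq_trans mn).
Qed.

(** A limit of the finite sums [bilin], uniform in time by [advection_bilin]. *)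
Lemma advection_continuous (t : R) k : 0 < t ->
  ccontinuous (fun s => fourier (advection (theta s)) k) t.
Proof.
move=> t0; apply: ccontinuous_uniform_limit => e e0.
have [n /(_ n (leqnn n)) hn] := sqrt_inv_small (mulr_ge0 (ler0n R 4) (sqr_ge0 M)) e0.
exists (fun s => bilin n (a s) (a s) k).
  apply: ccontinuous_sum => j; apply: ccontinuousM; first exact: ccontinuous_cst.
  by apply: ccontinuousM; exact: coef_continuous.
near=> s.
have s0 : 0 <= s by apply: ltW; near: s; exact: lt_nbhsr.
have [st h] := Hnorm32_h32 (hM s0).
by apply: le_trans (advection_bilin st h n k) _; rewrite mulrA.
Unshelve. all: by end_near. Qed.

Lemma rhsE (t : R) k : 0 <= t ->
  rhs t k = fourier f k - fourier (advection (theta t)) k - (kappa * kabs k)%:C * a t k.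
Proof.
move=> t0; have [st h] := Hnorm32_h32 (hM t0).
by rewrite /rhs /sqg_rhs (Lambda1_coef st h) mulrA -rmorphM.
Qed.

Lemma rhs_continuous (t : R) k : 0 < t -> ccontinuous (fun s => rhs s k) t.
Proof.
move=> t0; apply: ccontinuous_uniform_limit => e e0.
exists (fun s => fourier f k - fourier (advection (theta s)) k - (kappa * kabs k)%:C * a s k).
  apply: ccontinuousB.
    by apply: ccontinuousB; [exact: ccontinuous_cst|exact: advection_continuous].
  by apply: ccontinuousM; [exact: ccontinuous_cst|exact: coef_continuous].
near=> s.
have s0 : 0 <= s by apply: ltW; near: s; exact: lt_nbhsr.
by rewrite rhsE// subrr cnorm0 ltW.
Unshelve. all: by end_near. Qed.

Lemma coef_derive (t : R) k : 0 < t ->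
  is_derive t 1 (fun s => Re (a s k)) (Re (rhs t k)) /\
  is_derive t 1 (fun s => Im (a s k)) (Im (rhs t k)).
Proof.
move=> t0; have [c1 c2] := rhs_continuous k t0.
have [h1 h2] := coef_Re k; have [h3 h4] := coef_Im k.
split.
  exact: (@integral_curve_derive R (fun s => Re (rhs s k)) (fun s => Re (a s k)) _ h1 h2).
exact: (@integral_curve_derive R (fun s => Im (rhs s k)) (fun s => Im (a s k)) _ h3 h4).
Qed.

End Trajectory.

(** * Smoothing of the difference of two trajectories *)

Section Smoothing.
Context {R : realType}.
Local Notation Z2 := (int * int)%type.
Local Notation Re := complex.Re.
Local Notation Im := complex.Im.
Local Notation kabs := (@kabs R).
#[local] Opaque fourier.

Lemma is_derive_affine (a b t : R) : is_derive t 1 (cst a + cst b * id : R -> R) b.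
Proof.
apply: is_derive_eq (is_deriveD (is_derive_cst _ _ _)
  (is_deriveM (is_derive_cst _ _ _) (is_derive_id _ _))) _.
by rewrite scaler0 addr0 add0r /GRing.scale /= mulr1.
Qed.

(** The linear factor [1 - L t] replaces the exponential: its product with
    [phi + eps / L] does not increase, and at the time [T] it still is
    [1 / 2]. *)
Lemma linear_gronwall (phi dphi : R -> R) (L eps T : R) :
  0 < L -> T = (2 * L)^-1 -> 0 <= eps ->
  {within `[0, T], continuous phi} ->
  (forall t : R, 0 < t < T ->
    [/\ is_derive t 1 phi (dphi t), dphi t <= L * phi t + eps & 0 <= phi t]) ->
  phi T <= 2 * phi 0 + eps / L.
Proof.
move=> L0 TE e0 cphi dphi_le.
have T0 : 0 < T by rewrite TE invr_gt0 mulr_gt0.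
have LT : L * T = 2^-1 by rewrite TE; field; rewrite lt0r_neq0.
(* The affine function is written with operations on functions, which have rules
   of derivation. *)
pose psi := (phi + cst (eps / L)) * (cst 1 + cst (- L) * id) : R -> R.
have : exists2 c, c \in `]0, T[%R & psi T - psi 0 =
    ((phi c + eps / L) * (- L) + (1 - L * c) * dphi c) * (T - 0).
  apply: (@MVT R psi (fun t => (phi t + eps / L) * (- L) + (1 - L * t) * dphi t)) => //.
- move=> t tT; have [|d _ _] := dphi_le t; first by move: tT; rewrite in_itv.
  have d1 : is_derive t 1 (phi + cst (eps / L)) (dphi t) by apply: is_derive_eq; rewrite addr0.
  have d2 := is_derive_affine 1 (- L) t.
  apply: is_derive_eq (is_deriveM d1 d2) _.
  rewrite /GRing.scale /=; cbn; ring.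
- move=> t; apply: cvgM.
    by apply: cvgD; [exact: cphi|exact: cvg_cst].
  apply: (@continuous_subspaceT _ _ _ (cst 1 + cst (- L) * id : R -> R)) => x.
  by apply: cvgD; [exact: cvg_cst|apply: cvgM; [exact: cvg_cst|exact: cvg_id]].
move=> [c cT].
have [|_ dc p0] := dphi_le c; first by move: cT; rewrite in_itv.
move: cT; rewrite in_itv /= => /andP[c0 cT].
have q0 : 0 <= eps / L by rewrite divr_ge0// ltW.
have qL : L * (eps / L) = eps by field; rewrite lt0r_neq0.
rewrite /psi /= /cst subr0 => e.
have e' : (phi T + eps / L) * (1 - L * T) - (phi 0 + eps / L) =
  ((phi c + eps / L) * (- L) + (1 - L * c) * dphi c) * T.
  by rewrite -e; cbn; ring.
have Lc : 0 <= 1 - L * c.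
  have := ler_wpM2l (ltW L0) (ltW cT); rewrite LT; lra.
have : (phi c + eps / L) * (- L) + (1 - L * c) * dphi c <= 0.
  have := ler_wpM2l Lc dc.
  have := mulr_ge0 (mulr_ge0 (ltW L0) (ltW c0)) (addr_ge0 (mulr_ge0 (ltW L0) p0) e0).
  move: qL; move: (eps / L) (phi c) (dphi c) => q p d qL; nra.
move/(ler_wpM2r (ltW T0)); rewrite -e' LT mul0r; lra.
Qed.

Lemma is_derive_seq_sum (I : Type) (r : seq I) (F : I -> R -> R) (dF : I -> R) (t : R) :
  (forall i, is_derive t 1 (F i) (dF i)) ->
  is_derive t 1 (fun s => \sum_(i <- r) F i s) (\sum_(i <- r) dF i).
Proof.
move=> h; elim: r => [|i r IH].
  rewrite big_nil (_ : (fun s => _) = cst 0); first exact: is_derive_cst.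
  by apply/funext => s; rewrite big_nil.
rewrite big_cons (_ : (fun s => _) = F i + (fun s => \sum_(j <- r) F j s)).
  exact: is_deriveD.
by apply/funext => s; rewrite big_cons.
Qed.

Lemma within_continuous_seq_sum (I : Type) (r : seq I) (F : I -> R -> R) (A : set R) :
  (forall i, {within A, continuous (F i)}) ->
  {within A, continuous (fun s => \sum_(i <- r) F i s)}.
Proof.
move=> h; elim: r => [|i r IH].
  rewrite (_ : (fun s => _) = cst 0); first by move=> t; exact: cvg_cst.
  by apply/funext => s; rewrite big_nil.
rewrite (_ : (fun s => _) = F i + (fun s => \sum_(j <- r) F j s)).
  by move=> t; apply: cvgD; [exact: h|exact: IH].
by apply/funext => s; rewrite big_cons.
Qed.

Variables (kappa M L T : R) (f : field R) (th1 th2 : R -> field R).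
Hypotheses (kappa0 : 0 < kappa) (M0 : 0 < M)
  (LE : L = 225%:R * M ^+ 2 / kappa) (TE : T = (2 * L)^-1)
  (sol1 : is_solution kappa f (th1 0) th1) (sol2 : is_solution kappa f (th2 0) th2)
  (hM1 : forall t : R, 0 <= t -> (Hnorm (3 / 2) (th1 t) <= M%:E)%E)
  (hM2 : forall t : R, 0 <= t -> (Hnorm (3 / 2) (th2 t) <= M%:E)%E).

Let w t k := fourier (th1 t) k - fourier (th2 t) k.
Let N t k := fourier (advection (th1 t)) k - fourier (advection (th2 t)) k.
Let err K := 24 * (1 + kappa * T) * M ^+ 3 / Num.sqrt K.+1%:R.
Let E K (j : nat) (t : R) := \sum_(k <- zbox K) kabs k ^+ j * cnorm (w t k) ^+ 2.
Let Phi K (t : R) := \sum_(k <- zbox K) (1 + kappa * t * kabs k) * cnorm (w t k) ^+ 2.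

Lemma L_gt0 : 0 < L.
Proof.
have h : 0 < 225%:R :> R by rewrite ltr0n.
by rewrite LE; exact: divr_gt0 (mulr_gt0 h (exprn_gt0 2 M0)) kappa0.
Qed.

Lemma T_gt0 : 0 < T.
Proof. by rewrite TE invr_gt0 mulr_gt0// L_gt0. Qed.

Lemma E_ge0 K j t : 0 <= E K j t.
Proof.
by rewrite sumr_ge0// => k _; rewrite mulr_ge0// exprn_ge0 ?kabs_ge0 ?cnorm_ge0.
Qed.

Lemma PhiE K t : Phi K t = E K 0 t + kappa * t * E K 1 t.
Proof.
by rewrite /Phi /E mulr_sumr -big_split/=; apply: eq_bigr => k _; ring.
Qed.

Lemma Phi_ge0 K t : 0 <= t -> 0 <= Phi K t.
Proof. by move=> t0; rewrite PhiE addr_ge0 ?E_ge0// !mulr_ge0 ?E_ge0// ltW. Qed.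

(** The limit of [energy_bound] as the truncation of the convolution disappears,
    the products of norms being split by the inequality of arithmetic and
    geometric means. *)
Lemma advection_energy K t : 0 <= t <= T ->
  `|2 * \sum_(k <- zbox K) (1 + kappa * t * kabs k) * Re ((w t k)^*%C * N t k)|
  <= kappa * t * (kappa * E K 2 t + L * E K 1 t) + (kappa * E K 1 t + L * E K 0 t)
     + 4 * err K.
Proof.
move=> /andP[t0 tT].
have [s1 h1] := Hnorm32_h32 (hM1 t0); have [s2 h2] := Hnorm32_h32 (hM2 t0).
have tau0 : 0 <= kappa * t by rewrite mulr_ge0// ltW.
set G := (leRHS); set S := \sum_(k <- _) _.
(* The error committed on the whole sum is [c / sqrt (n + 1)]. *)
pose c := 16 * M ^+ 2 * \sum_(k <- zbox K) (1 + kappa * t * kabs k) * cnorm (w t k).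
have cnorm4 (p1 p2 q1 q2 : R[i]) :
    cnorm (p1 - p2 + (q2 - q1)) <= cnorm (p1 - q1) + cnorm (p2 - q2).
  have -> : p1 - p2 + (q2 - q1) = (p1 - q1) + (-1)%:C * (p2 - q2).
    by rewrite rmorphN1; ring.
  by apply: le_trans (cnormD _ _) _; rewrite cnormM cnorm_real normrN1 mul1r.
have m0 k : 0 <= 1 + kappa * t * kabs k by rewrite addr_ge0// mulr_ge0// kabs_ge0.
have c0 : 0 <= c.
  apply: mulr_ge0; first by rewrite mulr_ge0// sqr_ge0.
  by apply: sumr_ge0 => k _; rewrite mulr_ge0// cnorm_ge0.
apply/ler_addgt0Pr => e e0.
have [n0 hn] := sqrt_inv_small c0 e0.
pose n := maxn n0 (2 * K)%N.
have nc := hn n (leq_maxl _ _).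
have := @energy_bound R _ _ M (kappa * t) (conj_sym_fourier s1) (conj_sym_fourier s2)
  h1 h2 (ltW M0) tau0 K n (leq_maxr _ _).
set S' := \sum_(k <- _) _; rewrite -/(w t) -/(E K 1 t) -/(E K 2 t) -/(E K 0 t) => bS.
have dS : `|2 * S - 2 * S'| <= c / Num.sqrt n.+1%:R.
  have -> : c / Num.sqrt n.+1%:R = 2 * \sum_(k <- zbox K) (1 + kappa * t * kabs k) *
      (cnorm (w t k) * (8 * (M ^+ 2 / Num.sqrt n.+1%:R))).
    under eq_bigr do rewrite mulrA; rewrite -mulr_suml /c; ring.
  rewrite -mulrBr normrM ger0_norm// ler_wpM2l// /S /S' -sumrB.
  apply: le_trans (ler_norm_sum _ _ _) _; apply: ler_sum => k _.
  rewrite -mulrBr normrM (ger0_norm (m0 k)) ler_wpM2l//.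
  rewrite -ReN -ReD -mulrN -mulrDr.
  apply: le_trans (Re_le_cnorm _) _; rewrite cnormM cnormJ ler_wpM2l ?cnorm_ge0//.
  rewrite opprB /N; have d1 := advection_bilin s1 h1 n k; have d2 := advection_bilin s2 h2 n k.
  apply: le_trans (cnorm4 _ _ _ _) _; apply: le_trans (lerD d1 d2) _.
  by rewrite -mulrDl -natrD.
have dG : `|2 * S'| <= G.
  apply: le_trans bS _; rewrite /G.
  have amgm x y : 30 * M * (x * y) <= kappa * y ^+ 2 + L * x ^+ 2.
    have -> : kappa * y ^+ 2 + L * x ^+ 2 =
      30 * M * (x * y) + (kappa * y - 15 * M * x) ^+ 2 / kappa.
      by rewrite LE; field; rewrite lt0r_neq0.
    by rewrite lerDl divr_ge0 ?sqr_ge0// ltW.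
  have r j : Num.sqrt (E K j t) ^+ 2 = E K j t by rewrite sqr_sqrtr ?E_ge0.
  have := amgm (Num.sqrt (E K 1 t)) (Num.sqrt (E K 2 t)); rewrite !r => a1.
  have := amgm (Num.sqrt (E K 0 t)) (Num.sqrt (E K 1 t)); rewrite !r => a2.
  have aa := ler_wpM2l tau0 a1.
  have p : 0 <= M * (Num.sqrt (E K 0 t) * Num.sqrt (E K 1 t)).
    by rewrite !mulr_ge0 ?sqrtr_ge0// ltW.
  have er : 24 * (1 + kappa * t) * M ^+ 3 / Num.sqrt K.+1%:R <= err K.
    rewrite /err ler_wpM2r ?invr_ge0 ?sqrtr_ge0// ler_wpM2r ?exprn_ge0 ?(ltW M0)//.
    by rewrite ler_wpM2l// lerD2l ler_wpM2l// ltW.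
  apply: lerD; last by rewrite ler_wpM2l.
  apply: lerD; first by apply: le_trans aa; rewrite le_eqVlt; apply/orP; left; apply/eqP; ring.
  by apply: le_trans a2; rewrite -2!(mulrA _ M) ler_wpM2r// ler_nat.
have := ler_normD (2 * S - 2 * S') (2 * S'); rewrite subrK; lra.
Qed.

Let V t k := - N t k - (kappa * kabs k)%:C * w t k.
Let dPhi K (t : R) := \sum_(k <- zbox K) (kappa * kabs k * cnorm (w t k) ^+ 2 +
  (1 + kappa * t * kabs k) * (2 * Re ((w t k)^*%C * V t k))).

Lemma ReB (x y : R[i]) : Re (x - y) = Re x - Re y. Proof. by rewrite ReD ReN. Qed.

Lemma ImB (x y : R[i]) : Im (x - y) = Im x - Im y. Proof. by rewrite ImD ImN. Qed.

Lemma Phi_derive K (t : R) : 0 < t -> is_derive t 1 (Phi K) (dPhi K t).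
Proof.
move=> t0; apply: is_derive_seq_sum => k.
have [x1 y1] := coef_derive sol1 hM1 k t0; have [x2 y2] := coef_derive sol2 hM2 k t0.
have e1 := @rhsE R kappa M f th1 hM1 t k (ltW t0); have e2 := @rhsE R kappa M f th2 hM2 t k (ltW t0).
have eV : sqg_rhs kappa f (th1 t) k - sqg_rhs kappa f (th2 t) k = V t k.
  have sub_rhs (x p q c y z : R[i]) :
    (x - p - c * y) - (x - q - c * z) = - (p - q) - c * (y - z) by ring.
  by rewrite e1 e2 sub_rhs.
have eRe := etrans (f_equal (@complex.Re R) (esym eV)) (ReB _ _).
have eIm := etrans (f_equal (@complex.Im R) (esym eV)) (ImB _ _).
pose X s := Re (w s k); pose Y s := Im (w s k).
have dX : is_derive t 1 X (Re (V t k)).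
  rewrite (_ : X = (fun s => Re (fourier (th1 s) k)) - (fun s => Re (fourier (th2 s) k))).
    exact: is_derive_eq (is_deriveB x1 x2) (esym eRe).
  by apply/funext => s; rewrite /X /w ReD ReN.
have dY : is_derive t 1 Y (Im (V t k)).
  rewrite (_ : Y = (fun s => Im (fourier (th1 s) k)) - (fun s => Im (fourier (th2 s) k))).
    exact: is_derive_eq (is_deriveB y1 y2) (esym eIm).
  by apply/funext => s; rewrite /Y /w ImD ImN.
rewrite (_ : (fun s => _) = (cst 1 + cst (kappa * kabs k) * id) * (X * X + Y * Y)); last first.
  by apply/funext => s; rewrite sqr_cnorm /X /Y; cbn; ring.
apply: is_derive_eq (is_deriveM (is_derive_affine _ _ _)
  (is_deriveD (is_deriveM dX dX) (is_deriveM dY dY))) _.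
rewrite sqr_cnorm /X /Y ReM ReJ ImJ /GRing.scale /=; cbn; ring.
Qed.

Lemma Phi_within K : {within `[0, T], continuous (Phi K)}.
Proof.
apply: within_continuous_seq_sum => k.
have [x1 y1] := coef_within sol1 k T_gt0; have [x2 y2] := coef_within sol2 k T_gt0.
have cx : {within `[0, T], continuous (fun s => Re (w s k))}.
  rewrite (_ : (fun s => _) = (fun s => Re (fourier (th1 s) k)) - (fun s => Re (fourier (th2 s) k))).
    by move=> s; apply: cvgB; [exact: x1|exact: x2].
  by apply/funext => s; rewrite /w ReD ReN.
have cy : {within `[0, T], continuous (fun s => Im (w s k))}.
  rewrite (_ : (fun s => _) = (fun s => Im (fourier (th1 s) k)) - (fun s => Im (fourier (th2 s) k))).
    by move=> s; apply: cvgB; [exact: y1|exact: y2].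
  by apply/funext => s; rewrite /w ImD ImN.
rewrite (_ : (fun s => _) = (cst 1 + cst (kappa * kabs k) * id) *
    ((fun s => Re (w s k)) * (fun s => Re (w s k)) + (fun s => Im (w s k)) * (fun s => Im (w s k)))).
  move=> s; apply: cvgM; last by apply: cvgD; apply: cvgM; [exact: cx|exact: cx|exact: cy|exact: cy].
  apply: (@continuous_subspaceT _ _ _ (cst 1 + cst (kappa * kabs k) * id : R -> R)) => x.
  by apply: cvgD; [exact: cvg_cst|apply: cvgM; [exact: cvg_cst|exact: cvg_id]].
by apply/funext => s; rewrite sqr_cnorm; cbn; ring.
Qed.

(** Without its weight, the dissipation is [2 kappa E_1], where [E_j] is the sum
    with the power [|k|^j]: one half pays for the growth of the weight and the
    other, with [L E_0], for the nonlinear terms free of [t]. Those with a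
    factor [kappa t] are paid by the weighted dissipation [2 kappa^2 t E_2] and
    by [kappa t L E_1]. *)
Lemma dPhi_le K (t : R) : 0 < t < T -> dPhi K t <= L * Phi K t + 4 * err K.
Proof.
move=> /andP[t0 tT]; have tt : 0 <= t <= T by rewrite !ltW.
have := advection_energy K tt; set S := \sum_(k <- _) _ => bS.
have -> : dPhi K t = - (2 * S) - kappa * E K 1 t - 2 * (kappa * (kappa * t)) * E K 2 t.
  rewrite /dPhi /S /E !mulr_sumr -!sumrN -!big_split/=; apply: eq_bigr => k _.
  have -> : Re ((w t k)^*%C * V t k) =
      - Re ((w t k)^*%C * N t k) - kappa * kabs k * cnorm (w t k) ^+ 2.
    by rewrite sqr_cnorm /V; case: (w t k) (N t k) => x y [u v] /=; ring.
  by rewrite expr1; ring.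
have k2 : 0 <= kappa * (kappa * t) * E K 2 t by rewrite !mulr_ge0 ?E_ge0// ltW.
have := ler_norm (- (2 * S)); rewrite normrN PhiE; lra.
Qed.

(** The weight is [1] at time [0] and [1 + kappa T |k|] at time [T]: half a
    derivative is gained, for a factor [2]. *)
Lemma difference_smoothing D : sumbd (fun k => cnorm (w 0 k) ^+ 2) D ->
  sumbd (fun k => (1 + kappa * T * kabs k) * cnorm (w T k) ^+ 2) (2 * D).
Proof.
move=> hD s us; have L0 := L_gt0; have T0 := T_gt0.
have [n sn] := seq_sub_zbox s.
apply/ler_addgt0Pr => e e0.
pose c := 4 * (24 * (1 + kappa * T) * M ^+ 3) / L.
have c0 : 0 <= c.
  rewrite !mulr_ge0 ?invr_ge0 ?exprn_ge0 ?addr_ge0 ?(ltW L0) ?(ltW M0)//.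
  by rewrite mulr_ge0 ?ltW.
have [m hm] := sqrt_inv_small c0 e0.
pose K := maxn n m.
have err0 : 0 <= 4 * err K.
  rewrite !mulr_ge0 ?invr_ge0 ?sqrtr_ge0 ?exprn_ge0 ?addr_ge0 ?(ltW M0)//.
  by rewrite mulr_ge0 ?ltW.
have := @linear_gronwall (Phi K) (dPhi K) L (4 * err K) T L0 TE err0 (@Phi_within K).
have pT (t : R) : 0 < t < T -> [/\ is_derive t 1 (Phi K) (dPhi K t),
    dPhi K t <= L * Phi K t + 4 * err K & 0 <= Phi K t].
  move=> tT.
  split; [apply: Phi_derive|exact: dPhi_le|apply: Phi_ge0; apply: ltW];
    by case/andP: tT.
move=> /(_ pT).
have -> : 4 * err K / L = c / Num.sqrt K.+1%:R by rewrite /err /c; ring.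
have := hm K (leq_maxr _ _) => hK PT.
have P0 : Phi K 0 <= D.
  rewrite PhiE mulr0 mul0r addr0 /E.
  under eq_bigr do rewrite mul1r.
  exact: hD (zbox_uniq K).
apply: (@le_trans _ _ (Phi K T)); last by lra.
apply: ler_sum_sub => // [k|k ks].
  by rewrite mulr_ge0 ?sqr_ge0// addr_ge0// !mulr_ge0 ?kabs_ge0// ltW.
by rewrite (sub_zbox (leq_maxl n m))// sn.
Qed.

End Smoothing.

(** * Cells that meet a Euclidean ball *)

Section Grid.
Context {R : realType}.

Definition ndist (s j : nat) : nat := (s - j) + (j - s).

Lemma sum_half_pow_ndist (s : nat) :
  \sum_(j < s + s.+1) (2^-1 : R) ^+ ndist s j <= 3.
Proof.
rewrite big_split_ord /=.
have a m : \sum_(j < m) (2^-1 : R) ^+ (m - j) <= 1.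
  elim: m => [|m IH]; first by rewrite big_ord0.
  rewrite big_ord_recr /= subSnn expr1.
  have -> : \sum_(j < m) (2^-1 : R) ^+ (m.+1 - j) = 2^-1 * \sum_(j < m) (2^-1 : R) ^+ (m - j).
    by rewrite mulr_sumr; apply: eq_bigr => j _; rewrite subSn ?exprS// ltnW.
  lra.
have b m : \sum_(j < m) (2^-1 : R) ^+ j = 2 - 2 * 2^-1 ^+ m.
  elim: m => [|m IH]; first by rewrite big_ord0 expr0; lra.
  by rewrite big_ord_recr /= IH exprS; lra.
have -> : \sum_(i < s) (2^-1 : R) ^+ ndist s i = \sum_(i < s) 2^-1 ^+ (s - i).
  by apply: eq_bigr => i _; rewrite /ndist (eqP (ltnW (ltn_ord i) : i - s == 0)%N) addn0.
have -> : \sum_(i < s.+1) (2^-1 : R) ^+ ndist s (s + i) = \sum_(i < s.+1) 2^-1 ^+ i.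
  by apply: eq_bigr => i _; rewrite /ndist subnDA subnn sub0n add0n addKn.
have := a s; have := b s.+1; have : 0 <= (2^-1 : R) ^+ s.+1 by rewrite exprn_ge0// invr_ge0.
lra.
Qed.

(** The points of the ball are counted with the weight [2^s] times the product
    of the [2^-|z_i - s|], which is at least [1] on the ball, and the sum of
    this weight over the cube factorises. The number of points of the cube
    itself would be too large, as [s] is to be proportional to the dimension. *)
Lemma card_l1_ball (I : finType) (s : nat) :
  (#|[pred z : {ffun I -> 'I_(s + s.+1)} | (\sum_i ndist s (z i) <= s)%N]| <= 2 ^ s * 3 ^ #|I|)%N.
Proof.
rewrite -(ler_nat R) natrM !natrX -sum1_card natr_sum.
have h0 (j : nat) : 0 <= (2^-1 : R) ^+ j by rewrite exprn_ge0// invr_ge0.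
apply: (@le_trans _ _ (\sum_(z : {ffun I -> 'I_(s + s.+1)}) 2 ^+ s * \prod_i (2^-1 : R) ^+ ndist s (z i))).
  rewrite big_mkcond /=; apply: ler_sum => z _; rewrite inE.
  have p0 : 0 <= \prod_i (2^-1 : R) ^+ ndist s (z i) by rewrite prodr_ge0.
  case: ifP => zs; last by rewrite mulr_ge0// exprn_ge0.
  rewrite prodrXr; move: (\sum_i _)%N zs => m ms.
  rewrite -(subnK ms) exprD -mulrA -exprMn mulfV// expr1n mulr1 exprn_ege1//.
  by rewrite ler1n.
rewrite -mulr_sumr ler_wpM2l ?exprn_ge0//.
rewrite -(bigA_distr_bigA (fun _ (j : 'I_(s + s.+1)) => (2^-1 : R) ^+ ndist s j)).
rewrite prodr_const lerXn2r ?nnegrE ?sumr_ge0// ?sum_half_pow_ndist//.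
Qed.

Lemma leq_expl (m n e : nat) : (m <= n)%N -> (m ^ e <= n ^ e)%N.
Proof. by move=> mn; elim: e => // e IH; rewrite !expnS leq_mul. Qed.

(** The cells have side [(D / 8 d)^(1/2)], where [d] is the dimension, so that
    they have diameter [(D / 8)^(1/2)]. In units of this side, the cells that
    meet the ball are at distance at most [5 d] from the origin in the norm of
    [l^1]: therefore [card_l1_ball] applies, and their number is exponential in
    [d] and independent of [D]. *)
Lemma grid_code (I : finType) (D : R) : 0 < D ->
  exists code : (I -> R) -> 'I_(2 ^ (7 * #|I|)), forall x y : I -> R,
    \sum_i x i ^+ 2 <= 2 * D -> \sum_i y i ^+ 2 <= 2 * D -> code x = code y ->
    \sum_i (x i - y i) ^+ 2 <= D / 8.
Proof.
(* Four times the dimension for the size of the ball, and once for the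
   rounding. *)
move=> D0; set d := #|I|; pose s := (5 * d)%N.
pose B := [pred z : {ffun I -> 'I_(s + s.+1)} | (\sum_i ndist s (z i) <= s)%N].
have cB : (#|B| <= 2 ^ (7 * d))%N.
  apply: leq_trans (card_l1_ball I s) _.
  have -> : (2 ^ (7 * d) = 2 ^ s * 4 ^ d)%N.
    by rewrite (_ : 4 = 2 ^ 2)%N// -expnM -expnD /s -mulnDl.
  by rewrite leq_pmul2l ?expn_gt0// -/d leq_expl.
have s_lt : (s < s + s.+1)%N by rewrite addnS ltnS leq_addr.
(* The default value is never taken by a cell that meets the ball. *)
pose enc (z : int) : 'I_(s + s.+1) := insubd (Ordinal s_lt) (absz (z + s%:Z)%R).
have encE (z : int) : (`|z|%N <= s)%N -> enc z = (absz (z + s%:Z)%R) :> nat /\ ndist s (enc z) = `|z|%N.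
  move=> zs; have e : enc z = (absz (z + s%:Z)%R) :> nat by rewrite /enc val_insubd; case: ifP => //; lia.
  by rewrite e /ndist; split=> //; lia.
pose h := Num.sqrt (D / (8 * d%:R)).
pose cell (x : I -> R) : {ffun I -> 'I_(s + s.+1)} := [ffun i => enc (Num.floor (x i / h))].
have z0B : [ffun=> Ordinal s_lt] \in B.
  by rewrite inE big1// => i _; rewrite ffunE /ndist /= subnn.
exists (fun x => widen_ord cB (enum_rank_in z0B (cell x))) => x y hx hy e.
have [d0|d_neq0] := eqVneq d 0%N.
  rewrite big1 ?divr_ge0 ?(ltW D0)// => i _.
  by move: (d0 : #|I| = 0%N) => /card0_eq /(_ i); rewrite inE.
have d0 : 0 < (d%:R : R) by rewrite ltr0n lt0n.
have h2 : h ^+ 2 = D / (8 * d%:R) by rewrite sqr_sqrtr// divr_ge0 ?mulr_ge0// ltW.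
have h0 : 0 < h by rewrite sqrtr_gt0 divr_gt0// mulr_gt0.
have floor_sum (u : I -> R) : \sum_i u i ^+ 2 <= 2 * D ->
    (\sum_i `|Num.floor (u i / h)| <= s)%N.
  move=> hu; rewrite -(ler_nat R) natr_sum.
  apply: (@le_trans _ _ (\sum_i ((u i / h) ^+ 2 / 8 + 3))).
    apply: ler_sum => i _; move: (u i / h) => v.
    have := floor_le v; have := floorD1_gt v.
    rewrite natr_absz intrD; set z : R := (Num.floor v)%:~R.
    have -> : (`|Num.floor v|%:~R : R) = `|z| by rewrite intr_norm.
    by have := sqr_ge0 (v - 4); have := sqr_ge0 (v + 4); case: ler0P; lra.
  rewrite big_split /= -mulr_suml sumr_const -/d.
  have -> : \sum_i (u i / h) ^+ 2 = (\sum_i u i ^+ 2) / h ^+ 2.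
    by rewrite mulr_suml; apply: eq_bigr => i _; rewrite exprMn exprVn.
  have : (\sum_i u i ^+ 2) / h ^+ 2 <= 2 * D / h ^+ 2.
    by rewrite ler_wpM2r// invr_ge0 sqr_ge0.
  have -> : 2 * D / h ^+ 2 = 16 * d%:R.
    by rewrite h2; field; rewrite !lt0r_neq0.
  by rewrite /s natrM -mulr_natr; lra.
have absz_floor_le (u : I -> R) i : \sum_i u i ^+ 2 <= 2 * D ->
    (`|Num.floor (u i / h)| <= s)%N.
  by move=> /floor_sum; apply: leq_trans; rewrite (bigD1 i)//= leq_addr.
have cellB (u : I -> R) : \sum_i u i ^+ 2 <= 2 * D -> cell u \in B.
  move=> hu; rewrite inE (eq_bigr (fun i => `|Num.floor (u i / h)|%N)) ?floor_sum//.
  by move=> i _; rewrite ffunE; have [] := encE _ (absz_floor_le u i hu).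
have {}e : cell x = cell y.
  have ei : enum_rank_in z0B (cell x) = enum_rank_in z0B (cell y).
    by apply: val_inj; exact: (f_equal val e).
  by apply: enum_rank_in_inj (cellB _ hx) (cellB _ hy) ei.
apply: (@le_trans _ _ (\sum_(i : I) h ^+ 2)).
  apply: ler_sum => i _.
  have ef : Num.floor (x i / h) = Num.floor (y i / h).
    have [ex _] := encE _ (absz_floor_le x i hx); have [ey _] := encE _ (absz_floor_le y i hy).
    have lx := absz_floor_le x i hx; have ly := absz_floor_le y i hy.
    have : (absz (Num.floor (x i / h) + s%:Z)%R) = (absz (Num.floor (y i / h) + s%:Z)%R).
      by rewrite -ex -ey; have := f_equal (fun c : {ffun I -> 'I_(s + s.+1)} => val (c i)) e; rewrite !ffunE.
    by move: lx ly; move: (Num.floor _) (Num.floor _) => p q; lia.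
  have xE : x i = x i / h * h by rewrite mulfVK// lt0r_neq0.
  have yE : y i = y i / h * h by rewrite mulfVK// lt0r_neq0.
  rewrite xE yE -mulrBl exprMn ler_piMl ?sqr_ge0//.
  have := floor_le (x i / h); have := floorD1_gt (x i / h).
  have := floor_le (y i / h); have := floorD1_gt (y i / h).
  rewrite ef intrD; move: (x i / h) (y i / h) (_%:~R) => u v z *.
  by rewrite -ler_sqrt// sqrtr_sqr sqrtr1 ler_norml; apply/andP; split; lra.
rewrite sumr_const -/d h2 -mulr_natr le_eqVlt; apply/orP; left; apply/eqP.
by field; rewrite lt0r_neq0.
Qed.

End Grid.

(** * Coverings of an invariant set in the distance of L^2 *)

Section Colorings.
Context {R : realType}.
Local Notation Z2 := (int * int)%type.
Local Notation Re := complex.Re.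
Local Notation Im := complex.Im.
Local Notation kabs := (@kabs R).
#[local] Opaque fourier.
Implicit Types (theta phi : field R) (k : Z2).

Definition l2close (D : R) theta phi :=
  sumbd (fun k => cnorm (fourier theta k - fourier phi k) ^+ 2) D.

(** A covering of [A] by [N] sets of diameter [D^(1/2)], given by the map from
    points to sets: a refinement is then a pair of maps. *)
Definition colorable (A : set (field R)) (N : nat) (D : R) :=
  exists col : field R -> 'I_N, forall theta phi, A theta -> A phi ->
    col theta = col phi -> l2close D theta phi.

Lemma weighted_squares_le (m x y : R) : 64 <= m ->
  2 * x ^+ 2 + 2 * y ^+ 2 <= 32^-1 * (m * x ^+ 2 + m * y ^+ 2).
Proof.
move=> m64; have := ler_wpM2r (addr_ge0 (sqr_ge0 x) (sqr_ge0 y)) m64; lra.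
Qed.

Lemma weighted_squares_ge0 (m x y : R) : 0 <= m ->
  0 <= 32^-1 * (m * x ^+ 2 + m * y ^+ 2).
Proof.
by move=> m0; rewrite mulr_ge0 ?invr_ge0// addr_ge0// mulr_ge0// sqr_ge0.
Qed.

Variables (A : set (field R)) (G : field R -> field R) (M tau : R) (n : nat).
Hypotheses (tau0 : 0 < tau) (hA : forall theta, A theta -> h32 (fourier theta) M)
  (GA : G @` A = A)
  (smoothing : forall theta phi D, A theta -> A phi -> l2close D theta phi ->
    sumbd (fun k => (1 + tau * kabs k) * cnorm (fourier (G theta) k - fourier (G phi) k) ^+ 2)
      (2 * D))
  (weight_high : forall k, (n < supnorm k)%N -> 64 <= 1 + tau * kabs k).

Let low : seq Z2 := rem 0 (zbox n).

Lemma size_low : size low = (4 * n * n.+1)%N.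
Proof.
by rewrite size_rem ?mem_zbox ?supnorm0// size_zbox; lia.
Qed.

Lemma sum_low (F : Z2 -> R) : F 0 = 0 -> \sum_(k <- zbox n) F k = \sum_(k <- low) F k.
Proof.
move=> F0; rewrite (perm_big _ (perm_to_rem (_ : 0 \in zbox n)))/= ?mem_zbox ?supnorm0//.
by rewrite big_cons F0 add0r.
Qed.

(** The boolean selects the real or the imaginary part. *)
Let J : finType := ('I_(size low) * bool)%type.
Let coord (v : Z2 -> R[i]) (i : J) : R :=
  let z := v (nth 0 low i.1) in if i.2 then Re z else Im z.

Lemma sum_coord (v : Z2 -> R[i]) :
  \sum_i coord v i ^+ 2 = \sum_(k <- low) cnorm (v k) ^+ 2.
Proof.
rewrite (big_nth 0) big_mkord -(pair_bigA _ (fun i b => coord v (i, b) ^+ 2))/=.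
by apply: eq_bigr => i _; rewrite big_bool /= sqr_cnorm.
Qed.

Lemma card_J : #|J| = (8 * n * n.+1)%N.
Proof. by rewrite card_prod card_ord card_bool size_low; lia. Qed.

(** A point [G phi] is coded by the color of [phi] and by the cell that contains
    the low modes of [G phi - G rho], where [rho] is the representative of this
    color. Between points with the same code, the smoothing property leaves at
    most [D / 8] in the high modes, and the cells leave at most [D / 8] in the
    low ones. *)
Lemma colorable_step N D : 0 < D -> colorable A N D ->
  colorable A (N * 2 ^ (7 * (8 * n * n.+1))) (D / 4).
Proof.
move=> D0 [col hcol]; rewrite -card_J.
have [code hcode] := @grid_code R J D D0.
(* A preimage under [G], and a representative of each color. *)
pose pre theta := xget theta [set phi | A phi /\ G phi = theta].
have preP theta : A theta -> A (pre theta) /\ G (pre theta) = theta.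
  by rewrite -{1}GA => -[phi Aphi <-]; rewrite /pre; case: xgetP => // /(_ phi) [].
pose rep (i : 'I_N) := xget (@zerof R) [set phi | A phi /\ col phi = i].
have repP phi : A phi -> A (rep (col phi)) /\ col (rep (col phi)) = col phi.
  by move=> Ap; rewrite /rep; case: xgetP => // /(_ phi) [].
pose v theta k := fourier theta k - fourier (G (rep (col (pre theta)))) k.
have hv theta : A theta -> sumbd (fun k => (1 + tau * kabs k) * cnorm (v theta k) ^+ 2) (2 * D).
  move=> At; have [Ap eG] := preP _ At; have [Ar er] := repP _ Ap.
  by rewrite /v -{1}eG; exact: smoothing Ap Ar (hcol _ _ Ap Ar (esym er)).
have w0 k : 1 <= 1 + tau * kabs k by rewrite lerDl mulr_ge0 ?kabs_ge0// ltW.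
have cE : #|{: 'I_N * 'I_(2 ^ (7 * #|J|))}| = (N * 2 ^ (7 * #|J|))%N.
  by rewrite card_prod !card_ord.
pose color theta := cast_ord cE (enum_rank (col (pre theta), code (coord (v theta)))).
exists color => theta phi At Ap e.
have [e1 e2] : col (pre theta) = col (pre phi) /\
    code (coord (v theta)) = code (coord (v phi)).
  have e' := enum_rank_inj (cast_ord_inj e).
  by have [= e1 e2] := e'; exact: conj e1 e2.
have vB k : fourier theta k - fourier phi k = v theta k - v phi k.
  by rewrite /v e1; move: (fourier _ k) (fourier _ k) (fourier _ k) => *; ring.
rewrite /l2close; under eq_fun do rewrite vB.
have F0 k : 0 <= cnorm (v theta k - v phi k) ^+ 2 by exact: sqr_ge0.
have lowb u : A u -> \sum_i coord (v u) i ^+ 2 <= 2 * D.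
  move=> Au; rewrite sum_coord; have h : sumbd (fun k => cnorm (v u k) ^+ 2) (2 * D).
    apply: sumbd_le (hv u Au) => [k|]; last exact: lexx.
    exact: ler_peMl (sqr_ge0 _) (w0 k).
  exact: h (rem_uniq _ (zbox_uniq n)).
have z0 : v theta 0 - v phi 0 = 0.
  by rewrite -vB; have [-> _] := hA At; have [-> _] := hA Ap; rewrite subrr.
have L : sumbd (fun k => if (supnorm k <= n)%N then cnorm (v theta k - v phi k) ^+ 2 else 0) (D / 8).
  apply: sumbd_le (sumbd_trunc n F0) => [k|]; first exact: lexx.
  rewrite sum_low; last by rewrite z0 cnorm0 expr0n.
  rewrite -(sum_coord (fun k => v theta k - v phi k)).
  rewrite (eq_bigr (fun i => (coord (v theta) i - coord (v phi) i) ^+ 2)).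
    exact: hcode (lowb _ At) (lowb _ Ap) e2.
  by move=> [i b] _; rewrite /coord /=; case: b; rewrite ?ReD ?ReN ?ImD ?ImN.
have H : sumbd (fun k => if (supnorm k <= n)%N then 0 else cnorm (v theta k - v phi k) ^+ 2) (D / 8).
  apply: sumbd_le (sumbdZ (c := 32^-1) _ (sumbdD (hv _ At) (hv _ Ap))) => [k||]; last 2 first.
  - lra.
  - by rewrite invr_ge0.
  case: leqP => kn.
    exact: weighted_squares_ge0 (le_trans ler01 (w0 k)).
  apply: le_trans (cnormB2 _ _) _.
  exact: weighted_squares_le (weight_high kn).
apply: sumbd_le (sumbdD L H) => [k|]; last lra.
by case: ifP => _; rewrite ?addr0 ?add0r.
Qed.

Lemma colorable_start : colorable A 1 ((2 * M) ^+ 2).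
Proof.
exists (fun=> ord0) => theta phi At Ap _.
by apply: sumbd_le (h32_le (h32_diff (hA At) (hA Ap)) (leq0n 3)) => // k; rewrite mul1r.
Qed.

Lemma colorable_iter i : 0 < M ->
  colorable A (2 ^ (7 * (8 * n * n.+1) * i)) ((2 * M) ^+ 2 / 4 ^+ i).
Proof.
move=> M0; elim: i => [|i IH].
  by rewrite muln0 expn0 expr0 divr1; exact: colorable_start.
rewrite mulnS addnC expnD [4 ^+ i.+1]exprSr invfM mulrA.
apply: colorable_step IH; rewrite divr_gt0 ?exprn_gt0// mulr_gt0//.
Qed.

End Colorings.

(** * Fractal dimension in H^1 *)

Section Dimension.
Context {R : realType}.
Local Notation Z2 := (int * int)%type.
Local Notation kabs := (@kabs R).
Local Notation area := (@area R).
#[local] Opaque fourier.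
Implicit Types (theta phi : field R) (k : Z2).

Lemma area_le64 : area <= 64.
Proof.
have p := @pihalf_lt2 R; have p0 := @pi_ge0 R.
rewrite /area (_ : 64 = (2 * 4) ^+ 2); last by lra.
by rewrite ler_sqr ?nnegrE ?mulr_ge0// ler_wpM2l//; lra.
Qed.

(** Interpolation: the distance in [L^2] controls the low modes, and the bound
    in [H^(3/2)] the high ones. *)
Lemma H1dist_le theta phi (M D : R) (K : nat) : sqint theta -> sqint phi ->
  h32 (fourier theta) M -> h32 (fourier phi) M -> l2close D theta phi ->
  (H1dist theta phi <=
     (Num.sqrt (64 * (2 * K%:R ^+ 2 * D + (2 * M) ^+ 2 / K.+1%:R)))%:E)%E.
Proof.
move=> st sp ht hp hD.
have [ss _] := fourier_subf 0 st sp.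
have e k : fourier (subf theta phi) k = fourier theta k - fourier phi k.
  by have [_ ->] := fourier_subf k st sp.
have hw := h32_diff ht hp.
set B := _ + _.
have hB : sumbd (fun k => (kabs k `^ 1 * cnorm (fourier (subf theta phi) k)) ^+ 2) B.
  apply: sumbd_le (sumbdD (sumbdZ (c := 2 * K%:R ^+ 2) _ hD) (h32_tail K hw)) => [k||].
  - rewrite powRr1 ?kabs_ge0// e exprMn; have c0 := sqr_ge0 (cnorm (fourier theta k - fourier phi k)).
    case: leqP => kK.
      rewrite addr0 ler_wpM2r// (le_trans (sqr_kabs_le _))// ler_wpM2l//.
      by rewrite ler_sqr ?nnegrE// ler_nat.
    by rewrite lerDr mulr_ge0// mulr_ge0// sqr_ge0.
  - exact: lexx.
  - by rewrite mulr_ge0// sqr_ge0.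
have B0 := sumbd_ge0 hB.
apply: le_trans (Hnorm_le ss _ hB) _; first by rewrite e; have [-> _] := hw.
by rewrite lee_fin ler_wsqrtr// ler_wpM2r// area_le64.
Qed.

Lemma H1_covered_colorable (A : set (field R)) (M D r : R) (N K : nat) :
  A !=set0 -> (forall theta, A theta -> sqint theta /\ h32 (fourier theta) M) ->
  colorable A N D -> 0 < r ->
  64 * (2 * K%:R ^+ 2 * D + (2 * M) ^+ 2 / K.+1%:R) < r ^+ 2 -> H1_covered A r N.
Proof.
move=> [a0 Aa0] hA [col hcol] r0 hr.
pose c (i : 'I_N) := xget a0 [set phi | A phi /\ col phi = i].
have cA i : A (c i) by rewrite /c; case: xgetP => // y _ [].
have cP phi : A phi -> col (c (col phi)) = col phi.
  by move=> Ap; rewrite /c; case: xgetP => [y _ []//|/(_ phi) []].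
exists c; split=> [i|phi Ap].
  have [s [z h]] := hA _ (cA i).
  apply: (@HsP R 1 _ (M ^+ 2)) => //.
  apply: sumbd_le (h32_le (conj z h) (isT : (2 <= 3)%N)) => [k|]; last exact: lexx.
  by rewrite powRr1 ?kabs_ge0// exprMn.
exists (col phi).
have [s1 h1] := hA _ Ap; have [s2 h2] := hA _ (cA (col phi)).
have close := hcol _ _ Ap (cA (col phi)) (esym (cP _ Ap)).
apply: le_lt_trans (H1dist_le K s1 s2 h1 h2 close) _.
by rewrite lte_fin -(ger0_norm (ltW r0)) -sqrtr_sqr ltr_sqrt// exprn_gt0.
Qed.

(** Here [q r] is the radius of the attractor in [H^(3/2)]. With a cutoff [K] of
    order [q^2] the high modes are smaller than [r], and then a distance of
    order [r / q^2] in [L^2] suffices for the low modes. It is obtained from the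
    initial diameter [2 q r] when this is divided by [q^3], up to a constant:
    hence the factor [3] in the dimension. *)
Lemma scale_choice (r q K Y : R) : 0 < r -> 0 < q -> 0 <= K -> K <= 2 ^+ 10 * q ^+ 2 ->
  2 ^+ 10 * q ^+ 2 < K + 1 -> (2 ^+ 16 * q ^+ 3) ^+ 2 <= Y ->
  64 * (2 * K ^+ 2 * ((2 * (q * r)) ^+ 2 / Y) + (2 * (q * r)) ^+ 2 / (K + 1)) < r ^+ 2.
Proof.
move=> r0 q0 K0 Kq qK Yq.
have q2 : 0 < q ^+ 2 by rewrite exprn_gt0.
have Z0 : 0 < (2 ^+ 16 * q ^+ 3) ^+ 2 by rewrite !exprn_gt0// mulr_gt0// exprn_gt0.
have Y0 := lt_le_trans Z0 Yq.
have K1 : 0 < K + 1 by rewrite ltr_wpDl.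
have a : (2 * q) ^+ 2 / (K + 1) <= 2^-1 ^+ 8.
  rewrite ler_pdivrMr//; apply: le_trans (ler_wpM2l _ (ltW qK)).
    by rewrite le_eqVlt; apply/orP; left; apply/eqP; field.
  by rewrite exprn_ge0// invr_ge0.
have b : 2 * K ^+ 2 * ((2 * q) ^+ 2 / Y) <= 2^-1 ^+ 9.
  rewrite mulrA ler_pdivrMr//; apply: le_trans (ler_wpM2l _ Yq); last first.
    by rewrite exprn_ge0// invr_ge0.
  have K2 : K ^+ 2 <= (2 ^+ 10 * q ^+ 2) ^+ 2.
    by rewrite ler_sqr ?nnegrE// mulr_ge0 ?exprn_ge0// ltW.
  have := ler_wpM2r (sqr_ge0 (2 * q)) (ler_wpM2l (ler0n R 2) K2).
  by move/le_trans; apply; rewrite le_eqVlt; apply/orP; left; apply/eqP; field.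
have -> : 64 * (2 * K ^+ 2 * ((2 * (q * r)) ^+ 2 / Y) + (2 * (q * r)) ^+ 2 / (K + 1)) =
    64 * (2 * K ^+ 2 * ((2 * q) ^+ 2 / Y) + (2 * q) ^+ 2 / (K + 1)) * r ^+ 2 by ring.
rewrite gtr_pMl ?exprn_gt0// [ltRHS](_ : 1 = 64 * (2^-1 ^+ 6)); last by field.
rewrite ltr_pM2l//; apply: le_lt_trans (lerD b a) _.
lra.
Qed.

(** A radius [r] requires [i] steps, where [2^i] is of order [(M / r)^3], and
    [2^(c i)] balls. *)
Lemma fractal_dim_colorable (A : set (field R)) (M : R) (c : nat) :
  0 < M -> A !=set0 ->
  (forall theta, A theta -> sqint theta /\ h32 (fourier theta) M) ->
  (forall i, colorable A (2 ^ (c * i)) ((2 * M) ^+ 2 / 4 ^+ i)) ->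
  (0 <= fractal_dim A <= (3 * c%:R)%:E)%E.
Proof.
move=> M0 A0 hA hcol.
pose C : R := 17 * ln 2 + 3 * ln M.
have ln2 : 0 < ln (2 : R) by rewrite ln_gt0// ltr1n.
have cover (r : R) : 0 < r -> r < M ->
    exists2 N : nat, H1_covered A r N /\ (0 < N)%N & ln (N%:R : R) <= c%:R * (C + 3 * ln r^-1).
  move=> r0 rM.
  have q0 : 0 < M / r by rewrite divr_gt0.
  pose X : R := 2 ^+ 16 * (M / r) ^+ 3.
  have X0 : 0 < X by rewrite mulr_gt0 ?exprn_gt0.
  have X1 : 1 <= X.
    by rewrite -[leLHS]mulr1 ler_pM// exprn_ege1// ?ler1n// ler_pdivlMr// mul1r ltW.
  have lnX : ln X = 16 * ln 2 + 3 * ln M + 3 * ln r^-1.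
    rewrite lnM ?posrE ?exprn_gt0// !lnXn// lnM ?posrE ?invr_gt0//; ring.
  pose i := (Num.truncn (ln X / ln 2)).+1.
  have iX : X <= 2 ^+ i.
    rewrite -ler_ln ?posrE ?exprn_gt0// lnXn// -[leRHS]mulr_natl -ler_pdivrMr//.
    exact: ltW (truncnS_gt _).
  have iln : i%:R * ln (2 : R) <= ln X + ln 2.
    rewrite /i -natr1 mulrDl mul1r lerD2r -ler_pdivlMr//.
    by rewrite truncn_le; exact: divr_ge0 (ln_ge0 X1) (ltW ln2).
  pose K := Num.truncn (2 ^+ 10 * (M / r) ^+ 2).
  exists (2 ^ (c * i))%N; first (split; last by rewrite expn_gt0).
    apply: (H1_covered_colorable (K := K) A0 hA (hcol i) r0).
    have p0 : 0 <= 2 ^+ 10 * (M / r) ^+ 2 by rewrite mulr_ge0 ?exprn_ge0// ltW.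
    have h1 : K%:R <= 2 ^+ 10 * (M / r) ^+ 2 by rewrite truncn_le.
    have h2 : 2 ^+ 10 * (M / r) ^+ 2 < K%:R + 1 by rewrite natr1 truncnS_gt.
    have h3 : X ^+ 2 <= 4 ^+ i.
      have e4 : (4 : R) = 2 ^+ 2 by rewrite -natrX.
      have -> : (4 : R) ^+ i = (2 ^+ i) ^+ 2 by rewrite e4 -!exprM mulnC.
      by rewrite ler_sqr ?nnegrE ?exprn_ge0 ?(ltW X0).
    have := scale_choice r0 q0 (ler0n _ _) h1 h2 h3.
    by rewrite natr1 divfK// lt0r_neq0.
  rewrite natrX lnXn// -[leLHS]mulr_natl natrM -mulrA ler_wpM2l//.
  by apply: le_trans iln _; rewrite lnX /C le_eqVlt; apply/orP; left; apply/eqP; ring.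
have [a0 Aa0] := A0.
have num_ge0 r : (0 <= lne (H1_covering_number A r))%E.
  rewrite lne_ge0; apply: le_ereal_inf_tmp => _ [N [cc [_ hc]] <-].
  have [[j jN] _] := hc _ Aa0.
  by rewrite lee_fin ler1n (leq_trans _ jN).
apply/andP; split.
  apply: le_ereal_inf_tmp => _ [V V0 <-].
  have [r [Vr r0 r1]] : exists r : R, [/\ V r, 0 < r & r < 1].
    have F : (0 : R)^'+ [set r : R | V r /\ 0 < r < 1].
      near=> r; split; first by near: r.
      by apply/andP; split; near: r; [exact: nbhs_right_gt|exact: nbhs_right_lt].
    by have [r [? /andP[? ?]]] := filter_ex F; exists r.
  apply: (@le_trans _ _ (lne (H1_covering_number A r) * ((ln r^-1)^-1)%:E)%E).
    by rewrite mule_ge0// lee_fin invr_ge0 ln_ge0// invf_ge1// ltW.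
  by apply: ereal_sup_ubound; exists r.
apply/lee_addgt0Pr => e e0.
pose P := [set r : R | [/\ 0 < r, r < M, 0 < ln r^-1 & c%:R * C <= e * ln r^-1]].
have PF : (0 : R)^'+ P.
  near=> r.
  have r0 : 0 < r by near: r; exact: nbhs_right_gt.
  have rM : r < M by near: r; exact: nbhs_right_lt.
  have r1 : r < 1 by near: r; exact: nbhs_right_lt.
  have re : r < expR (- (c%:R * C / e)) by near: r; apply: nbhs_right_lt; exact: expR_gt0.
  split=> //; first by rewrite ln_gt0// invf_gt1.
  rewrite -ler_pdivrMl// mulrC lnV ?posrE// lerNr.
  by rewrite -ler_expR lnK ?posrE// ltW.
apply: (@le_trans _ _ (ereal_sup ((fun r : R =>
    lne (H1_covering_number A r) * ((ln r^-1)^-1)%:E)%E @` P))).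
  by apply: ereal_inf_lbound; exists P.
apply: ge_ereal_sup => _ [r [r0 rM lr er] <-].
have [N [hN N0] lnN] := cover r r0 rM.
have le1 : (lne (H1_covering_number A r) <= (ln (N%:R : R))%:E)%E.
  rewrite -lne_EFin ?ltr0n// lee_lne ?in_itv/= ?leey ?andbT ?lee_fin//.
    by apply: ereal_inf_lbound; exists N.
  by apply: le_ereal_inf_tmp => _ [m _ <-]; rewrite lee_fin.
have l0 : (0 <= ((ln r^-1)^-1)%:E)%E by rewrite lee_fin invr_ge0 ltW.
apply: le_trans (lee_wpmul2r l0 le1) _.
rewrite -EFinM -EFinD lee_fin ler_pdivrMr//.
by apply: le_trans lnN _; lra.
Unshelve. all: by end_near. Qed.

End Dimension.

(** * The global attractor *)

Section AttractorDimension.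
Context {R : realType}.
Local Notation kabs := (@kabs R).
#[local] Opaque fourier.

(** The condition on [n] says that [kappa T |k|] is at least [64] beyond the
    frequency [n], for the time [T] of [difference_smoothing]. There are
    [8 n (n + 1)] real coordinates below, and [168 = 3 * 7 * 8]. *)
Lemma attractor_dim (kappa M : R) (f : field R) (S : R -> field R -> field R)
    (A : set (field R)) (n : nat) :
  0 < kappa -> 0 < M -> is_solution_map kappa f S ->
  A !=set0 -> (forall t, 0 <= t -> S t @` A = A) ->
  (forall theta, A theta -> (Hnorm (3 / 2) theta <= M%:E)%E) ->
  64%:R * (450%:R * (M ^+ 2 / kappa ^+ 2)) <= n.+1%:R ->
  (0 <= fractal_dim A <= (168 * (n * n.+1))%:R%:E)%E.
Proof.
move=> kappa0 M0 solS A0 invS hM hn.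
have hA theta : A theta -> sqint theta /\ h32 (fourier theta) M.
  by move=> /hM/Hnorm32_h32.
have AS t theta : 0 <= t -> A theta -> A (S t theta).
  by move=> t0 At; rewrite -(invS t t0); exists theta.
have H1 theta : A theta -> Hs 1 theta.
  move=> At; have [s [z h]] := hA _ At.
  apply: (@HsP R 1 _ (M ^+ 2)) => //.
  apply: sumbd_le (h32_le (conj z h) (isT : (2 <= 3)%N)) => [k|]; last exact: lexx.
  by rewrite powRr1 ?kabs_ge0// exprMn.
have sol theta : A theta -> S 0 theta = theta /\ is_solution kappa f (S 0 theta) (S ^~ theta).
  by move=> At; have [sl _] := solS _ (H1 _ At); have [e _ _ _ _] := sl; rewrite e.
pose L := 225%:R * M ^+ 2 / kappa; pose T := (2 * L)^-1.
have L0 : 0 < L := L_gt0 kappa0 M0 erefl.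
have T0 : 0 < T by rewrite invr_gt0; exact: mulr_gt0.
have tau0 : 0 < kappa * T by exact: mulr_gt0.
have dim : (0 <= fractal_dim A <= (3 * (7 * (8 * n * n.+1))%:R)%:E)%E.
  apply: (fractal_dim_colorable M0 A0 hA) => i.
  have hA2 theta : A theta -> h32 (fourier theta) M by move=> /hA[].
  apply: (@colorable_iter R A (S T) M (kappa * T) n tau0 hA2) => //.
  - exact: invS (ltW T0).
  - move=> theta phi D At Ap hD.
    have [e1 s1] := sol _ At; have [e2 s2] := sol _ Ap.
    have := @difference_smoothing R kappa M L T f (S ^~ theta) (S ^~ phi) kappa0 M0 erefl erefl
      s1 s2 (fun t t0 => hM _ (AS t _ t0 At)) (fun t t0 => hM _ (AS t _ t0 Ap)) D.
    by rewrite e1 e2; exact.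
  - move=> k nk.
    have e : kappa * T * (64%:R * (450%:R * (M ^+ 2 / kappa ^+ 2))) = 64%:R.
      by rewrite /T /L; field; rewrite (lt0r_neq0 M0) (lt0r_neq0 kappa0).
    have := ler_wpM2l (ltW tau0) hn; rewrite e => h.
    apply: le_trans h _; rewrite ler_wpDl//.
    by apply: (ler_wpM2l (ltW tau0)); rewrite (le_trans _ (supnorm_kabs _))// ler_nat.
have -> : (168 * (n * n.+1))%:R = 3 * (7 * (8 * n * n.+1))%:R :> R.
  by rewrite -natrM; congr (_%:R); lia.
exact: dim.
Qed.

End AttractorDimension.

Theorem theorem6p4 (R : realType) :
  exists c10 c11 : R, [/\ 0 < c10, 0 < c11 &
    forall (kappa : R) (f : field R) (S : R -> field R -> field R)
           (A : set (field R)) (MA : R),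
      0 < kappa ->
      Hs 1 f -> (Linfnorm f < +oo)%E ->
      is_solution_map kappa f S ->
      is_global_attractor S A ->
      is_attractor_bound S A MA ->
      let N : int := Num.ceil ((c10 * c11 * kappa ^- 2 * MA ^+ 2) ^+ 2) in
      fractal_dim A \is a fin_num /\ (fractal_dim A <= N%:~R%:E)%E].
Proof.
have c0 : 0 < 20%:R * (64%:R * 450%:R) :> R.
  by apply: mulr_gt0; [|apply: mulr_gt0]; rewrite ltr0n.
exists (20%:R * (64%:R * 450%:R)), 1; split; [exact: c0|exact: ltr01|].
move=> kappa f S A MA kappa0 f1 _ solS attr bound N.
have invS := attractor_invariant attr.
(* The attractor attracts the trajectory that starts at [f], so it has
   points. *)
have [a Aa] : A !=set0.
  have [t _ h] := attractor_attracting attr f1 ltr01.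
  by have [b Ab _] := h t (lexx t); exists b.
have hM theta : A theta -> (Hnorm (3 / 2) theta <= MA%:E)%E by move=> /bound[].
have [_ _ MA0 _] := Hnorm_leP (hM _ Aa).
set y : R := 64%:R * (450%:R * (MA ^+ 2 / kappa ^+ 2)).
have y0 : 0 <= y.
  by rewrite /y; do 2 (apply: mulr_ge0; first exact: ler0n); rewrite divr_ge0// sqr_ge0.
have [n ny dimn] : exists2 n : nat, n%:R <= y &
    (0 <= fractal_dim A <= (168 * (n * n.+1))%:R%:E)%E.
  have [MA_eq0|MA_neq0] := eqVneq MA 0.
    (* Any positive bound will do when the attractor is reduced to zero; with
       this one all the nonzero modes are high. *)
    have M0 : 0 < kappa / 450%:R by apply: divr_gt0 kappa0 _; rewrite ltr0n.
    exists 0%N; first exact: y0.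
    apply: (attractor_dim kappa0 M0 solS _ invS); first by exists a.
      by move=> theta At; apply: le_trans (hM _ At) _; rewrite lee_fin MA_eq0; exact: (ltW M0).
    have -> : 64%:R * (450%:R * ((kappa / 450%:R) ^+ 2 / kappa ^+ 2)) = 64%:R / 450%:R :> R.
      by field; rewrite (lt0r_neq0 kappa0).
    by rewrite ler_pdivrMr ?ltr0n// mul1r ler_nat.
  have M0 : 0 < MA by rewrite lt_neqAle eq_sym MA_neq0.
  exists (Num.truncn y); first by rewrite truncn_le.
  apply: (attractor_dim kappa0 M0 solS _ invS hM); first by exists a.
  by apply: ltW; exact: truncnS_gt.
have /andP[d0 dn] := dimn.
have nN : ((168 * (n * n.+1))%:R%:E <= N%:~R%:E :> \bar R)%E.
  rewrite lee_fin; apply: le_trans (ceil_ge _).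
  (* The inequality that remains is [168 n (n + 1) <= (20 n)^2]. *)
  have -> : 20%:R * (64%:R * 450%:R) * 1 / kappa ^+ 2 * MA ^+ 2 = 20%:R * y.
    by rewrite /y; ring.
  rewrite exprMn; apply: (@le_trans _ _ (20%:R ^+ 2 * n%:R ^+ 2)).
    by rewrite -!natrX -natrM ler_nat; case: (n) => // m; lia.
  by apply: ler_wpM2l; [exact: sqr_ge0|rewrite ler_sqr ?nnegrE].
split; last exact: le_trans dn nN.
by rewrite fin_numE; apply/andP; split; [rewrite gt_eqF// (lt_le_trans _ d0)// ltNyr
  |rewrite lt_eqF// (le_lt_trans dn)// ltry].
Qed.
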